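(* Let $\Delta$ be a thick irreducible spherical building of rank at least $2$ whose Coxeter diagram is simply laced (i.e. of type $\mathsf{A}_n$ ($n\ge 2$), $\mathsf{D}_n$ ($n\ge 4$), $\mathsf{E}_6$, $\mathsf{E}_7$ or $\mathsf{E}_8$), and let $\theta$ be an automorphism of $\Delta$ (equivalently, an automorphism of its long root subgroup geometry). Then $\theta$ is uniclass if and only if $\theta$ is a polar $\{1,2'\}$-kangaroo, i.e. no point $x$ of the long root subgroup geometry is mapped to a point $x^\theta$ at distance $1$ or at distance $2'$ (codistance $1$) from $x$.
   Context: Let $(\Delta,\delta)$ be a building with Coxeter system $(W,S)$ and Weyl distance $\delta$. For an automorphism $\theta$ of $\Delta$ (not necessarily type preserving) the companion automorphism $\sigma$ of the Coxeter graph is defined by $\delta(C^\theta,D^\theta)=\delta(C,D)^\sigma$. The displacement spectrum is $\mathrm{disp}(\theta)=\{\delta(C,C^\theta): C \text{ a chamber}\}$. A $\sigma$-conjugacy class in $W$ is a set $\{v^{-1}wv^\sigma : v\in W\}$. The automorphism $\theta$ is uniclass if $\mathrm{disp}(\theta)$ is contained in a single $\sigma$-conjugacy class. The long root subgroup geometry $\Gamma$ of $\Delta$ is the point-line geometry whose points are the vertices of polar type (the simple roots not perpendicular to the highest root; with Bourbaki labelling: the incident point–hyperplane pairs of the projective space for $\mathsf{A}_n$, the lines of the polar space for $\mathsf{D}_n$, and the vertices of type $2$, $1$, $8$ for $\mathsf{E}_6,\mathsf{E}_7,\mathsf{E}_8$ respectively), lines being given by panels of cotype in the polar type. It is a parapolar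 space of diameter $3$; a symplecton (symp) is a convex subspace isomorphic to a polar space. For two points $x,y$ of $\Gamma$ their mutual position is: $0$ if $x=y$; $1$ if they are distinct and collinear; $2$ if non-collinear but contained in a common symp; $2'$ if non-collinear with exactly one point collinear to both; $3$ if at distance $3$ in the collinearity graph (equivalently, opposite in the building). For $D\subseteq\{0,1,2,2',3\}$, an automorphism $\theta$ is a polar $D$-kangaroo if for every point $x$ of $\Gamma$ the mutual position of $x$ and $x^\theta$ is not in $D$. *)

(* Defs.v *)
From HB Require Import structures.
From mathcomp Require Import all_boot all_order all_fingroup.
Set Implicit Arguments. Unset Strict Implicit. Unset Printing Implicit Defensive.

(* Simply laced irreducible Coxeter/Dynkin types.  Nodes are indexed by
   'I_(rank X), node k (0-based) being the Bourbaki node k+1. *)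
Inductive sl_type : Type := TA of nat | TD of nat | TE6 | TE7 | TE8.

Definition rank (X : sl_type) : nat :=
  match X with TA n => n | TD n => n | TE6 => 6 | TE7 => 7 | TE8 => 8 end.

Definition valid_type (X : sl_type) : bool :=
  match X with TA n => 2 <= n | TD n => 4 <= n | _ => true end.

(* edges of the Coxeter (= Dynkin) diagram, Bourbaki labelling shifted by -1 *)
Definition edge (X : sl_type) (i j : nat) : bool :=
  match X with
  | TA n => j == i.+1
  | TD n => ((j == i.+1) && (j <= n - 2)) || ((i == n - 3) && (j == n - 1))
  | _ => ((i == 0) && (j == 2)) || ((i == 1) && (j == 3)) || ((2 <= i) && (j == i.+1))
  end.

Definition adj (X : sl_type) (i j : nat) : bool := edge X i j || edge X j i.

Definition cox_m (X : sl_type) (i j : nat) : nat :=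
  if i == j then 1 else if adj X i j then 3 else 2.

Definition polar (X : sl_type) (i : nat) : bool :=
  match X with
  | TA n => (i == 0) || (i == n - 1)
  | TD _ => i == 1
  | TE6 => i == 1
  | TE7 => i == 0
  | TE8 => i == 7
  end.

(* (W, s) is a Coxeter system of type X: s generates W, satisfies the Coxeter
   relations, and has the universal property of the Coxeter presentation
   (tested against finite groups, enough since spherical Coxeter groups are finite). *)
Definition coxeter_system (X : sl_type) (W : finGroupType) (s : 'I_(rank X) -> W) : Prop :=
  [/\ (<<[set s i | i : 'I_(rank X)]>> = [set: W])%g,
      (forall i j : 'I_(rank X), ((s i * s j) ^+ cox_m X i j = 1)%g) &
      (forall (G : finGroupType) (t : 'I_(rank X) -> G),
          (forall i j : 'I_(rank X), ((t i * t j) ^+ cox_m X i j = 1)%g) ->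
          exists f : W -> G, (forall x y, f (x * y)%g = (f x * f y)%g) /\
                             (forall i, f (s i) = t i))].

Definition is_length (r : nat) (W : finGroupType) (s : 'I_r -> W) (w : W) (k : nat) : Prop :=
  (exists t : seq 'I_r, size t = k /\ w = (\prod_(i <- t) s i)%g) /\
  (forall t : seq 'I_r, w = (\prod_(i <- t) s i)%g -> k <= size t).

(* Building as W-metric space (Abramenko-Brown, Def. 5.1) *)
Definition is_building (r : nat) (W : finGroupType) (s : 'I_r -> W)
    (T : Type) (delta : T -> T -> W) : Prop :=
  [/\ (forall C D, delta C D = 1%g <-> C = D),
      (forall C D C' (i : 'I_r), delta C' C = s i ->
          (delta C' D = (s i * delta C D)%g \/ delta C' D = delta C D) /\
          ((forall k, is_length s (delta C D) k -> is_length s ((s i * delta C D)%g) k.+1) ->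
             delta C' D = (s i * delta C D)%g)) &
      (forall C D (i : 'I_r), exists C', delta C' C = s i /\ delta C' D = (s i * delta C D)%g)].

Definition thick (r : nat) (W : finGroupType) (s : 'I_r -> W)
    (T : Type) (delta : T -> T -> W) : Prop :=
  forall C (i : 'I_r), exists D1 D2, D1 <> D2 /\ delta C D1 = s i /\ delta C D2 = s i.

Definition building_aut (X : sl_type) (W : finGroupType) (s : 'I_(rank X) -> W)
    (T : Type) (delta : T -> T -> W) (theta : T -> T)
    (sigma : {perm 'I_(rank X)}) (phi : W -> W) : Prop :=
  [/\ bijective theta,
      (forall x y, phi (x * y)%g = (phi x * phi y)%g),
      (forall i, phi (s i) = s (sigma i)) &
      (forall C D, delta (theta C) (theta D) = phi (delta C D))].

Definition uniclass (W : finGroupType) (T : Type) (delta : T -> T -> W)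
    (theta : T -> T) (phi : W -> W) : Prop :=
  exists w0 : W, forall C, exists v : W, delta C (theta C) = (v^-1 * w0 * phi v)%g.

(* Long root subgroup geometry.  A point is a vertex of polar type, i.e. a
   residue of type I \ P; we represent it by any chamber in it. *)
Section LRG.
Variables (X : sl_type) (W : finGroupType) (s : 'I_(rank X) -> W)
          (T : Type) (delta : T -> T -> W).

Definition WJ : {set W} := (<<[set s j | j : 'I_(rank X) & ~~ polar X j]>>)%g.

Definition same_point (C D : T) : Prop := delta C D \in WJ.

(* distinct points, both containing a chamber of a common panel of cotype j,
   j in the polar type (these panels give the lines) *)
Definition collinear (C D : T) : Prop :=
  ~ same_point C D /\
  exists C' D' (j : 'I_(rank X)), polar X j /\ same_point C C' /\ same_point D D' /\
     (delta C' D' = 1%g \/ delta C' D' = s j).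

Definition pos2' (C D : T) : Prop :=
  ~ same_point C D /\ ~ collinear C D /\
  exists E, collinear C E /\ collinear E D /\
     forall E', collinear C E' -> collinear E' D -> same_point E E'.

Definition kangaroo_1_2' (theta : T -> T) : Prop :=
  forall C, ~ collinear C (theta C) /\ ~ pos2' C (theta C).
End LRG.

(* Main.v *)
(* Write D(C) for the isometry delta(C, C^theta) sigma of the root lattice, and h for the
   highest root.  The mutual position of a point and its image is determined by the inner
   product (h, D(C) h), the forbidden positions 1 and 2' being the values 1 and -1.  Hence
   theta is a kangaroo if and only if (h, D(C) h) is even for all chambers C.  We show that
   theta is uniclass if and only if D = D(C) is good, i.e. (r, D r) is even for all roots r,
   for all C.

   Within a panel of type s, the values of D are obtained from one of them by multiplying by
   s on the left, on the right, or on both sides; the building axioms and thickness impose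
   which of these actually occur.  If all D(C) are good then only conjugations occur, and
   theta is uniclass because the building is connected.  If theta is uniclass then all the
   displacements have the same parity, so the set of the D(C) is a full conjugacy class; if
   (r, D r) is odd for some r, then some conjugate of D exchanges up to sign two adjacent
   simple roots, and walking around a hexagon gives a contradiction.

   It remains to see that if h is always even, then all D(C) are good.  In types A_n and D_n
   (n >= 5), D modulo 2 is a permutation of coordinates; a permutation in the spectrum which
   is not an involution could be moved to one at which h is odd, so all are involutions, the
   spectrum is stable under conjugation, and h is conjugate to every root.  In types D_4,
   E_6, E_7, E_8 a D of maximal length among the bad ones, or a good neighbour of it, sends
   each simple root either to itself or to a negative root, and so does its inverse; it is
   then determined by the set of simple roots it fixes, and each of these finitely many
   candidates is excluded by a certificate. *)

(* The Coxeter presentation is only tested against finite groups, so it gives no direct map to the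
   isometries of the root lattice: the action is assembled from its reductions modulo p, for all
   primes p. No list of roots is used; a root is a lattice vector of norm 2.

   Goodness excludes one-sided multiplications for the following reason. If s is the reflection in
   a, then (r, s D r) = (r, D r) - (r, a)(r, D^-1 a), and for any two roots there is a root with odd
   products with both. So multiplying a good D by one reflection, on either side, makes it bad.

   The passage from h to all roots uses nothing of the building beyond the closure properties
   [disp_closed]. Type D_4 is kept apart from the other D_n because triality does not permute the
   coordinates. The good neighbour in the exceptional argument arises when a longest bad D is
   lengthened on one side only: thickness then puts a longer one-sided product into the spectrum,
   which is good by maximality, and it is this product that has the rigid form. *)
Require Import Defs.
From HB Require Import structures.
From mathcomp Require Import all_boot all_order all_fingroup all_algebra.
From mathcomp Require Import zify ring lra.
From Stdlib Require Import Classical.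

Set Implicit Arguments. Unset Strict Implicit. Unset Printing Implicit Defensive.
Import Order.TTheory GRing.Theory Num.Theory.

(** * Reflections and lattices *)

Section Form.
Local Open Scope ring_scope.
Variables (R : comNzRingType) (n : nat) (G : 'M[R]_n).

Definition form (x y : 'rV[R]_n) : R := (x *m G *m y^T) 0 0.
Definition basis (i : 'I_n) : 'rV[R]_n := delta_mx 0 i.
Definition refl (r x : 'rV[R]_n) : 'rV[R]_n := x - form x r *: r.

Lemma formDl x y z : form (x + y) z = form x z + form y z.
Proof. by rewrite /form !mulmxDl mxE. Qed.
Lemma formZl a x z : form (a *: x) z = a * form x z.
Proof. by rewrite /form -!scalemxAl mxE. Qed.
Lemma formDr x y z : form z (x + y) = form z x + form z y.
Proof. by rewrite /form linearD /= mulmxDr mxE. Qed.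
Lemma formZr a x z : form z (a *: x) = a * form z x.
Proof. by rewrite /form linearZ /= -scalemxAr mxE. Qed.
Lemma formNl x z : form (- x) z = - form x z.
Proof. by rewrite -scaleN1r formZl mulN1r. Qed.
Lemma formNr x z : form z (- x) = - form z x.
Proof. by rewrite -scaleN1r formZr mulN1r. Qed.
Lemma form_basis i j : form (basis i) (basis j) = G i j.
Proof. by rewrite /form -rowE /basis trmx_delta -colE !mxE. Qed.
Lemma form0l z : form 0 z = 0.
Proof. by rewrite -(scale0r 0) formZl mul0r. Qed.

Lemma reflD r x y : refl r (x + y) = refl r x + refl r y.
Proof. by rewrite /refl formDl scalerDl opprD addrACA. Qed.
Lemma reflZ r a x : refl r (a *: x) = a *: refl r x.
Proof. by rewrite /refl formZl scalerBr scalerA. Qed.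
Lemma reflN r x : refl r (- x) = - refl r x.
Proof. by rewrite -scaleN1r reflZ scaleN1r. Qed.

Hypothesis Gsym : G^T = G.
Lemma formC x y : form x y = form y x.
Proof.
have -> : form x y = ((x *m G *m y^T)^T) 0 0 by rewrite mxE.
by rewrite !trmx_mul trmxK Gsym mulmxA.
Qed.

Lemma refl_form r x y : form r r = 2 -> form (refl r x) (refl r y) = form x y.
Proof.
move=> h; rewrite /refl !(formDl, formDr, formNl, formNr, formZl, formZr) h (formC r y).
by ring.
Qed.
Lemma reflK r : form r r = 2 -> involutive (refl r).
Proof.
move=> h x; rewrite {1}/refl /refl !(formDl, formNl, formZl) h.
rewrite (_ : form x r - form x r * 2 = - form x r); last by ring.
by rewrite scaleNr opprK subrK.
Qed.
Lemma refl_comm r t x : form r t = 0 -> refl r (refl t x) = refl t (refl r x).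
Proof.
move=> h; have h' : form t r = 0 by rewrite formC.
by rewrite /refl !(formDl, formNl, formZl) h h' !mulr0 !subr0 addrAC.
Qed.
Lemma refl_braid r t x : form r r = 2 -> form t t = 2 -> form r t = -1 ->
  refl r (refl t (refl r x)) = refl t (refl r (refl t x)).
Proof.
move=> hr ht h; have h' : form t r = -1 by rewrite formC.
rewrite /refl !(formDl, formNl, formZl) hr ht h h'.
apply/rowP=> i; rewrite !mxE; ring.
Qed.
End Form.

(* Positive definiteness of the form is not assumed: it follows from the existence of
   [hi], the highest root, which has positive coordinates and is dominant. *)
Record rootdatum := RootDatum {
  rk : nat;
  nb : rel 'I_rk;
  nb_sym : symmetric nb;
  nb_irr : irreflexive nb;
  nb_conn : forall P : 'I_rk -> Prop, (exists i, P i) ->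
     (forall i j, nb i j -> P i -> P j) -> forall i, P i;
  cart : 'M[int]_rk := (\matrix_(i, j) if i == j then 2 else if nb i j then -1 else 0)%R;
  hi : 'rV[int]_rk;
  hi_gt0 : forall i, (0 < hi 0 i)%R;
  hi_dom : forall i, (0 <= form cart hi (basis _ i))%R;
  hi_norm : form cart hi hi = 2%R;
  rk_gt1 : 1 < rk }.

Section Lattice.
Local Open Scope ring_scope.
Variable D : rootdatum.
Local Notation n := (rk D).
Local Notation V := 'rV[int]_n.
Implicit Types (x y z r t : V) (i j k : 'I_n).

Definition B x y : int := form (cart D) x y.
Definition al i : V := basis int i.
Definition si i x : V := refl (cart D) (al i) x.

Lemma cart_sym : (cart D)^T = cart D.
Proof. by apply/matrixP=> i j; rewrite !mxE eq_sym nb_sym. Qed.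

Lemma BC x y : B x y = B y x. Proof. exact/formC/cart_sym. Qed.
Lemma BDl x y z : B (x + y) z = B x z + B y z. Proof. exact: formDl. Qed.
Lemma BDr x y z : B z (x + y) = B z x + B z y. Proof. exact: formDr. Qed.
Lemma BZl a x z : B (a *: x) z = a * B x z. Proof. exact: formZl. Qed.
Lemma BZr a x z : B z (a *: x) = a * B z x. Proof. exact: formZr. Qed.
Lemma BNl x z : B (- x) z = - B x z. Proof. exact: formNl. Qed.
Lemma BNr x z : B z (- x) = - B z x. Proof. exact: formNr. Qed.
Lemma B0l z : B 0 z = 0. Proof. exact: form0l. Qed.
Lemma B0r z : B z 0 = 0. Proof. by rewrite BC B0l. Qed.
Definition BE := (BDl, BDr, BNl, BNr, BZl, BZr, B0l, B0r).

Lemma B_al i j : B (al i) (al j) = if i == j then 2 else if nb i j then -1 else 0.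
Proof. by rewrite /B form_basis mxE. Qed.
Lemma B_alal i : B (al i) (al i) = 2. Proof. by rewrite B_al eqxx. Qed.
Lemma B_alnb i j : nb i j -> B (al i) (al j) = -1.
Proof. by rewrite B_al => h; case: eqP h => [->|_ ->//]; rewrite nb_irr. Qed.

Lemma vec_sum x : x = \sum_i x 0 i *: al i.
Proof. exact: row_sum_delta. Qed.
Lemma B_suml I (s : seq I) P (F : I -> V) z :
  B (\sum_(i <- s | P i) F i) z = \sum_(i <- s | P i) B (F i) z.
Proof. by elim/big_rec2: _ => [|i a b _ <-]; rewrite ?B0l // BDl. Qed.
Lemma B_expandl x y : B x y = \sum_i x 0 i * B (al i) y.
Proof. by rewrite {1}(vec_sum x) B_suml; apply: eq_bigr => i _; rewrite BZl. Qed.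
Lemma B_expand x y : B x y = \sum_i \sum_j x 0 i * y 0 j * cart D i j.
Proof.
rewrite B_expandl; apply: eq_bigr => i _; rewrite BC B_expandl mulr_sumr.
by apply: eq_bigr => j _; rewrite BC /B form_basis mulrA.
Qed.

Lemma coN x i : (- x) 0 i = - x 0 i. Proof. exact: mxE. Qed.
Lemma coD x y i : (x + y) 0 i = x 0 i + y 0 i. Proof. exact: mxE. Qed.
Lemma coZ a x i : (a *: x) 0 i = a * x 0 i. Proof. exact: mxE. Qed.
Lemma co0 i : (0 : V) 0 i = 0. Proof. exact: mxE. Qed.
Definition coE := (coD, coN, coZ, co0).
Lemma vecP x y : (forall i, x 0 i = y 0 i) -> x = y. Proof. by move=> h; apply/rowP=> i; exact: h. Qed.
Lemma al_coord i j : al i 0 j = (i == j)%:R.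
Proof. by rewrite mxE eqxx eq_sym. Qed.

Lemma si_eq i x : si i x = x - B x (al i) *: al i. Proof. by []. Qed.
Lemma siD i x y : si i (x + y) = si i x + si i y. Proof. exact: reflD. Qed.
Lemma siZ i a x : si i (a *: x) = a *: si i x. Proof. exact: reflZ. Qed.
Lemma siN i x : si i (- x) = - si i x. Proof. exact: reflN. Qed.
Lemma siK i : involutive (si i). Proof. by apply: reflK; exact: B_alal. Qed.
Lemma si_B i x y : B (si i x) (si i y) = B x y.
Proof. by apply: refl_form; [exact: cart_sym | exact: B_alal]. Qed.
Lemma si_Bl i x y : B (si i x) y = B x (si i y).
Proof. by rewrite -{1}(siK i y) si_B. Qed.
Lemma si_al i : si i (al i) = - al i.
Proof. by rewrite si_eq B_alal scaler_nat mulr2n opprD addrA subrr sub0r. Qed.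

Lemma even_norm x : (2 %| B x x)%Z.
Proof.
rewrite (vec_sum x); elim/big_ind: _ => [|y z|i _]; first by rewrite B0l.
- rewrite !BE (BC z y) => ? ?; lia.
- by rewrite BZl BZr B_alal mulrA dvdz_mull.
Qed.

Let q x i : rat := (x 0 i)%:~R / (hi D 0 i)%:~R.
Let d i : rat := (hi D 0 i)%:~R.

Let d_gt0 i : 0 < d i. Proof. by rewrite ltr0z hi_gt0. Qed.
Let dq x i : d i * q x i = (x 0 i)%:~R.
Proof. by rewrite /q mulrC divfK // gt_eqF // d_gt0. Qed.

(** Put x_i = d_i q_i, with d_i the coordinates of the highest root h, and use 2 q_i q_j = q_i^2 +
    q_j^2 - (q_i - q_j)^2. The weights that appear are (h, al i) and minus the off-diagonal Cartan
    entries, all nonnegative; the diagonal terms of the double sum vanish. *)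
Lemma norm_sos x : (B x x)%:~R * 2 =
  \sum_i (q x i ^+ 2 * d i * (B (hi D) (al i))%:~R) * 2 +
  \sum_i \sum_j (- (cart D i j)%:~R) * (d i * d j) * (q x i - q x j) ^+ 2.
Proof.
have cs i j : cart D i j = cart D j i by rewrite -[in LHS]cart_sym mxE.
pose F i j : rat := (cart D i j)%:~R * (d i * d j).
have e1 : (B x x)%:~R = \sum_i \sum_j F i j * (q x i * q x j).
  rewrite B_expand rmorph_sum; apply: eq_bigr => i _.
  rewrite rmorph_sum; apply: eq_bigr => j _.
  by rewrite !rmorphM /= -!dq /F; ring.
have e2 : \sum_i (q x i ^+ 2 * d i * (B (hi D) (al i))%:~R) =
          \sum_i \sum_j F i j * (q x i ^+ 2).
  apply: eq_bigr => i _; rewrite B_expandl rmorph_sum mulr_sumr.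
  by apply: eq_bigr => j _; rewrite rmorphM /= /B form_basis cs /F /d; ring.
have e3 : \sum_i \sum_j F i j * (q x i ^+ 2) = \sum_i \sum_j F i j * (q x j ^+ 2).
  rewrite exchange_big /=; apply: eq_bigr => i _; apply: eq_bigr => j _.
  by rewrite /F cs (mulrC (d j)).
have e4 : (\sum_i (q x i ^+ 2 * d i * (B (hi D) (al i))%:~R)) * 2 =
   \sum_i \sum_j F i j * (q x i ^+ 2) + \sum_i \sum_j F i j * (q x j ^+ 2).
  by rewrite -e3 e2; ring.
rewrite -mulr_suml e4 -!big_split /= e1 mulr_suml.
apply: eq_bigr => i _; rewrite mulr_suml -!big_split /=; apply: eq_bigr => j _.
by rewrite /F; ring.
Qed.

Let sos1_ge0 x i : 0 <= (q x i ^+ 2 * d i * (B (hi D) (al i))%:~R) * 2.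
Proof.
apply: mulr_ge0 => //; apply: mulr_ge0; last by rewrite ler0z hi_dom.
by apply: mulr_ge0; [exact: sqr_ge0 | exact/ltW/d_gt0].
Qed.
Let sos2_ge0 x i j : 0 <= (- (cart D i j)%:~R) * (d i * d j) * (q x i - q x j) ^+ 2.
Proof.
have [->|neij] := eqVneq i j; first by rewrite subrr expr0n mulr0.
apply: mulr_ge0; last exact: sqr_ge0.
apply: mulr_ge0; last by apply: mulr_ge0; exact/ltW/d_gt0.
by rewrite mxE (negPf neij); case: ifP.
Qed.

Lemma B_ge0 x : 0 <= B x x.
Proof.
have : 0 <= (B x x)%:~R * 2 :> rat.
  by rewrite norm_sos addr_ge0 // sumr_ge0 // => i _; rewrite sumr_ge0.
by rewrite pmulr_lge0 // ler0z.
Qed.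

(** When both sums of [norm_sos] vanish, q is constant along the edges, and it is 0 at some node not
    orthogonal to h; such a node exists since h has norm 2. Connectedness of the diagram
    concludes. *)
Lemma B_eq0 x : B x x = 0 -> x = 0.
Proof.
move=> x0; have := norm_sos x; rewrite x0 mul0r => /esym/eqP.
rewrite paddr_eq0; last 2 first.
- by rewrite sumr_ge0.
- by rewrite sumr_ge0 // => i _; rewrite sumr_ge0.
case/andP=> /eqP s1 /eqP s2.
have h1 i : (q x i ^+ 2 * d i * (B (hi D) (al i))%:~R) * 2 = 0.
  by apply: (psumr_eq0P _ s1).
have h2 i j : (- (cart D i j)%:~R) * (d i * d j) * (q x i - q x j) ^+ 2 = 0.
  have g k : 0 <= \sum_l (- (cart D k l)%:~R) * (d k * d l) * (q x k - q x l) ^+ 2.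
    by rewrite sumr_ge0.
  have h := psumr_eq0P (fun k _ => g k) s2 (i := i) isT.
  exact: (psumr_eq0P (fun l _ => sos2_ge0 x i l) h).
have [k hk] : exists k, B (hi D) (al k) != 0.
  apply: NNPP => nk; have: B (hi D) (hi D) = 0.
    rewrite B_expandl big1 // => i _; rewrite BC.
    by case: (eqVneq (B (hi D) (al i)) 0) => [->|e]; [rewrite mulr0 | case: nk; exists i].
  by rewrite /B hi_norm.
have sq0 (a b c : rat) : b != 0 -> c != 0 -> a ^+ 2 * b * c * 2 = 0 -> a = 0.
  by move=> b0 c0 /eqP; rewrite !mulf_eq0 (negPf b0) (negPf c0) !orbF orbb => /eqP.
have P i : q x i = 0.
  move: i; apply: nb_conn.
  - exists k; apply: (sq0 _ _ _ _ _ (h1 k)); first by rewrite gt_eqF.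
    by rewrite intr_eq0.
  - move=> i j ij qi; have h := h2 i j.
    have neij : i != j by apply: contraTneq ij => ->; rewrite nb_irr.
    rewrite qi sub0r mxE (negPf neij) ij in h.
    apply: oppr_inj; rewrite oppr0; apply: (sq0 _ (d i * d j) 1) => //.
      by rewrite mulf_neq0 // gt_eqF.
    by rewrite mulr1 -[RHS](mul0r 2) -h; ring.
apply/rowP=> i; rewrite mxE; apply/eqP; rewrite -(intr_eq0 rat) -dq P mulr0 //.
Qed.
End Lattice.

(** * Roots *)

Section Roots.
Local Open Scope ring_scope.
Variable D : rootdatum.
Local Notation n := (rk D).
Local Notation V := 'rV[int]_n.
Implicit Types (x y z r t : V) (i j k : 'I_n).

Definition root x := B x x == 2.
Definition pos x := [forall i, 0 <= x 0 i].
Definition ht x : int := \sum_i x 0 i.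
Definition oddz (z : int) := ~~ (2 %| z)%Z.

Lemma root_al i : root (al i). Proof. exact/eqP/B_alal. Qed.
Lemma root_hi : root (hi D). Proof. by apply/eqP; exact: hi_norm. Qed.
Lemma root_si i x : root (si i x) = root x. Proof. by rewrite /root si_B. Qed.
Lemma root_N x : root (- x) = root x. Proof. by rewrite /root !BE opprK. Qed.
Lemma root_sub x y : root x -> root y -> B x y = 1 -> root (x - y).
Proof. move=> /eqP hx /eqP hy h; apply/eqP; rewrite !BE (BC y) hx hy h; lia. Qed.
Lemma root_add x y : root x -> root y -> B x y = -1 -> root (x + y).
Proof. move=> /eqP hx /eqP hy h; apply/eqP; rewrite !BE (BC y) hx hy h; lia. Qed.
Lemma B_eq2 x y : root x -> root y -> B x y = 2 -> x = y.
Proof.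
move=> /eqP hx /eqP hy h; apply/eqP; rewrite -subr_eq0; apply/eqP/B_eq0.
rewrite !BE (BC y) hx hy h; lia.
Qed.
Lemma B_eqN2 x y : root x -> root y -> B x y = -2 -> x = - y.
Proof. by move=> hx hy h; apply: B_eq2; rewrite ?root_N // BNr h. Qed.
Lemma B_bound x y : root x -> root y -> -2 <= B x y <= 2.
Proof.
move=> /eqP hx /eqP hy; have := B_ge0 (x - y); have := B_ge0 (x + y).
rewrite !BE (BC y) hx hy; lia.
Qed.
Lemma B_lt2 x y : root x -> root y -> x <> y -> B x y <= 1.
Proof.
move=> hx hy ne; have := B_bound hx hy.
have : B x y <> 2 by move/(B_eq2 hx hy).
lia.
Qed.
Lemma root_neq0 x : root x -> x <> 0.
Proof. by move=> /eqP + e; rewrite e B0l. Qed.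

Lemma norm_ge2 x : x <> 0 -> 2 <= B x x.
Proof.
move=> x0; have h0 := B_ge0 x; have := even_norm x.
have : B x x <> 0 by move/B_eq0.
lia.
Qed.

Lemma posP x : reflect (forall i, 0 <= x 0 i) (pos x). Proof. exact: forallP. Qed.
Lemma pos_al i : pos (al i). Proof. by apply/posP=> j; rewrite al_coord; case: eqP. Qed.
Lemma pos_hi : pos (hi D). Proof. by apply/posP=> j; rewrite ltW // hi_gt0. Qed.
Lemma posD x y : pos x -> pos y -> pos (x + y).
Proof. by move=> /posP hx /posP hy; apply/posP=> i; rewrite mxE addr_ge0. Qed.

(** Write x = p - m with p and m the positive and negative parts. Their supports are disjoint, so
    (p, m) <= 0; if both were nonzero, each would have norm at least 2 and x norm at least 4. *)
Lemma root_pos x : root x -> pos x || pos (- x).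
Proof.
move=> /eqP hx; apply/negPn/negP; rewrite negb_or => /andP[/forallPn[i hi] /forallPn[j hj]].
pose p : V := \row_k Num.max (x 0 k) 0; pose m : V := \row_k Num.max (- x 0 k) 0.
have pk k : p 0 k = Num.max (x 0 k) 0 by rewrite mxE.
have mk k : m 0 k = Num.max (- x 0 k) 0 by rewrite mxE.
have e : x = p - m by apply: vecP => k; rewrite !coE pk mk; lia.
have p0 : p <> 0.
  move=> h; have := pk j; move: hj; rewrite h !coE; lia.
have m0 : m <> 0.
  move=> h; have := mk i; move: hi; rewrite h !coE; lia.
have pm : B p m <= 0.
  rewrite B_expand; apply: sumr_le0 => k _; apply: sumr_le0 => l _; rewrite pk mk mxE.
  case: eqP => [<-|_]; first by case: (leP 0 (x 0 k)) => ?; nia.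
  by case: ifP => _; [nia | rewrite mulr0].
move: hx; rewrite e !BE (BC m); have := norm_ge2 p0; have := norm_ge2 m0; lia.
Qed.
Lemma root_posN x : root x -> pos (- x) = ~~ pos x.
Proof.
move=> hx; have := root_pos hx; case: (boolP (pos x)) => //= /posP h _.
apply/negP => /posP h'; apply: (root_neq0 hx); apply: vecP => i.
by have := h i; have := h' i; rewrite !coE; lia.
Qed.
Lemma root_posP x i : root x -> 0 < x 0 i -> pos x.
Proof.
move=> hx h; apply/negPn; rewrite -root_posN //; apply/negP => /posP /(_ i).
by rewrite coE; lia.
Qed.

Lemma root_mul_al a i : root (a *: al i) -> pos (a *: al i) -> a = 1.
Proof.
move=> /eqP + /posP /(_ i); rewrite !BE B_alal coE al_coord eqxx => h; nia.
Qed.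
Lemma pos_si i x : root x -> pos x -> x <> al i -> pos (si i x).
Proof.
move=> rx px ne; have [j ji xj] : exists2 j, j != i & 0 < x 0 j.
  apply: NNPP => h; apply: ne.
  have e : x = x 0 i *: al i.
    apply: vecP => j; rewrite coE al_coord; case: (eqVneq i j) => [->|ij]; first by rewrite mulr1.
    rewrite mulr0; have /posP/(_ j) := px; case: (ltP 0 (x 0 j)) => [xj|]; last by lia.
    by case: h; exists j => //; rewrite eq_sym.
  by rewrite e (@root_mul_al (x 0 i) i) -?e // scale1r.
apply: (@root_posP _ j); first by rewrite root_si.
by rewrite si_eq !coE al_coord eq_sym (negPf ji) mulr0 subr0.
Qed.
Lemma pos_siN i x : root x -> pos (si i x) = if x == al i then false else
  if x == - al i then true else pos x.
Proof.
move=> rx; case: eqP => [->|ne].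
  by rewrite si_al root_posN ?root_al // pos_al.
case: eqP => [->|ne']; first by rewrite siN si_al opprK pos_al.
case: (boolP (pos x)) => px; first by rewrite pos_si.
have : pos (si i (- x)).
  by apply: pos_si; rewrite ?root_N ?root_posN // => h; apply: ne'; rewrite -h opprK.
by rewrite siN root_posN ?root_si // => /negPf.
Qed.

Lemma htD x y : ht (x + y) = ht x + ht y.
Proof. by rewrite /ht -big_split; apply: eq_bigr => i _; rewrite coE. Qed.
Lemma htN x : ht (- x) = - ht x.
Proof. by rewrite /ht -sumrN; apply: eq_bigr => i _; rewrite coE. Qed.
Lemma ht_al i : ht (al i) = 1.
Proof.
rewrite /ht (bigD1 i) //= al_coord eqxx big1 ?addr0 // => j ji.
by rewrite al_coord eq_sym (negPf ji).
Qed.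
Lemma ht_pos x : pos x -> 0 <= ht x.
Proof. by move=> /posP h; rewrite sumr_ge0. Qed.

Lemma B_pos_ge0 x r : pos r -> (forall i, 0 <= B x (al i)) -> 0 <= B x r.
Proof.
move=> /posP pr h; rewrite BC B_expandl sumr_ge0 // => i _.
by rewrite mulr_ge0 // BC.
Qed.
Lemma B_hi_pos r : pos r -> 0 <= B (hi D) r.
Proof. by move=> pr; apply: B_pos_ge0 => // i; exact: hi_dom. Qed.
Lemma root_desc x : root x -> pos x -> exists i, 0 < x 0 i /\ 0 < B x (al i).
Proof.
move=> /eqP rx /posP px; apply: NNPP => h; have : B x x <= 0; last by rewrite rx.
rewrite B_expandl sumr_le0 // => i _; rewrite BC.
case: (ltP 0 (x 0 i)) => xi; last first.
  by rewrite (_ : x 0 i = 0) ?mul0r //; have := px i; lia.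
case: (leP (B x (al i)) 0) => hb; first by nia.
by case: h; exists i.
Qed.

(** Two dominant roots have a positive product. If it is 1, their difference is a root, and
    whichever of the two signs makes it positive, its product with one of the dominant roots is -1.
    This is what makes diagram automorphisms fix the highest root. *)
Lemma hi_unique a : root a -> (forall i, 0 <= B a (al i)) -> a = hi D.
Proof.
move=> ra da; have pa : pos a.
  have := root_pos ra; case/orP => // pN; have := B_pos_ge0 pN da.
  by rewrite BNr; move/eqP: ra => ->.
have gt : 0 < B a (hi D).
  have [i [ai bi]] := root_desc ra pa.
  rewrite BC B_expandl (bigD1 i) //= ltr_pwDl ?mulr_gt0 ?hi_gt0 1?BC //.
  by rewrite sumr_ge0 // => j _; rewrite mulr_ge0 ?(ltW (hi_gt0 _)) // BC.
have := B_bound ra root_hi; have [e|ne _] := eqVneq (B a (hi D)) 2.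
  by move=> _; apply: B_eq2 e => //; exact: root_hi.
have e : B a (hi D) = 1 by move: (B_bound ra root_hi) ne; lia.
have rr := root_sub ra root_hi e; have := root_pos rr.
case/orP => pr.
  by have := B_hi_pos pr; rewrite !BE BC e; have /eqP -> := root_hi.
by have := B_pos_ge0 pr da; rewrite !BE e; move/eqP: ra => ->.
Qed.

Lemma nb_exists i : exists j, nb i j.
Proof.
apply: NNPP => h; have := rk_gt1 D => n1.
have all k : k = i.
  move: k; apply: nb_conn; first by exists i.
  by move=> j k + e; rewrite e => ik; case: h; exists k.
have [j ji] : exists j, j != i.
  have lt0 : (0 < n)%N by lia.
  case: (eqVneq (Ordinal lt0) i) => [e|ne]; last by exists (Ordinal lt0).
  by exists (Ordinal n1); rewrite -e.
by rewrite (all j) eqxx in ji.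
Qed.

Lemma oddz1 x y : root x -> root y -> oddz (B x y) = (B x y == 1) || (B x y == -1).
Proof.
move=> rx ry; have := B_bound rx ry; rewrite /oddz; move: (B x y) => c h.
by apply/idP/orP => [?|[] /eqP ->] //; have [] : c = 1 \/ c = -1 by [lia] => ->; [left|right].
Qed.
Lemma oddzD a b : oddz (a + b) = oddz a (+) oddz b. Proof. rewrite /oddz; lia. Qed.
Lemma oddzN a : oddz (- a) = oddz a. Proof. rewrite /oddz; lia. Qed.
Lemma oddzM a b : oddz (a * b) = oddz a && oddz b.
Proof. by rewrite /oddz !dvdzE abszM Euclid_dvdM // negb_or. Qed.

Lemma root_odd_al r : root r -> exists i, oddz (B r (al i)).
Proof.
move=> rr; wlog pr : r rr / pos r.
  move=> H; have /orP[|pr] := root_pos rr; first exact: H.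
  by have [|i] := H _ _ pr; rewrite ?root_N // BNl oddzN; exists i.
have [i [ri bi]] := root_desc rr pr.
have [e|ne] := eqVneq r (al i).
  by have [j ij] := nb_exists i; exists j; rewrite e B_alnb.
exists i; have := B_lt2 rr (root_al i) (elimN eqP ne); rewrite /oddz; lia.
Qed.

(* In the graph of roots, joined when their product is odd, the set [S] below is
   closed under adjacency, so it contains every simple root. *)
Lemma odd_two_roots r r' : root r -> root r' ->
  exists x, [/\ root x, oddz (B x r) & oddz (B x r')].
Proof.
move=> rr rr'; apply: NNPP => H.
(* Modulo 2 the root [z] is x + y, so its parities are the sums of those of [x] and [y]. *)
have add x y : root x -> root y -> oddz (B x y) -> exists2 z, root z &
    exists2 c, oddz c & z = x + c *: y.
  move=> rx ry; rewrite oddz1 // => /orP[] /eqP h.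
  - by exists (x - y); [exact: root_sub | exists (-1); rewrite // scaleN1r].
  - by exists (x + y); [exact: root_add | exists 1; rewrite // scale1r].
pose O x := [/\ root x, oddz (B x r) & ~~ oddz (B x r')].
pose T x := [/\ root x, ~~ oddz (B x r), ~~ oddz (B x r') & exists2 z, O z & oddz (B z x)].
pose S x := O x \/ T x.
have addE x c y s : oddz c -> oddz (B (x + c *: y) s) = oddz (B x s) (+) oddz (B y s).
  by move=> oc; rewrite BDl BZl oddzD oddzM oc.
have clo x y : S x -> root y -> oddz (B x y) -> S y.
  move=> [[rx o1 o2]|[rx o1 o2 [z [rz p1 p2] p3]]] ry oxy.
  - have [z rz [c oc ez]] := add _ _ rx ry oxy.
    have z1 := addE x c y r oc; have z2 := addE x c y r' oc; rewrite -ez in z1 z2.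
    case y1: (oddz (B y r)); case y2: (oddz (B y r')).
    + by case: H; exists y; split.
    + by left; split; rewrite ?y1 ?y2.
    + by case: H; exists z; split; rewrite ?z1 ?z2 ?o1 ?y1 ?y2 ?(negPf o2).
    + by right; split; rewrite ?y1 ?y2 //; exists x.
  - have [w rw [c oc ew]] := add _ _ rz rx p3.
    have w1 := addE z c x r oc; have w2 := addE z c x r' oc; have w3 := addE z c x y oc.
    rewrite -ew p1 (negPf p2) (negPf o1) (negPf o2) oxy in w1 w2 w3.
    have Ow : O w by split; rewrite ?w1 ?w2.
    case y1: (oddz (B y r)); case y2: (oddz (B y r')).
    + by case: H; exists y; split.
    + by left; split; rewrite ?y1 ?y2.
    + have [q [rq q1 q2 q3]] : exists q, [/\ root q, oddz (B q r), ~~ oddz (B q r') & oddz (B q y)].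
        case zy: (oddz (B z y)); first by exists z; split.
        by exists w; split; rewrite ?w1 ?w2 // w3 zy.
      have [u ru [c' oc' eu]] := add _ _ rq ry q3.
      case: H; exists u; split=> //; rewrite eu addE //; first by rewrite q1 y1.
      by rewrite (negPf q2) y2.
    + right; split; rewrite ?y1 ?y2 //.
      case zy: (oddz (B z y)); first by exists z.
      by exists w => //; rewrite w3 zy.
have allS i : S (al i).
  move: i; apply: nb_conn => [|i j ij Si]; last first.
    by apply: clo Si (root_al j) _; rewrite B_alnb.
  have [i oi] := root_odd_al rr; exists i; left; rewrite BC in oi; split; rewrite ?root_al //.
  by apply/negP => oi'; apply: H; exists (al i); rewrite root_al.
have [j oj] := root_odd_al rr'; rewrite BC in oj.
by case: (allS j) => [[_ _]|[_ _]]; rewrite oj.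
Qed.
End Roots.

(** * The Coxeter group *)

Definition coxm (D : rootdatum) (i j : 'I_(rk D)) : nat :=
  if i == j then 1 else if nb i j then 3 else 2.

Record coxgrp (D : rootdatum) := CoxGrp {
  cg : finGroupType;
  cs : 'I_(rk D) -> cg;
  cs_gen : (<<[set cs i | i : 'I_(rk D)]>> = [set: cg])%g;
  cs_rel : forall i j, ((cs i * cs j) ^+ coxm i j = 1)%g;
  cs_univ : forall (H : finGroupType) (t : 'I_(rk D) -> H),
    (forall i j, ((t i * t j) ^+ coxm i j = 1)%g) ->
    exists f : cg -> H, (forall x y, f (x * y)%g = (f x * f y)%g) /\ (forall i, f (cs i) = t i) }.

Section Action.
Local Open Scope ring_scope.
Variables (D : rootdatum) (W : coxgrp D).
Local Notation n := (rk D).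
Local Notation V := 'rV[int]_n.
Local Notation s := (cs W).
Implicit Types (x y z r : V) (i j k : 'I_n) (t : seq 'I_n) (w v u : cg W).

Definition wd t : cg W := (\prod_(i <- t) s i)%g.
Definition actw t x : V := foldr (@si D) x t.

Lemma wd_nil : wd [::] = 1%g. Proof. exact: big_nil. Qed.
Lemma wd_cons i t : wd (i :: t) = (s i * wd t)%g. Proof. exact: big_cons. Qed.
Lemma wd_cat t t' : wd (t ++ t') = (wd t * wd t')%g. Proof. exact: big_cat. Qed.
Lemma wd1 i : wd [:: i] = s i. Proof. exact: big_seq1. Qed.
Lemma ss i : (s i * s i = 1)%g. Proof. by have := cs_rel W i i; rewrite /coxm eqxx expg1. Qed.
Lemma sV i : ((s i)^-1 = s i)%g. Proof. by apply: (mulgI (s i)); rewrite mulgV ss. Qed.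
Lemma sK i w : (s i * (s i * w) = w)%g. Proof. by rewrite mulgA ss mul1g. Qed.
Lemma Ks i w : (w * s i * s i = w)%g. Proof. by rewrite -mulgA ss mulg1. Qed.
Lemma wd_rev t : wd (rev t) = (wd t)^-1%g.
Proof.
elim: t => [|i t IH]; first by rewrite wd_nil invg1.
by rewrite rev_cons -cats1 wd_cat IH wd1 wd_cons invMg sV.
Qed.
Lemma wordP w : exists t, w = wd t.
Proof.
have : w \in <<[set s i | i : 'I_n]>>%g by rewrite cs_gen inE.
case/gen_prodgP=> m [c hc ->]; have {}hc a : exists j, c a = s j.
  by have /imsetP[j _ ->] := hc a; exists j.
elim: m c hc => [|m IH] c hc; first by exists [::]; rewrite big_ord0 wd_nil.
rewrite big_ord_recl; have [j ->] := hc ord0.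
by have [t ->] := IH _ (fun a => hc (lift ord0 a)); exists (j :: t); rewrite wd_cons.
Qed.

Section Mod.
Variable p : nat.
Local Notation F := 'F_p.
Local Notation Gp := (map_mx intr (cart D) : 'M[F]_n).
Local Notation red := (fun x : V => map_mx intr x : 'rV[F]_n).

Let Gp_sym : Gp^T = Gp. Proof. by rewrite map_trmx cart_sym. Qed.
Let formp x y : form Gp (red x) (red y) = (form (cart D) x y)%:~R.
Proof. by rewrite /form map_trmx -!map_mxM mxE. Qed.
Let redal i : red (al i) = basis F i. Proof. exact: map_delta_mx. Qed.
Let bp i j : form Gp (basis F i) (basis F j) = (form (cart D) (al i) (al j))%:~R.
Proof. by rewrite -!redal formp. Qed.
Let bpii i : form Gp (basis F i) (basis F i) = 2.
Proof. by rewrite bp -/(B _ _) B_alal. Qed.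
Let rp i := refl Gp (basis F i).
Let rpK i : involutive (rp i). Proof. exact: reflK. Qed.
Let T i : {perm 'rV[F]_n} := perm (can_inj (rpK i)).

Let T_rel i j : ((T i * T j) ^+ coxm i j = 1)%g.
Proof.
apply/permP=> x; rewrite perm1 /coxm.
case: (eqVneq i j) => [->|ij]; first by rewrite expg1 permM !permE rpK.
case: ifP => ijn; rewrite ?expgS expg0 mulg1 !permM !permE.
- rewrite /rp refl_braid ?bpii //; first by rewrite !reflK ?bpii.
  by rewrite bp -/(B _ _) B_alnb 1?nb_sym.
- rewrite /rp (@refl_comm _ _ _ Gp_sym _ (basis F j)); first by rewrite !reflK ?bpii // ?reflK ?bpii.
  by rewrite bp -/(B _ _) B_al (negPf ij) ijn.
Qed.

(** The row vectors over ['F_p] form a finite set, so the reflections modulo p lie in a finite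
    permutation group and the universal property applies to them. *)
Lemma actw_mod t t' x : wd t = wd t' -> red (actw t x) = red (actw t' x).
Proof.
have [f [fM fs]] := @cs_univ _ W _ _ T_rel.
have f1 : f 1%g = 1%g by apply: (mulgI (f 1%g)); rewrite -fM !mulg1.
have fwd (q : seq 'I_n) (a : 'rV[F]_n) : f (wd q) a = foldl (fun b i => rp i b) a q.
  elim: q a => [|i q IH] a; first by rewrite wd_nil f1 perm1.
  by rewrite wd_cons fM fs permM permE IH.
(* Permutations compose from left to right, whereas [actw] applies the last letter first; hence the
   reversed word. *)
have red_act (q : seq 'I_n) : red (actw q x) = f (wd (rev q)) (red x).
  rewrite fwd foldl_rev; elim: q => //= i q <-.
  by rewrite /si /refl map_mxB map_mxZ /= -formp redal.
by move=> e; rewrite !red_act !wd_rev e.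
Qed.
End Mod.

(** If two coordinates differed, their difference would survive modulo any prime larger than its
    absolute value. *)
Lemma actw_wd t t' x : wd t = wd t' -> actw t x = actw t' x.
Proof.
move=> e; apply: vecP => i; apply/eqP; rewrite -subr_eq0 -absz_eq0.
set z := _ - _; have [p pz pp] := prime_above `|z|%N.
have := congr1 (fun a : 'rV['F_p]_n => a 0 i) (actw_mod p x e); rewrite /= !mxE => /eqP.
rewrite -subr_eq0 -rmorphB -/z => h.
have dv : (p %| `|z|)%N.
  rewrite (dvdn_pcharf (pchar_Fp pp)); move: h; rewrite {1}[z]intEsign rmorphM /=.
  by rewrite rmorphXn rmorphN1 mulf_eq0 signr_eq0.
by rewrite -leqn0 leqNgt; apply/negP=> z0; have := dvdn_leq z0 dv; rewrite leqNgt pz.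
Qed.

Lemma word_ex w : exists t, wd t == w.
Proof. by have [t ->] := wordP w; exists t. Qed.
Definition act w x : V := actw (xchoose (word_ex w)) x.

Lemma act_wd t x : act (wd t) x = actw t x.
Proof. by apply: actw_wd; apply/eqP; exact: (xchooseP (word_ex (wd t))). Qed.
Lemma act1 x : act 1%g x = x. Proof. by rewrite -wd_nil act_wd. Qed.
Lemma actM w v x : act (w * v)%g x = act w (act v x).
Proof.
have [t ->] := wordP w; have [q ->] := wordP v.
by rewrite -wd_cat !act_wd /actw foldr_cat.
Qed.
Lemma act_s i x : act (s i) x = si i x. Proof. by rewrite -wd1 act_wd. Qed.
Lemma actK w : cancel (act w) (act w^-1%g). Proof. by move=> x; rewrite -actM mulVg act1. Qed.
Lemma actKV w : cancel (act w^-1%g) (act w). Proof. by move=> x; rewrite -actM mulgV act1. Qed.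
Lemma act_ind (P : cg W -> Prop) : P 1%g -> (forall i w, P w -> P (s i * w)%g) -> forall w, P w.
Proof.
move=> h1 hs w; have [t ->] := wordP w.
by elim: t => [|i t IH]; rewrite ?wd_nil // wd_cons; apply: hs.
Qed.
Lemma actD w x y : act w (x + y) = act w x + act w y.
Proof. by elim/act_ind: w => [|i w IH]; rewrite ?act1 // !actM IH !act_s siD. Qed.
Lemma actZ w a x : act w (a *: x) = a *: act w x.
Proof. by elim/act_ind: w => [|i w IH]; rewrite ?act1 // !actM IH !act_s siZ. Qed.
Lemma act0 w : act w 0 = 0. Proof. by have := actZ w 0 0; rewrite !scale0r. Qed.
Lemma act_sum w x : act w x = \sum_i x 0 i *: act w (al i).
Proof.
rewrite {1}(vec_sum x); elim/big_rec2: _ => [|j y z _ <-]; first exact: act0.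
by rewrite actD actZ.
Qed.
Lemma actN w x : act w (- x) = - act w x.
Proof. by rewrite -scaleN1r actZ scaleN1r. Qed.
Lemma act_B w x y : B (act w x) (act w y) = B x y.
Proof. by elim/act_ind: w => [|i w IH]; rewrite ?act1 // !actM !act_s si_B. Qed.
Lemma act_Bl w x y : B (act w x) y = B x (act w^-1%g y).
Proof. by rewrite -{1}(actKV w y) act_B. Qed.
Lemma root_act w x : root (act w x) = root x. Proof. by rewrite /root act_B. Qed.

Lemma ell_ex w : exists k : nat, [exists t : k.-tuple 'I_n, wd t == w].
Proof. by have [t ->] := wordP w; exists (size t); apply/existsP; exists (in_tuple t). Qed.
Definition ell w : nat := ex_minn (ell_ex w).

Lemma ell_word w : exists2 t, size t = ell w & wd t = w.
Proof.
rewrite /ell; case: ex_minnP => k /existsP[t /eqP e] _.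
by exists t; rewrite ?size_tuple.
Qed.
Lemma ell_le t : (ell (wd t) <= size t)%N.
Proof.
rewrite /ell; case: ex_minnP => k _; apply; apply/existsP; exists (in_tuple t); exact/eqP.
Qed.
Lemma is_lengthE w (k : nat) : is_length s w k <-> k = ell w.
Proof.
split=> [[[t [<- e]] h]|->].
- have [q eq wq] := ell_word w; apply/eqP; rewrite eqn_leq -{1}eq h ?wq //= e.
  exact: ell_le.
- have [t e wt] := ell_word w; split; first by exists t.
  by move=> q ->; exact: ell_le.
Qed.

Lemma ell1 : ell 1%g = 0%N.
Proof. by apply/eqP; rewrite -leqn0 -wd_nil ell_le. Qed.
Lemma ell_eq0 w : ell w = 0%N -> w = 1%g.
Proof. by have [[|i t] <- // <-] := ell_word w; rewrite wd_nil. Qed.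
Lemma ellV w : ell w^-1%g = ell w.
Proof.
have le v : (ell v^-1%g <= ell v)%N.
  by have [t <- <-] := ell_word v; rewrite -wd_rev -(size_rev t) ell_le.
by apply/eqP; rewrite eqn_leq le -{1}(invgK w) le.
Qed.
Lemma ell_leM w v : (ell (w * v)%g <= ell w + ell v)%N.
Proof.
have [t <- <-] := ell_word w; have [q <- <-] := ell_word v.
by rewrite -wd_cat -size_cat ell_le.
Qed.
Lemma ell_s i : (ell (s i) <= 1)%N. Proof. by rewrite -wd1; exact: (ell_le [:: i]). Qed.

(** The sign character, obtained by sending every generator to the transposition of [bool]. *)
Lemma odd_ell t : odd (ell (wd t)) = odd (size t).
Proof.
pose T : {perm bool} := perm (can_inj negbK).
have TT : (T * T = 1)%g by apply/permP=> b; rewrite permM !permE /= negbK.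
have [|f [fM fs]] := @cs_univ _ W _ (fun _ => T).
  by move=> i j; rewrite TT expg1n.
have f1 : f 1%g = 1%g by apply: (mulgI (f 1%g)); rewrite -fM !mulg1.
have fwd (q : seq 'I_n) (b : bool) : f (wd q) b = odd (size q) (+) b.
  elim: q b => [|i q IH] b; first by rewrite wd_nil f1 perm1.
  by rewrite wd_cons fM fs permM IH permE /= addbN addNb.
have [q <- e] := ell_word (wd t).
by have := fwd t false; rewrite -e fwd !addbF.
Qed.
Lemma oddM w v : odd (ell (w * v)%g) = odd (ell w) (+) odd (ell v).
Proof.
have [t ->] := wordP w; have [q ->] := wordP v.
by rewrite -wd_cat !odd_ell size_cat oddD.
Qed.
Lemma odd_s i : odd (ell (s i)). Proof. by rewrite -wd1 odd_ell. Qed.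

Lemma ell_ws w i : ell (w * s i)%g = (ell w).+1 \/ ell w = (ell (w * s i)%g).+1.
Proof.
have h := oddM w (s i); rewrite odd_s addbT in h.
have h1 := ell_leM w (s i); have h2 := ell_leM (w * s i)%g (s i).
rewrite Ks in h2; have := ell_s i; lia.
Qed.
Lemma ell_sw w i : ell (s i * w)%g = (ell w).+1 \/ ell w = (ell (s i * w)%g).+1.
Proof.
have := ell_ws w^-1%g i; have -> : (w^-1 * s i = (s i * w)^-1)%g by rewrite invMg sV.
by rewrite !ellV.
Qed.

Lemma braid i j : nb i j -> (s i * s j * s i = s j * s i * s j)%g.
Proof.
move=> ij; have := cs_rel W i j; rewrite /coxm ij.
have -> : (i == j) = false by apply: contraTF ij => /eqP ->; rewrite nb_irr.
rewrite !expgS expg0 mulg1 => h.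
by apply/eqP; rewrite eq_mulgV1 !invMg !sV !mulgA; apply/eqP; rewrite -[RHS]h !mulgA.
Qed.
Lemma s_comm i j : i != j -> ~~ nb i j -> (s i * s j = s j * s i)%g.
Proof.
move=> ij nij; have := cs_rel W i j; rewrite /coxm (negPf ij) (negPf nij).
rewrite !expgS expg0 mulg1 => h.
by apply/eqP; rewrite eq_mulgV1 !invMg !sV !mulgA; apply/eqP; rewrite -[RHS]h !mulgA.
Qed.

(** Induction on the length, removing the last letter j of a reduced word: w = w' s_j. If j is
    joined to i, the image of [al i] is w'(al j) + w'(al i). Either both terms are positive by
    induction, or w' ends in s_i and the sum collapses to the image of [al j] under a still shorter
    element. *)
Lemma ell_ws_pos w i : (ell w < ell (w * s i)%g)%N -> pos (act w (al i)).
Proof.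
elim: {w}(ell w).+1 {-2}w (ltnSn (ell w)) i => // m IH w lwm i lwi.
have [e|wn] := eqVneq (ell w) 0%N; first by rewrite (ell_eq0 e) act1 pos_al.
have [t et wt] := ell_word w; case/lastP: t et wt => [|q j]; first by move=> /esym/eqP; rewrite (negPf wn).
rewrite size_rcons -cats1 => et wt; pose w' := wd q.
have wE : w = (w' * s j)%g by rewrite -wt wd_cat wd1.
have lw' : ell w = (ell w').+1.
  by have := ell_le q; rewrite -/w'; have := ell_ws w' j; rewrite -wE; lia.
have ji : i != j.
  by apply: contraTneq lwi => ->; rewrite {2}wE Ks -leqNgt lw'.
have pj : pos (act w' (al j)) by apply: IH; rewrite -?wE; lia.
rewrite {1}wE actM act_s si_eq B_al (negPf ji).
case: ifP => ij; last first.
  rewrite scale0r subr0; apply: IH; first by lia.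
  have com := s_comm ji (negbT ij).
  have e : (w * s i = w' * s i * s j)%g by rewrite wE -mulgA -com mulgA.
  by have := ell_ws w' i; have := ell_ws (w' * s i)%g j; rewrite -e; lia.
rewrite scaleN1r opprK addrC actD.
have [l1|l2] := ell_ws w' i; last first.
  pose w2 := (w' * s i)%g; have e2 : w' = (w2 * s i)%g by rewrite /w2 Ks.
  have {}l2 : ell w' = (ell w2).+1 by [].
  clearbody w2.
  have -> : act w' (al j) + act w' (al i) = act w2 (al j).
    rewrite -actD e2 actM act_s siD si_al si_eq B_alnb 1?nb_sym // scaleN1r opprK addrK.
  by [].
  apply: IH; first by lia.
  (* By the braid relation, w s_i is three letters beyond w2, and it is longer than w, which has two
     letters more than w2; so each of the three letters lengthens, in particular the first. *)
  have e : (w * s i = w2 * s j * s i * s j)%g.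
    by rewrite wE e2 -!mulgA (mulgA (s i) (s j)) braid // !mulgA.
  have := ell_ws w2 j; have := ell_ws (w2 * s j)%g i; have := ell_ws (w2 * s j * s i)%g j.
  by rewrite -e; lia.
by apply: posD => //; apply: IH; lia.
Qed.

Lemma pos_ws w i : pos (act w (al i)) = (ell w < ell (w * s i)%g)%N.
Proof.
apply/idP/idP; last exact: ell_ws_pos.
apply: contraTT; rewrite -leqNgt => h.
have : pos (act (w * s i)%g (al i)) by apply: ell_ws_pos; rewrite Ks; have := ell_ws w i; lia.
by rewrite actM act_s si_al actN root_posN // root_act root_al.
Qed.
Lemma pos_sw w i : pos (act w^-1%g (al i)) = (ell w < ell (s i * w)%g)%N.
Proof.
rewrite pos_ws; have -> : (w^-1 * s i = (s i * w)^-1)%g by rewrite invMg sV.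
by rewrite !ellV.
Qed.

Lemma all_pos_eq1 w : (forall i, pos (act w (al i))) -> w = 1%g.
Proof.
move=> h; apply: ell_eq0; have [t et wt] := ell_word w.
case/lastP: t et wt => // q j; rewrite size_rcons -cats1 wd_cat wd1 => eq wq.
have := h j; rewrite pos_ws -wq Ks => lt.
by rewrite wq in lt; have := ell_le q; lia.
Qed.
End Action.

(** * Orbits of roots and the stabiliser of the highest root *)

Section Orbits.
Local Open Scope ring_scope.
Variables (D : rootdatum) (W : coxgrp D).
Local Notation n := (rk D).
Local Notation V := 'rV[int]_n.
Local Notation s := (cs W).
Local Notation hi := (hi D).
Local Notation act := (@act D W).
Local Notation ell := (@ell D W).
Implicit Types (x y z r : V) (i j k : 'I_n) (t : seq 'I_n) (w v u : cg W).

Lemma ht_ind (P : V -> Prop) :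
  (forall r, root r -> pos r -> (forall r', root r' -> pos r' -> ht r' < ht r -> P r') -> P r) ->
  forall r, root r -> pos r -> P r.
Proof.
move=> H r; have [m] := ubnP `|ht r|%N; elim: m r => // m IH r lt rr pr.
apply: H => // r' rr' pr' lt'; apply: IH => //.
by have := ht_pos pr'; have := ht_pos pr; lia.
Qed.

Lemma si_lower i r : root r -> pos r -> r <> al i -> 0 < B r (al i) ->
  [/\ si i r = r - al i, root (si i r), pos (si i r) & ht (si i r) < ht r].
Proof.
move=> rr pr ne b; have b1 : B r (al i) = 1 by have := B_lt2 rr (root_al i) ne; lia.
have e : si i r = r - al i by rewrite si_eq b1 scale1r.
split=> //; rewrite ?root_si //; first exact: pos_si.
by rewrite e htD htN ht_al; lia.
Qed.

Lemma root_conj_simple r : root r -> exists w i, r = act w (al i).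
Proof.
have H r0 : root r0 -> pos r0 -> exists w i, r0 = act w (al i).
  move: r0; apply: ht_ind => r0 rr pr IH.
  have [i [_ b]] := root_desc rr pr.
  have [->|/eqP ne] := eqVneq r0 (al i); first by exists 1%g, i; rewrite act1.
  have [_ rr' pr' lt] := si_lower rr pr ne b.
  have [w [j e]] := IH _ rr' pr' lt.
  by exists (s i * w)%g, j; rewrite actM -e act_s siK.
move=> rr; have /orP[|pr] := root_pos rr; first exact: H.
have [||w [i e]] := H (- r); rewrite ?root_N //.
by exists (w * s i)%g, i; rewrite actM act_s si_al actN -e opprK.
Qed.

Lemma si_nb i j : nb i j -> si i (al j) = al j + al i.
Proof. by move=> ij; rewrite si_eq BC B_alnb // scaleN1r opprK. Qed.

Lemma root_trans r r' : root r -> root r' -> exists w, act w r = r'.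
Proof.
move=> rr rr'; have [w [i ->]] := root_conj_simple rr.
have [w' [j ->]] := root_conj_simple rr'.
have [u eu] : exists u, act u (al i) = al j.
  move: j; apply: nb_conn; first by exists i, 1%g; rewrite act1.
  move=> j k jk [u eu]; exists (s j * s k * u)%g.
  rewrite !actM !act_s eu (@si_nb k j) 1?nb_sym // siD si_al si_nb //.
  by rewrite addrC addrK.
by exists (w' * u * w^-1)%g; rewrite !actM actK eu.
Qed.

Definition J i := B hi (al i) == 0.

Lemma hi_al i : B hi (al i) = (~~ J i)%:Z.
Proof.
rewrite /J; have h0 : 0 <= B hi (al i) by exact: hi_dom.
have ne : hi <> al i.
  move=> e; have [j ij] := nb_exists i.
  have := @hi_gt0 D j; rewrite e al_coord.
  by case: eqP ij => [->|]; rewrite ?nb_irr.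
have := B_lt2 (root_hi D) (root_al i) ne.
by case: eqP => [->|] //= h h1; move: h0 h h1; case: (B hi (al i)) => [[|[|m]]|m].
Qed.
Lemma hi_alN i : ~~ J i -> B hi (al i) = 1. Proof. by rewrite hi_al => ->. Qed.
Lemma hi_alJ i : J i -> B hi (al i) = 0. Proof. by move/eqP. Qed.

Definition inJ w := exists2 t, all J t & w = wd W t.
Lemma inJ1 : inJ 1%g. Proof. by exists [::]; rewrite ?wd_nil. Qed.
Lemma inJ_s i w : J i -> inJ w -> inJ (s i * w)%g.
Proof. by move=> Ji [t Jt ->]; exists (i :: t); rewrite ?wd_cons //= Ji. Qed.
Lemma inJV w : inJ w -> inJ w^-1%g.
Proof. by case=> t Jt ->; exists (rev t); rewrite ?wd_rev // all_rev. Qed.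

Lemma act_J w : inJ w -> act w hi = hi.
Proof.
case=> t Jt ->; rewrite act_wd; elim: t Jt => //= i t IH /andP[Ji Jt].
by rewrite IH // si_eq hi_alJ // scale0r subr0.
Qed.

(** If w fixes h and w^-1 sends [al i] to a negative root, then (h, al i) = (h, w^-1 al i) <= 0, so
    i is in [J], and s_i can be stripped off w. *)
Lemma stab_hi w : act w hi = hi -> inJ w.
Proof.
have [m] := ubnP (ell w); elim: m w => // m IH w lt e.
have [->|w1] := eqVneq w 1%g; first exact: inJ1.
have [i ni] : exists i, ~~ pos (act w^-1%g (al i)).
  apply: NNPP => h; move/eqP: w1; apply; apply: invg_inj; rewrite invg1.
  by apply: all_pos_eq1 => i; apply/negPn/negP => hn; apply: h; exists i.
have Ji : J i.
  have h : 0 <= B hi (- act w^-1%g (al i)).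
    by apply: B_hi_pos; rewrite root_posN ?root_act ?root_al.
  have e' : B hi (act w^-1%g (al i)) = B hi (al i) by rewrite -{1}(actK w hi) e act_B.
  by move: h; rewrite BNr e' hi_al; case: (J i).
rewrite -(sK i w); apply: inJ_s => //; apply: IH.
  by have := ell_sw w i; move: ni; rewrite pos_sw; lia.
by rewrite actM e act_s si_eq hi_alJ // scale0r subr0.
Qed.

(** Reflections in [J] preserve the product with h, so they may be used to lower the height of r
    until it is a simple root. *)
Lemma hi1_J r : root r -> B hi r = 1 ->
  exists u j, [/\ inJ u, ~~ J j & act u r = al j].
Proof.
move=> rr b; have pr : pos r.
  have /orP[//|pr] := root_pos rr; have := B_hi_pos pr; rewrite BNr b; lia.
move: r rr pr b; apply: (@ht_ind (fun r => B hi r = 1 ->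
  exists u j, [/\ inJ u, ~~ J j & act u r = al j])) => r rr pr IH b.
have [[k [Jk bk]]|H] := classic (exists k, J k /\ 0 < B r (al k)).
  have ne : r <> al k by move=> e; move: b; rewrite e hi_al Jk.
  have [e rr' pr' lt] := si_lower rr pr ne bk.
  have [|u [j [Ju Jj eu]]] := IH _ rr' pr' lt.
    by rewrite BC si_Bl BC si_eq hi_alJ // scale0r subr0.
  exists (u * s k)%g, j; rewrite actM act_s eu; split=> //.
  by case: Ju => t Jt ->; exists (t ++ [:: k]); rewrite ?wd_cat ?wd1 // all_cat Jt /= Jk.
have [[j e]|ne] := classic (exists j, r = al j).
  by exists 1%g, j; rewrite act1; split=> //; [exact: inJ1 | move: b; rewrite e hi_al; case: J].
(* When no reflection in [J] lowers r and r is not simple, every simple root has a product with r at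
   most equal to its product with h. Summing over the coordinates of r gives 2 = (r, r) <= (r, h) =
   1. *)
have : B r r <= B r hi.
  rewrite !B_expandl; apply: ler_sum => i _; apply: ler_wpM2l; first by move/posP: pr.
  rewrite [B (al i) hi]BC hi_al BC; case: (boolP (J i)) => Ji /=.
    by rewrite leNgt; apply/negP => bi; apply: H; exists i.
  by apply: B_lt2; rewrite ?root_al // => e; apply: ne; exists i.
by rewrite [B r hi]BC b; move/eqP: rr => ->.
Qed.

(** The difference h - w h is a root with product 1 with h, so some u in W_J moves it to a simple
    root [al j]. Then u w h = h - al j, and s_j u w fixes h. *)
Lemma hi1_dcoset w : B hi (act w hi) = 1 ->
  exists u v j, [/\ inJ u, inJ v, ~~ J j & w = (u * s j * v)%g].
Proof.
move=> b; have rr : root (hi - act w hi).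
  by apply: root_sub; rewrite ?root_act ?root_hi.
have [|u [j [Ju Jj e]]] := hi1_J rr.
  by rewrite BDr BNr b (eqP (root_hi D)).
exists u^-1%g, (s j * u * w)%g, j; split=> //; first exact: inJV.
- apply: stab_hi; rewrite !actM act_s.
  have e' : act u (act w hi) = hi - al j.
    by rewrite -e actD actN (act_J Ju) opprB addrC subrK.
  rewrite e' siD siN si_al opprK si_eq hi_alN // scale1r subrK //.
- by rewrite !mulgA Ks mulVg mul1g.
Qed.
End Orbits.

(** * Buildings and positions of points *)

Record bldg (D : rootdatum) (W : coxgrp D) := Bldg {
  cham : Type;
  dl : cham -> cham -> cg W;
  dl_building : is_building (cs W) dl;
  dl_thick : thick (cs W) dl }.

Section Building.
Local Open Scope ring_scope.
Variables (D : rootdatum) (W : coxgrp D) (Bd : bldg W).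
Local Notation n := (rk D).
Local Notation V := 'rV[int]_n.
Local Notation s := (cs W).
Local Notation hi := (hi D).
Local Notation act := (@act D W).
Local Notation ell := (@ell D W).
Local Notation inJ := (@inJ D W).
Local Notation dl := (@dl D W Bd).
Implicit Types (x y z r : V) (i j k : 'I_n) (t : seq 'I_n) (w v u : cg W) (C E F X : cham Bd).

Lemma dl1 C E : dl C E = 1%g <-> C = E. Proof. by have [h _ _] := dl_building Bd; exact: h. Qed.
Lemma dl_refl C : dl C C = 1%g. Proof. exact/dl1. Qed.
Lemma dl_or i C' C X : dl C' C = s i -> dl C' X = (s i * dl C X)%g \/ dl C' X = dl C X.
Proof. by have [_ h _] := dl_building Bd => e; have [] := h C X C' i e. Qed.
Lemma dl_up i C' C X : dl C' C = s i -> (ell (dl C X) < ell (s i * dl C X)%g)%N ->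
  dl C' X = (s i * dl C X)%g.
Proof.
have [_ h _] := dl_building Bd => e lt; have [_] := h C X C' i e; apply => k.
move/is_lengthE => ->; apply/is_lengthE; have := ell_sw (dl C X) i; lia.
Qed.
Lemma dl_ex i C X : exists C', dl C' C = s i /\ dl C' X = (s i * dl C X)%g.
Proof. by have [_ _ h] := dl_building Bd; exact: h. Qed.
Lemma s_neq1 i : s i <> 1%g.
Proof. by move=> h; have := odd_s W i; rewrite h ell1. Qed.
Lemma dl_symS i C E : dl C E = s i -> dl E C = s i.
Proof.
move=> e; have [h|h] := dl_or C e.
  by apply: (mulgI (s i)); rewrite -h dl_refl ss.
by move: h; rewrite dl_refl => /esym/dl1 h; move: e; rewrite h dl_refl => /esym /s_neq1.
Qed.

Fixpoint reach t C E : Prop :=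
  if t is i :: t' then exists C', dl C C' = s i /\ reach t' C' E else C = E.

Lemma reach_cat t t' C E F : reach t C E -> reach t' E F -> reach (t ++ t') C F.
Proof.
elim: t C => [|i t IH] C /=; first by move=> ->.
by case=> C' [e r] r'; exists C'; split=> //; apply: IH.
Qed.
Lemma reach_rev t C E : reach t C E -> reach (rev t) E C.
Proof.
elim: t C => [|i t IH] C /=; first by move=> ->.
case=> C' [e r]; rewrite rev_cons -cats1; apply: reach_cat (IH _ r) _ => /=.
by exists C; split=> //; exact: dl_symS.
Qed.
Lemma reach_ex t C X : exists E, reach t C E /\ dl E X = ((wd W t)^-1 * dl C X)%g.
Proof.
elim: t C => [|i t IH] C /=; first by exists C; rewrite wd_nil invg1 mul1g.
have [C' [e e']] := dl_ex i C X; have [E [r h]] := IH C'.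
exists E; split; first by exists C'; split=> //; exact: dl_symS.
by rewrite h e' wd_cons invMg sV mulgA.
Qed.
Lemma reach_dl t C E : dl C E = wd W t -> reach t C E.
Proof.
by move=> e; have [F [r]] := reach_ex t C E; rewrite e mulVg => /dl1 <-.
Qed.
Lemma reach_connect C E : exists t, reach t C E.
Proof. by have [t e] := wordP (dl C E); exists t; apply: reach_dl. Qed.
Lemma dl_reach t C E : size t = ell (wd W t) -> reach t C E -> dl C E = wd W t.
Proof.
elim: t C => [|i t IH] C /=; first by move=> _ ->; rewrite dl_refl wd_nil.
rewrite wd_cons => h [C' [e r]]; have l1 := ell_le W t; have l2 := ell_sw (wd W t) i.
have h' : size t = ell (wd W t) by lia.
by rewrite -(IH _ h' r); apply: dl_up e _; rewrite (IH _ h' r); lia.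
Qed.
(** The axioms only move the first chamber. A reduced gallery read backwards is again reduced, and
    this gives the mirrored statements that follow. *)
Lemma dlV C E : dl E C = (dl C E)^-1%g.
Proof.
have [t et wt] := ell_word (dl C E).
have r := reach_rev (reach_dl (esym wt)).
have e : size (rev t) = ell (wd W (rev t)) by rewrite size_rev wd_rev ellV wt.
by rewrite (dl_reach e r) wd_rev wt.
Qed.

Lemma dl_orR i X C C' : dl C C' = s i -> dl X C' = (dl X C * s i)%g \/ dl X C' = dl X C.
Proof.
move/dl_symS => e; rewrite (dlV C' X) (dlV C X).
by case: (dl_or X e) => ->; [left; rewrite invMg sV | right].
Qed.
Lemma dl_upR i X C C' : dl C C' = s i -> (ell (dl X C) < ell (dl X C * s i)%g)%N ->
  dl X C' = (dl X C * s i)%g.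
Proof.
move/dl_symS => e; rewrite (dlV C' X) (dlV C X) => h.
rewrite (dl_up e) ?invMg ?sV //; move: h; rewrite ellV.
have -> : ((dl C X)^-1 * s i = (s i * dl C X)^-1)%g by rewrite invMg sV.
by rewrite ellV.
Qed.
Lemma dl_exR i X C : exists C', dl C C' = s i /\ dl X C' = (dl X C * s i)%g.
Proof.
have [C' [e h]] := dl_ex i C X; exists C'; split; first exact: dl_symS.
by rewrite (dlV C' X) h (dlV C X) invMg sV.
Qed.

Lemma panel_trans i C E F : dl C E = s i -> dl C F = s i -> E <> F -> dl E F = s i.
Proof.
move=> h1 h2 ne; have [h|-> //] := dl_or F (dl_symS h1).
by move: h; rewrite h2 ss => /dl1.
Qed.
(** [E] is the projection of [X] on the panel. Every other chamber of the panel is adjacent to [E],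
    from which the distance to [X] is forced up. *)
Lemma panel_proj i C E F X : dl C E = s i -> dl E X = (s i * dl C X)%g ->
  (ell (s i * dl C X)%g < ell (dl C X))%N -> dl C F = s i -> F <> E -> dl F X = dl C X.
Proof.
move=> h1 h2 lt h3 ne; have h4 := panel_trans h3 h1 ne.
by rewrite (dl_up h4) h2 sK.
Qed.
Lemma panel_projR i C E F X : dl C E = s i -> dl X E = (dl X C * s i)%g ->
  (ell (dl X C * s i)%g < ell (dl X C))%N -> dl C F = s i -> F <> E -> dl X F = dl X C.
Proof.
move=> h1 h2 lt h3 ne; have h4 := panel_trans h1 h3 (not_eq_sym ne).
by rewrite (dl_upR h4) h2 Ks.
Qed.
Lemma third i C E : dl C E = s i -> exists F, [/\ dl C F = s i & F <> E].
Proof.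
move=> e; have [E1 [E2 [ne [h1 h2]]]] := dl_thick C i.
have [e1|ne1] := classic (E1 = E); last by exists E1.
by exists E2; split=> // e2; apply: ne; rewrite e1 e2.
Qed.

(** * Mutual positions of points *)

Definition samept C E := inJ (dl C E).
(* The mutual positions 0, 1, 2, 2', 3 of the points of [C] and [E] are the values
   2, 1, 0, -1, -2 of [ppos C E]. *)
Definition ppos C E : int := B hi (act (dl C E) hi).

Lemma samept_refl C : samept C C. Proof. by rewrite /samept dl_refl; exact: inJ1. Qed.
Lemma samept_sym C E : samept C E -> samept E C.
Proof. by rewrite /samept (dlV C E); exact: inJV. Qed.

Lemma samept_ind (P : cham Bd -> Prop) C : P C ->
  (forall E F i, J i -> dl E F = s i -> P E -> P F) -> forall E, samept C E -> P E.
Proof.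
move=> PC step E [t Jt e]; have := reach_dl e => {e}.
elim: t C PC Jt => [|i t IH] C PC /=; first by move=> _ <-.
by case/andP=> Ji Jt [C' [e r]]; apply: IH r => //; apply: step e PC.
Qed.

Lemma ppos_samel C C' E : samept C C' -> ppos C' E = ppos C E.
Proof.
move: C'; apply: samept_ind => // E1 F i Ji e <-.
rewrite /ppos; case: (dl_or E (dl_symS e)) => ->; last by [].
by rewrite actM act_s BC si_Bl BC si_eq hi_alJ // scale0r subr0.
Qed.
Lemma act_hi_same C E E' : samept E E' -> act (dl C E') hi = act (dl C E) hi.
Proof.
move: E'; apply: samept_ind => // E1 F i Ji e <-.
case: (dl_orR C e) => ->; last by [].
by rewrite actM act_s si_eq hi_alJ // scale0r subr0.
Qed.
Lemma ppos_samer C E E' : samept E E' -> ppos C E' = ppos C E.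
Proof. by move=> h; rewrite /ppos (act_hi_same _ h). Qed.
Lemma sameptP C E : samept C E <-> ppos C E = 2.
Proof.
split=> [h|h]; first by rewrite /ppos act_J //; exact: hi_norm.
by apply: stab_hi; apply/esym; apply: B_eq2 h; rewrite ?root_act root_hi.
Qed.
Lemma samept_trans C E F : samept C E -> samept E F -> samept C F.
Proof. by move=> h1 /sameptP h2; apply/sameptP; rewrite -(ppos_samel F h1). Qed.

Lemma ppos_s j C E : ~~ J j -> dl C E = s j -> ppos C E = 1.
Proof.
move=> Jj e; rewrite /ppos e act_s si_eq BDr BNr BZr hi_alN // (eqP (root_hi D)).
by [].
Qed.

Definition coll C E := ~ samept C E /\ exists C' E' j,
  [/\ ~~ J j, samept C C', samept E E' & dl C' E' = s j].

Lemma collP C E : coll C E <-> ppos C E = 1.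
Proof.
split=> [[_ [C' [E' [j [Jj hC hE e]]]]]|h].
  by rewrite -(ppos_samel E hC) -(ppos_samer C' hE) (ppos_s Jj e).
split; first by move/sameptP; rewrite h.
have [u [v [j [Ju Jv Jj e]]]] := hi1_dcoset h.
have [t Jt eu] := Ju; have [q Jq ev] := Jv.
have [C' [r1 h1]] := reach_ex t C E.
have {}h1 : dl C' E = (s j * v)%g by rewrite h1 e eu -mulgA mulKg.
have [E' [r2 h2]] := dl_ex j C' E.
have {}r2 := dl_symS r2.
have {}h2 : dl E' E = v by rewrite h2 h1 sK.
have same t' A A' : all (@J D) t' -> reach t' A A' -> samept A A'.
  elim: t' A => [|i t' IH] A /=; first by move=> _ ->; exact: samept_refl.
  case/andP=> Ji Jt' [A1 [e1 r]]; apply: samept_trans (IH _ Jt' r).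
  by rewrite /samept e1 -(mulg1 (s i)); apply: inJ_s => //; exact: inJ1.
exists C', E', j; split=> //; first exact: same r1.
by apply: samept_sym; rewrite /samept h2.
Qed.

Lemma ppos_step j C C' X : ~~ J j -> dl C' C = s j ->
  ppos C' X = ppos C X \/
  (dl C' X = (s j * dl C X)%g /\ ppos C' X = ppos C X - B (act (dl C X) hi) (al j)).
Proof.
move=> Jj /(dl_or X) [] e; rewrite /ppos e; last by left.
right; split=> //; rewrite actM act_s BC si_Bl BC.
by rewrite (si_eq j hi) hi_alN // scale1r BDl BNl; rewrite [B (al j) _]BC.
Qed.

(** Choose u with u h = x and follow from [C] a gallery of reduced type u along which every step
    multiplies the distance to [X]. At its end [E] the two distances are u and u^-1 [dl C X], and
    both products of [ppos] become the assumed ones. *)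
Lemma mid_exists C X x : root x -> B hi x = 1 -> B x (act (dl C X) hi) = 1 ->
  exists E, [/\ coll C E, coll E X & act (dl C E) hi = x].
Proof.
move=> rx b1 b2; have [u eu] := root_trans W (root_hi D) rx.
have [t et wt] := ell_word u.
have [E [r h]] := reach_ex t C X; rewrite wt in h.
have e : dl C E = u by rewrite (dl_reach _ r) ?wt.
exists E; rewrite e; split=> //; apply/collP; rewrite /ppos ?e ?eu //.
by rewrite h actM -act_Bl eu.
Qed.

(** Moving a chamber inside its point does not change [ppos], so the change occurs at the panel
    between the two points. There the distance must be multiplied by s_j, and the amount of the
    change fixes the product with [al j]. *)
Lemma coll_cross C E X : coll C E -> ppos C X <> 1 -> coll E X -> exists C' E' j,
  [/\ ~~ J j, samept C C', samept E E', dl C' E' = s j &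
   dl E' X = (s j * dl C' X)%g /\ B (act (dl C' X) hi) (al j) = ppos C X - 1].
Proof.
case=> _ [C' [E' [j [Jj hC hE e]]]] ne /collP hX.
exists C', E', j; split=> //.
have [] := ppos_step X Jj (dl_symS e); rewrite (ppos_samel X hC) (ppos_samel X hE) hX.
  by move=> e1; case: ne.
by case=> -> h; split=> //; lia.
Qed.

Lemma no_mid_opp C E X : ppos C X = -2 -> coll C E -> ~ coll E X.
Proof.
move=> p h1 h2; have [|C' [E' [j [Jj hC _ _ [_ b]]]]] := coll_cross h1 _ h2; first by rewrite p.
have := ppos_samel X hC; rewrite p /ppos BC => e.
have {}e : act (dl C' X) hi = - hi by apply: B_eqN2; rewrite ?root_act ?root_hi.
by move: b; rewrite e BNl hi_alN // p.
Qed.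

Lemma other_mid C E X : ppos C X = 0 -> coll C E -> coll E X ->
  exists E', [/\ coll C E', coll E' X & ~ samept E E'].
Proof.
move=> p h1 h2; have [|C' [E1 [j [Jj hC hE e [e1 b]]]]] := coll_cross h1 _ h2; first by rewrite p.
rewrite p in b; set x := act (dl C' X) hi in b; have rx : root x by rewrite root_act root_hi.
have p' : B hi x = 0 by have := ppos_samel X hC; rewrite p.
(* The given middle point corresponds to h - al j. The root x + al j is a second candidate, told
   apart from it by the product with [al j], which is 1 instead of -1. *)
have [|||E' [c1 c2 e2]] := @mid_exists C' X (x + al j).
- by apply: root_add; rewrite ?root_al // b.
- by rewrite BDr p' hi_alN.
- by rewrite -/x BDl (eqP rx) BC b.
exists E'; split=> //.
  by apply/collP; rewrite -(ppos_samel E' hC); apply/collP.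
move=> hEE'; have h : samept E1 E' by apply: samept_trans (samept_sym hE) hEE'.
have := act_hi_same C' h; rewrite e2 e act_s si_eq hi_alN // scale1r => /(congr1 (fun a : V => B a (al j))).
by rewrite /= !BDl BNl B_alal b hi_alN.
Qed.

(** [C] is the projection of [X] on the residue formed by the chambers of its point. *)
Definition Jmin C X := forall k, J k -> (ell (dl C X) < ell (s k * dl C X)%g)%N.

Lemma supp_J r : pos r -> B hi r = 0 -> forall k, ~~ J k -> r 0 k = 0.
Proof.
move=> /posP pr; rewrite BC B_expandl => e k Jk.
have := psumr_eq0P (P := xpredT) _ e; move/(_ _ k isT).
rewrite BC hi_alN // mulr1; apply=> i _; rewrite BC hi_al; have := pr i; case: (J i) => /=; lia.
Qed.

(** The gate property of the residue of a point, with uniqueness of the gate as second conclusion.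
    The induction removes a left descent of [dl C' C], which necessarily lies in [J]. *)
Lemma Jmin_dl C X : Jmin C X -> forall C', samept C' C ->
  dl C' X = (dl C' C * dl C X)%g /\ (C' <> C -> ~ Jmin C' X).
Proof.
move=> Cmin C'; have [m] := ubnP (ell (dl C' C)); elim: m C' => // m IH C' lt hC.
have [e|v1] := eqVneq (dl C' C) 1%g.
  have eC : C' = C by apply/dl1.
  by split; rewrite ?e ?mul1g eC // => /(_ erefl).
set v := dl C' C in lt v1 *; set w := dl C X.
have [i ni] : exists i, ~~ pos (act v^-1%g (al i)).
  apply: NNPP => h; move/eqP: v1; apply; apply: invg_inj; rewrite invg1.
  by apply: all_pos_eq1 => i; apply/negPn/negP => hn; apply: h; exists i.
have rr : root (act v^-1%g (al i)) by rewrite root_act root_al.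
have pr : pos (- act v^-1%g (al i)) by rewrite root_posN.
have hb : B hi (act v^-1%g (al i)) = B hi (al i) by rewrite -act_Bl act_J.
have Ji : J i.
  by have := B_hi_pos pr; rewrite BNr hb hi_al; case: (J i).
have [C2 [e1 e2]] := dl_ex i C' C.
have lt2 : (ell (s i * v)%g < ell v)%N.
  by move: ni; rewrite pos_sw; have := ell_sw v i; lia.
have hC2 : samept C2 C by rewrite /samept e2; apply: inJ_s.
have [|h2 _] := IH C2 _ hC2; first by rewrite e2; exact: leq_trans lt2 lt.
rewrite e2 -/v -/w in h2.
(* The positive root - v^-1 al i is orthogonal to h, hence supported on [J], and w^-1 keeps the
   simple roots of [J] positive because [C] is the gate. *)
have lt3 : (ell (s i * v * w)%g < ell (v * w)%g)%N.
  have -> : (v * w = s i * (s i * v * w))%g by rewrite !mulgA ss mul1g.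
  rewrite -pos_sw !invMg !actM sV act_s si_al !actN -actN.
  set r := - _ in pr *; apply/posP => k.
  have s0 : B hi r = 0 by rewrite BNr hb hi_alJ.
  rewrite act_sum summxE sumr_ge0 // => j _; rewrite coE.
  case: (boolP (J j)) => Jj; last by rewrite (supp_J pr s0 Jj) mul0r.
  apply: mulr_ge0; first by move/posP: pr.
  by have := Cmin j Jj; rewrite -pos_sw => /posP.
have e3 : dl C' X = (v * w)%g.
  rewrite (@dl_up i C' C2) ?h2 //; first by rewrite !mulgA ss mul1g.
    exact: dl_symS.
  by rewrite !mulgA ss mul1g.
by split=> // _ /(_ i Ji); rewrite e3 mulgA ltnNge (ltnW lt3).
Qed.

(** The pair moves to the gate of the point of [C] without leaving either point. A descent k in [J]
    is not joined to j: otherwise the negative root w^-1 al k, where w = [dl C X], would have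
    product 1 with h. So s_k and s_j commute and [E] can move along with [C]. *)
Lemma gate C E X j : ~~ J j -> dl C E = s j -> act (dl C X) hi = - al j ->
  dl E X = (s j * dl C X)%g ->
  exists C0 E0, [/\ samept C C0, samept E E0, Jmin C0 X, dl C0 E0 = s j &
    act (dl C0 X) hi = - al j /\ dl E0 X = (s j * dl C0 X)%g].
Proof.
move=> Jj; have [m] := ubnP (ell (dl C X)); elim: m C E => // m IH C E lt e a e'.
have [Cmin|nmin] := classic (Jmin C X).
  by exists C, E; split=> //; exact: samept_refl.
have [k [Jk lk]] : exists k, J k /\ (ell (s k * dl C X)%g < ell (dl C X))%N.
  apply: NNPP => h; apply: nmin => k Jk; rewrite ltnNge; apply/negP => le; apply: h.
  by exists k; split=> //; have := ell_sw (dl C X) k; lia.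
have jk : j != k by apply: contraNneq Jj => ->.
have njk : ~~ nb k j.
  apply/negP => kj; have h : 0 <= B hi (- act (dl C X)^-1%g (al k)).
    apply: B_hi_pos; rewrite root_posN ?root_act ?root_al // pos_sw; lia.
  by move: h; rewrite BNr -act_Bl a BNl B_alnb // nb_sym.
have sj : si k (al j) = al j by rewrite si_eq B_al (negPf jk) nb_sym (negPf njk) scale0r subr0.
have [C1 [e1 e2]] := dl_ex k C X.
have eEC1 : dl E C1 = (s k * s j)%g.
  rewrite (@s_comm _ _ k j) // 1?eq_sym //.
  rewrite (@dl_up j E C) ?(dl_symS e) ?(dl_symS e1) //.
  by rewrite -pos_sw sV act_s sj pos_al.
have [E1 [e3 e4]] := dl_ex k E C1; rewrite eEC1 sK in e4.
have hE1 : samept E E1.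
  by apply: samept_sym; rewrite /samept e3 -(mulg1 (s k)); apply: inJ_s => //; exact: inJ1.
have hC1 : samept C C1.
  by apply: samept_sym; rewrite /samept e1 -(mulg1 (s k)); apply: inJ_s => //; exact: inJ1.
have a1 : act (dl C1 X) hi = - al j by rewrite e2 actM a act_s siN sj.
have b j' : act (s j * dl C X)%g hi = al j by rewrite actM a act_s siN si_al opprK.
have e5 : dl E1 X = (s j * dl C1 X)%g.
  have [//|h] := dl_or X e4; exfalso.
  have := ppos_samel X hE1; rewrite /ppos h a1 e' b // BNr hi_alN //.
have lt1 : (ell (dl C1 X) < m)%N by rewrite e2; lia.
have [C0 [E0 [h1 h2 h3 h4 h5]]] := IH C1 E1 lt1 (dl_symS e4) a1 e5.
by exists C0, E0; split=> //; [apply: samept_trans h1 | apply: samept_trans h2].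
Qed.

(** At position -1 the product found by [coll_cross] is -2, so the image of h is - al j. After
    [gate], both paths start from the same chamber and cross the same panel, and both end at the
    projection of [X] on that panel. *)
Lemma mid_unique C E E' X : ppos C X = -1 -> coll C E -> coll E X -> coll C E' -> coll E' X ->
  samept E E'.
Proof.
move=> p c1 c2 c1' c2'.
have [|C1 [E1 [j [Jj hC hE e [e1 b]]]]] := coll_cross c1 _ c2; first by rewrite p.
have [|C2 [E2 [j' [Jj' hC' hE' e' [e1' b']]]]] := coll_cross c1' _ c2'; first by rewrite p.
rewrite p in b b'.
have {}b : act (dl C1 X) hi = - al j by apply: B_eqN2; rewrite ?root_act ?root_hi ?root_al.
have {}b' : act (dl C2 X) hi = - al j' by apply: B_eqN2; rewrite ?root_act ?root_hi ?root_al.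
have [C3 [E3 [h1 h2 h3 h4 [h5 h6]]]] := gate Jj e b e1.
have [C4 [E4 [k1 k2 k3 k4 [k5 k6]]]] := gate Jj' e' b' e1'.
have C34 : C4 = C3.
  apply: NNPP => ne; have [||_ h] := @Jmin_dl C3 X _ C4 => //; last by apply: h.
  apply: samept_trans (samept_trans hC h1); apply: samept_sym.
  exact: samept_trans hC' k1.
rewrite C34 in k4 k5 k6.
have jj : j' = j.
  move: k5; rewrite h5 => /oppr_inj /(congr1 (fun a : V => a 0 j)).
  by rewrite /= !al_coord eqxx; case: eqP.
rewrite jj in k4 k6.
have E34 : E4 = E3.
  apply: NNPP => ne; have lt : (ell (s j * dl C3 X)%g < ell (dl C3 X))%N.
    have : ~~ pos (act (dl C3 X)^-1%g (al j)).
      by rewrite -[al j]opprK -h5 actN actK root_posN ?root_hi // pos_hi.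
    by rewrite pos_sw; have := ell_sw (dl C3 X) j; lia.
  have := panel_proj h4 h6 lt k4 ne; rewrite k6 => h.
  by move: lt; rewrite h ltnn.
apply: samept_trans hE (samept_trans h2 _); rewrite -E34.
by apply: samept_sym; apply: samept_trans hE' k2.
Qed.

Lemma pos2P C X : (~ samept C X /\ ~ coll C X /\
   exists E, coll C E /\ coll E X /\ forall E', coll C E' -> coll E' X -> samept E E')
  <-> ppos C X = -1.
Proof.
have rb : root (act (dl C X) hi) by rewrite root_act root_hi.
split=> [[h1 [h2 [E [c1 [c2 u]]]]]|p].
  have : ppos C X <> 2 by move/sameptP.
  have : ppos C X <> 1 by move/collP.
  have : ppos C X <> 0.
    by move=> p; have [E' [c1' c2' []]] := other_mid p c1 c2; apply: u.
  have : ppos C X <> -2 by move=> p; apply: (no_mid_opp p c1 c2).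
  have := B_bound (root_hi D) rb; rewrite -/(ppos C X); lia.
split; first by move/sameptP; rewrite p.
split; first by move/collP; rewrite p.
have p' : B hi (act (dl C X) hi) = -1 by [].
have [|||E [c1 c2 _]] := @mid_exists C X (hi + act (dl C X) hi).
- by apply: root_add; rewrite ?root_hi.
- by rewrite BDr p' (eqP (root_hi D)).
- by rewrite BDl p' (eqP rb).
exists E; do 2!split=> //; move=> E' c1' c2'.
exact: mid_unique p c1 c2 c1' c2'.
Qed.
End Building.

(** * Displacements *)

Record diagaut (D : rootdatum) (W : coxgrp D) := DiagAut {
  sg : {perm 'I_(rk D)};
  ph : cg W -> cg W;
  phM : forall w v, ph (w * v)%g = (ph w * ph v)%g;
  ph_s : forall i, ph (cs W i) = cs W (sg i) }.

Section Twist.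
Local Open Scope ring_scope.
Variables (D : rootdatum) (W : coxgrp D) (S : diagaut W).
Local Notation n := (rk D).
Local Notation V := 'rV[int]_n.
Local Notation s := (cs W).
Local Notation hi := (hi D).
Local Notation act := (@act D W).
Local Notation ell := (@ell D W).
Local Notation sg := (sg S).
Local Notation ph := (@ph _ _ S).
Implicit Types (x z r g : V) (i j k : 'I_n) (t : seq 'I_n) (w v u : cg W).

Lemma act_faithful w v : (forall x, act w x = act v x) -> w = v.
Proof.
move=> h; have e : (v^-1 * w)%g = 1%g.
  by apply: (@all_pos_eq1 D W) => i; rewrite actM h actK pos_al.
by apply: (mulgI v^-1%g); rewrite e mulVg.
Qed.
Lemma s_inj : injective s.
Proof.
move=> i j e; have := act_s W i (al i); rewrite e act_s si_al si_eq B_al.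
case: eqP => // ne h; exfalso.
have := congr1 (fun a : V => a 0 i) h; rewrite /= !coE !al_coord eqxx.
by case: (eqVneq j i) => [e1|_]; [case: ne | rewrite mulr0 subr0].
Qed.

Lemma ph1 : ph 1%g = 1%g. Proof. by apply: (mulgI (ph 1%g)); rewrite -phM !mulg1. Qed.

(** Two generators that both commute and satisfy the braid relation are equal, so an edge cannot
    correspond to a non-edge. *)
Lemma nb_sg i j : nb (sg i) (sg j) = nb i j.
Proof.
have [->|ij] := eqVneq i j; first by rewrite !nb_irr.
have ij' : sg i != sg j by rewrite (inj_eq perm_inj).
have ne : s (sg i) <> s (sg j) by move/s_inj/eqP; rewrite (negPf ij').
have excl k l : nb k l -> (s k * s l = s l * s k)%g -> s k = s l.
  by move=> kl c; have := braid W kl; rewrite c Ks -c Ks.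
apply/idP/idP => h; apply/negPn/negP => nh.
- have := s_comm W ij nh => /(congr1 ph); rewrite !phM !ph_s => c.
  exact: ne (excl _ _ h c).
- have c := s_comm W ij' nh; have := congr1 ph (braid W h); rewrite !phM !ph_s.
  by rewrite c Ks -c Ks => /esym.
Qed.

Definition psi x : V := \row_i x 0 ((sg)^-1%g i).
Definition psiV x : V := \row_i x 0 (sg i).

Lemma psi_coord x i : psi x 0 (sg i) = x 0 i. Proof. by rewrite mxE permK. Qed.
Lemma psiV_coord x i : psiV x 0 i = x 0 (sg i). Proof. by rewrite mxE. Qed.
Lemma psiK : cancel psi psiV. Proof. by move=> x; apply: vecP => i; rewrite psiV_coord psi_coord. Qed.
Lemma psiKV : cancel psiV psi.
Proof. by move=> x; apply: vecP => i; rewrite -(permKV sg i) psi_coord psiV_coord. Qed.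
Lemma psiD x z : psi (x + z) = psi x + psi z. Proof. by apply/rowP=> i; rewrite !mxE. Qed.
Lemma psiZ a x : psi (a *: x) = a *: psi x. Proof. by apply/rowP=> i; rewrite !mxE. Qed.
Lemma psiN x : psi (- x) = - psi x. Proof. by apply/rowP=> i; rewrite !mxE. Qed.
Lemma psiVN x : psiV (- x) = - psiV x. Proof. by apply/rowP=> i; rewrite !mxE. Qed.
Lemma psi_al i : psi (al i) = al (sg i).
Proof.
apply: vecP => j; rewrite -(permKV sg j) psi_coord !al_coord.
by rewrite (inj_eq perm_inj).
Qed.
Lemma psi_B x z : B (psi x) (psi z) = B x z.
Proof.
rewrite !B_expand (reindex_inj (@perm_inj _ sg)); apply: eq_bigr => i _.
rewrite (reindex_inj (@perm_inj _ sg)); apply: eq_bigr => j _.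
by rewrite !psi_coord !mxE nb_sg (inj_eq perm_inj).
Qed.
Lemma psi_pos x : pos (psi x) = pos x.
Proof.
apply/posP/posP => h i; first by rewrite -psi_coord.
by rewrite -(permKV sg i) psi_coord.
Qed.
Lemma psiV_pos x : pos (psiV x) = pos x. Proof. by rewrite -psi_pos psiKV. Qed.
Lemma psi_hi : psi hi = hi.
Proof.
apply: hi_unique => [|i]; first by rewrite /root psi_B; exact: root_hi.
by rewrite -(permKV sg i) -psi_al psi_B hi_dom.
Qed.
Lemma psi_si i x : psi (si i x) = si (sg i) (psi x).
Proof. by rewrite !si_eq psiD psiN psiZ psi_al -psi_al psi_B. Qed.
Lemma psi_act w x : psi (act w x) = act (ph w) (psi x).
Proof.
elim/(@act_ind D W): w x => [|i w IH] x; first by rewrite ph1 !act1.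
by rewrite phM ph_s !actM !act_s psi_si IH.
Qed.
Lemma ph_inj : injective ph.
Proof.
move=> w v e; apply: act_faithful => x; apply: (can_inj psiK).
by rewrite !psi_act e.
Qed.

(* [tw w] is the isometry w sigma of the root lattice, [twV w] its inverse. *)
Definition tw w x : V := act w (psi x).
Definition twV w x : V := psiV (act w^-1%g x).
Definition cj i w : cg W := (s i * w * s (sg i))%g.

Lemma twK w : cancel (tw w) (twV w). Proof. by move=> x; rewrite /tw /twV actK psiK. Qed.
Lemma twVK w : cancel (twV w) (tw w). Proof. by move=> x; rewrite /tw /twV psiKV actKV. Qed.
Lemma twD w x z : tw w (x + z) = tw w x + tw w z. Proof. by rewrite /tw psiD actD. Qed.
Lemma twN w x : tw w (- x) = - tw w x. Proof. by rewrite /tw psiN actN. Qed.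
Lemma twZ w a x : tw w (a *: x) = a *: tw w x. Proof. by rewrite /tw psiZ actZ. Qed.
Lemma twVN w x : twV w (- x) = - twV w x. Proof. by rewrite /twV actN psiVN. Qed.
Lemma tw_B w x z : B (tw w x) (tw w z) = B x z. Proof. by rewrite act_B psi_B. Qed.
Lemma tw_Bl w x z : B (tw w x) z = B x (twV w z). Proof. by rewrite -{1}(twVK w z) tw_B. Qed.
Lemma root_tw w x : root (tw w x) = root x. Proof. by rewrite /root tw_B. Qed.
Lemma root_twV w x : root (twV w x) = root x. Proof. by rewrite -(root_tw w) twVK. Qed.
Lemma tw_sl w i x : tw (s i * w)%g x = si i (tw w x). Proof. by rewrite /tw actM act_s. Qed.
Lemma tw_sr w i x : tw (w * s (sg i))%g x = tw w (si i x).
Proof. by rewrite /tw actM act_s psi_si. Qed.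
Lemma tw_cj w i x : tw (cj i w) x = si i (tw w (si i x)).
Proof. by rewrite /cj tw_sr tw_sl. Qed.
Lemma twV_eq w x z : tw w x = z -> twV w z = x. Proof. by move=> <-; rewrite twK. Qed.
Lemma twV_cj w i x : twV (cj i w) x = si i (twV w (si i x)).
Proof. by apply: twV_eq; rewrite tw_cj siK twVK siK. Qed.
Lemma tw_hi w : tw w hi = act w hi. Proof. by rewrite /tw psi_hi. Qed.
Lemma tw_inj w v : (forall x, tw w x = tw v x) -> w = v.
Proof.
by move=> h; apply: act_faithful => x; have := h (psiV x); rewrite /tw psiKV.
Qed.

Lemma pos_tw w i : pos (tw w (al i)) = (ell w < ell (w * s (sg i))%g)%N.
Proof. by rewrite /tw psi_al pos_ws. Qed.
Lemma pos_twV w i : pos (twV w (al i)) = (ell w < ell (s i * w)%g)%N.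
Proof. by rewrite psiV_pos pos_sw. Qed.

(** By [skewN] and [skew_neq] this says that [s i * w] and [w * s (sg i)] differ. When it fails,
    [cj i] fixes w. *)
Definition skew w i := (tw w (al i) != al i) && (tw w (al i) != - al i).

Lemma skewN w i : skew w i = false -> (s i * w = w * s (sg i))%g.
Proof.
move=> /negbT; rewrite negb_and !negbK => h.
have e x : tw w (si i x) = si i (tw w x).
  rewrite !si_eq twD twN twZ.
  have -> : B (tw w x) (al i) *: al i = B x (al i) *: tw w (al i).
    rewrite -(tw_B w x (al i)).
    by case/orP: h => /eqP ->; rewrite // BNr scalerN scaleNr opprK.
  by [].
by apply: tw_inj => x; rewrite tw_sl tw_sr e.
Qed.
(** Evaluated at [al i], an equality says that s_i negates the root r = tw w (al i). Then r is
    proportional to [al i], hence equal to it up to sign. *)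
Lemma skew_neq w i : skew w i -> (s i * w)%g <> (w * s (sg i))%g.
Proof.
move=> /andP[/eqP h1 /eqP h2] e.
have := tw_sl w i (al i); rewrite e tw_sr si_al twN si_eq.
have rt : root (tw w (al i)) by rewrite root_tw root_al.
move: h1 h2 rt; set r := tw w (al i); set c := B r (al i) => h1 h2 rt h.
have rc : 2 *: r = c *: al i.
  have : r - c *: al i + r = 0 by rewrite -h addNr.
  by move/eqP; rewrite addrAC subr_eq0 => /eqP <-; rewrite scaler_nat mulr2n.
have c2 : 2 * c = 2 * 2.
  have : B (2 *: r) (2 *: r) = 2 * (c * c).
    by rewrite {1}rc BZl BZr [B (al i) r]BC -/c; ring.
  rewrite BZl BZr (eqP rt) => c2.
  have := congr1 (fun a => B a (al i)) rc; rewrite /= !BZl B_alal -/c.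
  have := B_bound rt (root_al i); rewrite -/c.
  by have : c <> -2; [move/(B_eqN2 rt (root_al i)) | nia].
by apply: h1; apply: B_eq2; rewrite ?root_al // -/c; lia.
Qed.
Lemma cj_skewN w i : skew w i = false -> cj i w = w.
Proof. by move=> h; rewrite /cj skewN // Ks. Qed.
Lemma cjK w i : cj i (cj i w) = w. Proof. by rewrite /cj !mulgA ss mul1g Ks. Qed.
End Twist.

(** * Displacements of the chambers of a panel *)

Section Displacement.
Local Open Scope ring_scope.
Variables (D : rootdatum) (W : coxgrp D) (S : diagaut W) (Bd : bldg W).
Local Notation n := (rk D).
Local Notation V := 'rV[int]_n.
Local Notation s := (cs W).
Local Notation hi := (hi D).
Local Notation act := (@act D W).
Local Notation ell := (@ell D W).
Local Notation sg := (sg S).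
Local Notation ph := (@ph _ _ S).
Local Notation dl := (@dl D W Bd).
Local Notation tw := (@tw D W S).
Local Notation twV := (@twV D W S).
Local Notation cj := (@cj D W S).
Local Notation skew := (@skew D W S).
Variable th : cham Bd -> cham Bd.
Hypothesis th_bij : bijective th.
Hypothesis th_dl : forall C E, dl (th C) (th E) = ph (dl C E).
Implicit Types (x z r g : V) (i j k : 'I_n) (t : seq 'I_n) (w v u : cg W) (C E F X : cham Bd).

Definition dsp C := dl C (th C).
Definition Dsp w := exists C, dsp C = w.

Lemma th_adj i C E : dl C E = s i -> dl (th C) (th E) = s (sg i).
Proof. by rewrite th_dl => ->; rewrite ph_s. Qed.
Lemma th_adjV i C X : dl (th C) X = s (sg i) -> exists2 E, dl C E = s i & th E = X.
Proof.
have [f fK Kf] := th_bij => h; exists (f X); last by rewrite Kf.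
by apply: (@ph_inj D W S); rewrite -th_dl Kf ph_s.
Qed.
Lemma th_inj : injective th. Proof. by have [f fK _] := th_bij; exact: can_inj fK. Qed.

Lemma dsp_adj i C E : dl C E = s i ->
  [\/ dsp E = dsp C, dsp E = cj i (dsp C), dsp E = (s i * dsp C)%g |
      dsp E = (dsp C * s (sg i))%g].
Proof.
move=> e; have := dl_orR E (th_adj e); have := dl_or (th C) (dl_symS e).
rewrite -/(dsp C) -/(dsp E) => -[] -> [] ->.
- by constructor 2.
- by constructor 3.
- by constructor 4.
- by constructor 1.
Qed.

(** Left multiplication lengthens; right multiplication still lengthens afterwards, because the
    positive root tw (al i) is not [al i] and so stays positive under s_i. Both changes are thus
    forced at every chamber of the panel. *)
Lemma dsp_up i C E : dl C E = s i -> skew (dsp C) i ->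
  pos (tw (dsp C) (al i)) -> pos (twV (dsp C) (al i)) -> dsp E = cj i (dsp C).
Proof.
move=> e sk p; rewrite pos_twV => lt.
have h := dl_up (dl_symS e) lt; rewrite /cj -h.
apply: (dl_upR (th_adj e)); rewrite h -pos_tw tw_sl.
by apply: pos_si => //; [rewrite root_tw root_al | case/andP: sk => /eqP].
Qed.

Lemma ntwV_lt w i : ~~ pos (twV w (al i)) -> (ell (s i * w)%g < ell w)%N.
Proof. by rewrite pos_twV; have := ell_sw w i; lia. Qed.
Lemma ntw_lt w i : ~~ pos (tw w (al i)) -> (ell (w * s (sg i))%g < ell w)%N.
Proof. by rewrite pos_tw; have := ell_ws w (sg i); lia. Qed.

(** The conjugate occurs at the projection of [th C] on the panel. A third chamber of the panel
    keeps its distance to [th C], and then only the right multiplication, which lengthens, takes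
    place. *)
Lemma dsp_mixedl i C : skew (dsp C) i ->
  pos (tw (dsp C) (al i)) -> ~~ pos (twV (dsp C) (al i)) ->
  Dsp (cj i (dsp C)) /\ Dsp (dsp C * s (sg i))%g.
Proof.
move=> sk p /ntwV_lt lt; have [E [e h]] := dl_ex i C (th C).
have {}e := dl_symS e; split.
  exists E; rewrite /cj -h; apply: (dl_upR (th_adj e)); rewrite h -pos_tw tw_sl.
  by apply: pos_si => //; [rewrite root_tw root_al | case/andP: sk => /eqP].
have [F [f ne]] := third e; exists F.
have hF := panel_proj e h lt f ne; rewrite -[dsp C]hF; apply: (dl_upR (th_adj f)).
by rewrite hF -pos_tw.
Qed.

Lemma dsp_mixedr i C : skew (dsp C) i ->
  ~~ pos (tw (dsp C) (al i)) -> pos (twV (dsp C) (al i)) ->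
  Dsp (cj i (dsp C)) /\ Dsp (s i * dsp C)%g.
Proof.
move=> sk /ntw_lt lt p; have [X [f h]] := dl_exR (sg i) C (th C).
have [E e eX] := th_adjV f; rewrite -eX in f h; split.
  exists E; rewrite /cj -mulgA -h; apply: (dl_up (dl_symS e)); rewrite h -pos_sw invMg sV actM act_s.
  have -> : act (dl C (th C))^-1%g (al i) = psi S (twV (dsp C) (al i)) by rewrite psiKV.
  rewrite -psi_si psi_pos; apply: pos_si => //; first by rewrite root_twV root_al.
  by move=> h'; case/andP: sk => /eqP []; rewrite -[in LHS]h' twVK.
have [F [g ne]] := third e; exists F.
have ne' : th F <> th E by move/th_inj.
have hF := panel_projR f h lt (th_adj g) ne'; rewrite -[dsp C]hF; apply: (dl_up (dl_symS g)).
by rewrite hF -(pos_twV S).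
Qed.

(** Compare the projection E of [th C] on the panel with the chamber E' whose image is the
    projection of [C] on the image panel. If they coincide, both multiplications occur there; if
    not, exactly one occurs at each of them. *)
Lemma dsp_down i C : skew (dsp C) i ->
  ~~ pos (tw (dsp C) (al i)) -> ~~ pos (twV (dsp C) (al i)) ->
  exists E, dl C E = s i /\
    (dsp E = cj i (dsp C) \/ (Dsp (s i * dsp C)%g /\ Dsp (dsp C * s (sg i))%g)) /\
    (forall F, dl C F = s i -> F <> E -> dsp F = dsp C \/ dsp F = (dsp C * s (sg i))%g).
Proof.
move=> sk /ntw_lt ltr /ntwV_lt ltl; have ne := skew_neq sk.
have [E [e hE]] := dl_ex i C (th C); have {}e := dl_symS e.
exists E; split=> //; split; last first.
  move=> F f neF; have hF := panel_proj e hE ltl f neF.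
  by have := dl_orR F (th_adj f); rewrite hF -/(dsp C) -/(dsp F) => -[]; [right|left].
have [X [f hX]] := dl_exR (sg i) C (th C); have [E' e' eX] := th_adjV f.
rewrite -eX in f hX.
have l1 := dl_orR E (th_adj e); rewrite hE -/(dsp E) -/(dsp C) in l1.
have cw : cj i (dsp C) <> dsp C.
  by move=> h; apply: ne; rewrite -{2}h /cj Ks.
have sw : (s i * dsp C)%g <> dsp C.
  by move=> h; apply: (@s_neq1 _ W i); apply: (mulIg (dsp C)); rewrite h mul1g.
have ws : (dsp C * s (sg i))%g <> dsp C.
  by move=> h; apply: (@s_neq1 _ W (sg i)); apply: (mulgI (dsp C)); rewrite h mulg1.
have [eE|neE] := classic (E' = E).
  left; have := dl_or (th E) (dl_symS e); rewrite -eE hX eE -/(dsp E) -/(dsp C) mulgA.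
  case=> // h; case: l1 => // h'; case: ne; rewrite -h' h //.
right; split.
  exists E; case: l1 => // h; have ne' : th E <> th E' by move/th_inj => h'; case: neE.
  have := dl_or (th E) (dl_symS e); rewrite (panel_projR f hX ltr (th_adj e) ne').
  by rewrite -/(dsp E) -/(dsp C) h => -[] // /cw.
exists E'; have := dl_or (th E') (dl_symS e'); rewrite hX -/(dsp E') -/(dsp C) mulgA.
case=> // h; have := dl_orR E' (th_adj e'); rewrite (panel_proj e hE ltl e' neE).
by rewrite -/(dsp E') -/(dsp C) h => -[] // /cw.
Qed.

Lemma dsp_rule w i : Dsp w -> skew w i ->
  Dsp (cj i w) \/ (Dsp (s i * w)%g /\ Dsp (w * s (sg i))%g).
Proof.
case=> C <- sk; case p: (pos (tw (dsp C) (al i))); case q: (pos (twV (dsp C) (al i))).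
- left; have [E [E' [_ [e _]]]] := dl_thick C i.
  by exists E; rewrite (dsp_up e sk).
- by left; have [] := dsp_mixedl sk p (negbT q).
- by left; have [] := dsp_mixedr sk (negbT p) q.
- have [E [e [[h|h] _]]] := dsp_down sk (negbT p) (negbT q); last by right.
  by left; exists E.
Qed.

(** * Spectra of constant parity *)

Section Parity.
Hypothesis par : forall w v, Dsp w -> Dsp v -> odd (ell w) = odd (ell v).

Let no_s i C : ~ Dsp (s i * dsp C)%g.
Proof.
move=> h; have : Dsp (dsp C) by exists C.
by move/par/(_ h); rewrite oddM odd_s; case: odd.
Qed.
Let no_sr i C : ~ Dsp (dsp C * s (sg i))%g.
Proof.
move=> h; have : Dsp (dsp C) by exists C.
by move/par/(_ h); rewrite oddM odd_s; case: odd.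
Qed.

Lemma par_adj i C E : dl C E = s i -> dsp E = dsp C \/ dsp E = cj i (dsp C).
Proof.
move=> e; have [] := dsp_adj e => h; [by left|by right| |].
- by case: (@no_s i C); exists E.
- by case: (@no_sr i C); exists E.
Qed.
Lemma par_stay i C E : dl C E = s i -> skew (dsp C) i = false -> dsp E = dsp C.
Proof. by move=> e sk; have [//|->] := par_adj e; rewrite cj_skewN. Qed.
Lemma par_sign w i : Dsp w -> pos (tw w (al i)) = pos (twV w (al i)).
Proof.
case=> C <-; case sk: (skew (dsp C) i); last first.
  move/negbT: sk; rewrite negb_and !negbK => /orP[] /eqP h; have := twV_eq h => h'.
    by rewrite h h'.
  have : twV (dsp C) (al i) = - al i by rewrite -[in LHS](opprK (al i)) twVN h'.
  by rewrite h => ->.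
case p: (pos (tw (dsp C) (al i))); case q: (pos (twV (dsp C) (al i))) => //.
- by have [_ /no_sr] := dsp_mixedl sk p (negbT q).
- by have [_ /no_s] := dsp_mixedr sk (negbT p) q.
Qed.
Lemma par_cj w i : Dsp w -> Dsp (cj i w).
Proof.
move=> dw; case sk: (skew w i); last by rewrite cj_skewN.
by have [//|[h _]] := dsp_rule dw sk; case: dw h => C <- /no_s.
Qed.
Lemma par_down i C : skew (dsp C) i -> ~~ pos (tw (dsp C) (al i)) ->
  exists E, [/\ dl C E = s i, dsp E = cj i (dsp C) &
    forall F, dl C F = s i -> F <> E -> dsp F = dsp C].
Proof.
move=> sk p; have q : ~~ pos (twV (dsp C) (al i)) by rewrite -par_sign //; exists C.
have [E [e [h1 h2]]] := dsp_down sk p q; exists E; split=> //.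
- by case: h1 => // -[/no_s].
- by move=> F f nf; have [//|h] := h2 F f nf; case: (@no_sr i C); exists F.
Qed.
Lemma par_up i C E : dl C E = s i -> skew (dsp C) i -> pos (tw (dsp C) (al i)) ->
  dsp E = cj i (dsp C).
Proof. by move=> e sk p; apply: dsp_up => //; rewrite -par_sign //; exists C. Qed.

Lemma neigh i C : exists E, dl C E = s i.
Proof. by have [E [_ [_ [e _]]]] := dl_thick C i; exists E. Qed.

(** The braid relation replaces one half of a hexagon by the other. *)
Lemma square i j C1 C2 C3 C4 : nb i j -> dl C1 C2 = s i -> dl C2 C3 = s j -> dl C3 C4 = s i ->
  exists E1 E2, [/\ dl C1 E1 = s j, dl E1 E2 = s i & dl E2 C4 = s j].
Proof.
move=> ij e1 e2 e3; have ne : i != j by apply: contraTneq ij => ->; rewrite nb_irr.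
have h2 : dl C1 C3 = (s i * s j)%g.
  by rewrite (@dl_up _ _ _ i C1 C2) ?e2 // -pos_sw sV act_s si_nb 1?nb_sym // posD ?pos_al.
have h3 : dl C1 C4 = wd W [:: j; i; j].
  rewrite !wd_cons wd_nil mulg1 mulgA -braid // -h2.
  apply: dl_upR e3 _; rewrite h2 -pos_ws actM !act_s si_nb 1?nb_sym //.
  by rewrite siD si_al si_nb // addrC addrK pos_al.
by have [E1 [f1 [E2 [f2 [E3 [f3 <-]]]]]] := reach_dl h3; exists E1, E2.
Qed.

Lemma si_nbs i j : nb i j -> si i (al i + al j) = al j :> V.
Proof. by move=> ij; rewrite siD si_al si_nb // addrC addrK. Qed.
Lemma al_neq i j : i != j -> (al i == al j :> V) = false.
Proof.
move=> ij; apply/negbTE/eqP => /(congr1 (fun a : V => a 0 i)).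
by rewrite /= !al_coord eqxx [j == i]eq_sym (negPf ij).
Qed.
Lemma al_neqN i j : (al i == - al j :> V) = false.
Proof.
apply/negbTE/eqP => h; have := pos_al i.
by rewrite h root_posN ?root_al // pos_al.
Qed.
Lemma sum_neq i j : (al i + al j == al i :> V) = false.
Proof.
apply/negbTE/eqP => h; apply: (root_neq0 (root_al j)).
by apply: (addrI (al i)); rewrite h addr0.
Qed.
Lemma sum_neqN i j : (al i + al j == - al i :> V) = false.
Proof.
apply/negbTE/eqP => h; have : pos (al i + al j : V) by rewrite posD ?pos_al.
by rewrite h root_posN ?root_al // pos_al.
Qed.

(* If [tw w] exchanges the two simple roots of a rank 2 residue of type A_2, two ways round
   a hexagon of chambers force incompatible displacements on the same chamber. *)
Lemma no_swap_pos w i j : Dsp w -> nb i j -> tw w (al i) = al j -> tw w (al j) = al i -> False.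
Proof.
case=> C <-{w} ij hi hj; have ji : nb j i by rewrite nb_sym.
have ne : i != j by apply: contraTneq ij => ->; rewrite nb_irr.
have hs : tw (dsp C) (al i + al j) = al i + al j by rewrite twD hi hj addrC.
pose w1 := cj i (dsp C); pose w2 := cj j (dsp C).
have w1j : tw w1 (al j) = al j.
  by rewrite tw_cj si_nb // addrC hs si_nbs.
have w1i : tw w1 (al i) = - (al i + al j).
  by rewrite tw_cj si_al twN hi siN si_nb // addrC.
have w2i : tw w2 (al i) = al i.
  by rewrite tw_cj si_nb // hs addrC si_nbs.
have sk1 : skew w1 j = false by rewrite /skew w1j eqxx.
have sk2 : skew w2 i = false by rewrite /skew w2i eqxx.
have [C1 e1] := neigh i C.
have t1 : dsp C1 = w1.
  by apply: par_up => //; rewrite /skew hi ?al_neq ?al_neqN 1?eq_sym // pos_al.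
have [C0 e0] := neigh j C1.
have t0 : dsp C0 = w1 by rewrite (par_stay e0) ?t1.
have [||E [f1 f2 f3]] := @par_down i C0.
- by rewrite t0 /skew w1i eqr_oppLR sum_neqN eqr_opp sum_neq.
- by rewrite t0 w1i root_posN ?posD ?pos_al // root_add ?root_al // B_alnb.
have [C5 [e5 ne5]] := third f1.
have t5 : dsp C5 = w1 by rewrite f3.
have [E1 [E2 [g1 g2 g3]]] := square ij e1 e0 e5.
have u1 : dsp E1 = w2.
  by apply: par_up => //; rewrite /skew hj ?al_neq ?al_neqN // pos_al.
have u2 : dsp E2 = w2 by rewrite (par_stay g2) u1.
have : dsp E2 = w1 by rewrite -t5; apply: par_stay (dl_symS g3) _; rewrite t5.
rewrite u2 => w12; move: w1i; rewrite -w12 w2i => /eqP.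
by rewrite eq_sym eqr_oppLR sum_neqN.
Qed.

(** Here the starting chamber [C] is in the middle of one half of the hexagon. Thickness provides an
    i-neighbour [C3] with the displacement of [C], and [par_down] provides j-neighbours [C1] and
    [C4] of the two with the conjugate displacement. Along the other half, entering from [C1] forces
    the displacement of [C] on [E2], while entering from [C4] forces the conjugate one. *)
Lemma no_swap_neg w i j : Dsp w -> nb i j -> tw w (al i) = - al j -> tw w (al j) = - al i -> False.
Proof.
case=> C <-{w} ij hi hj; have ji : nb j i by rewrite nb_sym.
have ne : i != j by apply: contraTneq ij => ->; rewrite nb_irr.
have hs : tw (dsp C) (al i + al j) = - (al i + al j) by rewrite twD hi hj -opprD addrC.
pose wS := cj j (dsp C).
have Si : tw wS (al i) = - al i by rewrite tw_cj si_nb // hs siN addrC si_nbs.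
have Sj : tw wS (al j) = al j + al i by rewrite tw_cj si_al twN hj opprK si_nb // addrC.
have skS : skew wS i = false by rewrite /skew Si eqxx andbF.
have Wj : cj j wS = dsp C by rewrite cjK.
have sk k l : nb k l -> tw (dsp C) (al k) = - al l -> skew (dsp C) k /\ ~~ pos (tw (dsp C) (al k)).
  move=> kl h; have kl' : k != l by apply: contraTneq kl => ->; rewrite nb_irr.
  rewrite /skew h eqr_opp root_posN ?root_al // pos_al /= [_ == al k]eq_sym al_neqN.
  by rewrite al_neq // eq_sym.
have [ski pi] := sk _ _ ij hi; have [skj pj] := sk _ _ ji hj.
have [C1 [e1 t1 _]] := par_down skj pj.
have [F [f1 _ f3]] := par_down ski pi.
have [C3 [e3 ne3]] := third f1; have t3 := f3 _ e3 ne3.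
have [C4 [e4 t4 _]] : exists E, [/\ dl C3 E = s j, dsp E = cj j (dsp C3) &
    forall F, dl C3 F = s j -> F <> E -> dsp F = dsp C3] by apply: par_down; rewrite t3.
rewrite t3 in t4.
have [E1 [E2 [g1 g2 g3]]] := square ji (dl_symS e1) e3 e4.
have u1 : dsp E1 = wS by rewrite /wS -t1; apply: par_stay g1 _; rewrite t1.
have u2 : dsp E2 = dsp C.
  rewrite -Wj -u1; apply: par_up g2 _ _; rewrite u1.
    by rewrite /skew Sj sum_neq sum_neqN.
  by rewrite Sj posD ?pos_al.
have : dsp E2 = wS by rewrite /wS -t4; apply: par_stay (dl_symS g3) _; rewrite t4.
rewrite u2 => h; move: Si; rewrite -h hi => /eqP.
by rewrite eqr_opp al_neq // eq_sym.
Qed.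

Lemma no_swap w i j (e : int) : (e == 1) || (e == -1) -> Dsp w -> nb i j ->
  tw w (al i) = e *: al j -> tw w (al j) = e *: al i -> False.
Proof.
case/orP=> /eqP ->; rewrite ?scale1r ?scaleN1r; first exact: no_swap_pos.
exact: no_swap_neg.
Qed.

Let sgn_pos (e : int) r r' : (e == 1) || (e == -1) -> root r -> root r' ->
  pos (e *: r) = pos (e *: r') -> pos r = pos r'.
Proof.
by case/orP=> /eqP -> rr rr'; rewrite ?scale1r // !scaleN1r !root_posN // => /negb_inj.
Qed.

(* [g] and [g'] are the images of [al i] under [tw w] and its inverse, up to the
   common sign [e]; conjugating [w] lowers the height of [g] until it is simple. *)
Lemma no_odd_pos (e : int) : (e == 1) || (e == -1) -> forall g, root g -> pos g ->
  forall w i, Dsp w -> tw w (al i) = e *: g -> B (al i) g = -1 -> False.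
Proof.
move=> he; have ee : e * e = 1 by case/orP: he => /eqP ->.
apply: (@ht_ind _ (fun g => forall w i, Dsp w -> tw w (al i) = e *: g -> B (al i) g = -1 -> False)).
move=> g rg pg IH w i dw hg b.
have [j [_ bj]] := root_desc rg pg.
have ji : j != i by apply: contraTneq bj => ->; rewrite BC b.
have [eg|ne] := classic (g = al j); last first.
  have [es rs ps lt] := si_lower rg pg ne bj.
  have bj1 : B g (al j) = 1 by have := B_lt2 rg (root_al j) ne; lia.
  have hs : tw w (al i) = e *: g by [].
  (* If j is not joined to i, conjugation by s_j replaces g by g - al j. If it is, conjugation by
     s_i s_j does so while moving the tested root from [al i] to [al j]. *)
  case: (boolP (nb i j)) => ij; last first.
    apply: (IH _ rs ps lt (cj j w) i (par_cj j dw)).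
      have fx : si j (al i) = al i :> V.
        by rewrite si_eq B_al [i == j]eq_sym (negPf ji) (negPf ij) scale0r subr0.
      by rewrite tw_cj fx hg siZ.
    by rewrite es BDr b BNr B_al [i == j]eq_sym (negPf ji) (negPf ij).
  have fi : si i (g - al j) = g - al j.
    by rewrite si_eq BDl BNl BC b BC (B_alnb ij) scale0r subr0.
  apply: (IH _ rs ps lt (cj i (cj j w)) j (par_cj i (par_cj j dw))).
    rewrite !tw_cj si_nb // si_nbs 1?nb_sym //.
    by rewrite hg !siZ es fi.
  by rewrite es BDr BNr BC bj1 B_alal.
have ij : nb i j.
  by move: b; rewrite eg B_al [i == j]eq_sym (negPf ji); case: nb.
pose g' := e *: twV w (al i).
have rg' : root g' by rewrite /root /g' BZl BZr mulrA ee mul1r -/(root _) root_twV root_al.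
have hg' : twV w (al i) = e *: g' by rewrite /g' scalerA ee scale1r.
have b' : B (al i) g' = -1.
  by rewrite /g' BZr -tw_Bl hg BZl mulrA ee mul1r BC.
have pg' : pos g'.
  by rewrite -(sgn_pos he rg rg') // -hg -hg' par_sign.
have [eg'|ne'] := classic (g' = al j).
  apply: (no_swap he dw ij); first by rewrite hg eg.
  have := twVK S w (al i); rewrite hg' eg' twZ => /(congr1 (fun a => e *: a)).
  by rewrite scalerA ee scale1r.
(* Now g is [al j] and g' is not. After conjugation by s_i s_j, the image and the preimage of [al j]
   are, up to the common sign [e], a negative and a positive root, against [par_sign]. *)
have ps1 : pos (si j g') by apply: pos_si.
have ps2 : pos (si i (si j g')).
  apply: pos_si; rewrite ?root_si // => h.
  have := congr1 (si j) h; rewrite siK si_nb 1?nb_sym // => h'.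
  by move: b'; rewrite h' BDr B_alal B_alnb.
have dw' := par_cj i (par_cj j dw).
have := par_sign j dw'.
have -> : tw (cj i (cj j w)) (al j) = e *: - (al j + al i).
  rewrite !tw_cj si_nb // si_nbs 1?nb_sym // hg eg !siZ si_al siN si_nb //.
have -> : twV (cj i (cj j w)) (al j) = e *: si i (si j g').
  rewrite !twV_cj si_nb // si_nbs 1?nb_sym // hg'.
  by case/orP: (he) => /eqP ->; rewrite ?scale1r ?scaleN1r // !siN.
have rs : root (al j + al i : V) by rewrite root_add ?root_al // B_alnb // nb_sym.
move=> h; have := sgn_pos he _ _ h; rewrite ps2 root_N !root_si => /(_ rs rg').
by rewrite root_posN // posD ?pos_al.
Qed.

Lemma par_conj v w : Dsp w -> Dsp (v * w * ph v^-1)%g.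
Proof.
elim/(@act_ind D W): v w => [|i v IH] w dw; first by rewrite invg1 ph1 mul1g mulg1.
have := par_cj i (IH _ dw); rewrite /cj invMg sV phM ph_s !mulgA //.
Qed.
Lemma tw_conj v w x : tw (v * w * ph v^-1)%g x = act v (tw w (act v^-1%g x)).
Proof. by rewrite /tw !actM -psi_act. Qed.

Lemma par_even w r : Dsp w -> root r -> ~~ oddz (B r (tw w r)).
Proof.
move=> dw rr; apply/negP => od.
have [v [i er]] := root_conj_simple W rr.
pose w1 := (v^-1 * w * ph v^-1^-1)%g; have dw1 : Dsp w1 by exact: par_conj.
have {}od : oddz (B (al i) (tw w1 (al i))).
  by rewrite tw_conj invgK -er BC act_Bl invgK -er BC.
(* The sign makes the product of [al i] with [g] equal to -1. *)
pose e : int := - B (al i) (tw w1 (al i)); pose g := e *: tw w1 (al i).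
have he : (e == 1) || (e == -1).
  by move: od; rewrite oddz1 ?root_tw ?root_al // /e eqr_oppLR eqr_opp orbC.
have ee : e * e = 1 by case/orP: he => /eqP ->.
have rg : root g.
  by rewrite /root /g BZl BZr mulrA ee mul1r -/(root _) root_tw root_al.
have hg : tw w1 (al i) = e *: g by rewrite /g scalerA ee scale1r.
have b : B (al i) g = -1.
  by rewrite /g BZr -[B (al i) _]opprK -/e mulrN ee.
have [pg|] := boolP (pos g); first exact: (no_odd_pos he rg pg dw1 hg b).
(* For a negative [g], conjugation by s_i leads to the root s_i(- g), which is positive and has the
   same product with [al i]. *)
rewrite -(root_posN rg) => pg.
have p2 : pos (si i (- g)).
  apply: pos_si; rewrite ?root_N // => h; move: b.
  by rewrite -[g]opprK h BNr B_alal.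
apply: (no_odd_pos he _ p2 (par_cj i dw1) (i := i)); first by rewrite root_si root_N.
- by rewrite tw_cj si_al twN hg -scalerN siZ.
- by rewrite -(si_B i) siK si_al BNl BNr opprK.
Qed.
End Parity.

Lemma tw_sl_odd w i : (forall r, root r -> ~~ oddz (B r (tw w r))) ->
  ~ forall r, root r -> ~~ oddz (B r (tw (s i * w)%g r)).
Proof.
move=> h h'; have [||x [rx o1 o2]] := @odd_two_roots _ (al i) (twV w (al i)).
- exact: root_al.
- by rewrite root_twV root_al.
have := h' x rx; rewrite tw_sl si_eq BDr BNr BZr oddzD oddzN oddzM o1.
by rewrite (negPf (h x rx)) tw_Bl o2.
Qed.
Lemma tw_sr_odd w i : (forall r, root r -> ~~ oddz (B r (tw w r))) ->
  ~ forall r, root r -> ~~ oddz (B r (tw (w * s (sg i))%g r)).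
Proof.
move=> h h'; have [||x [rx o1 o2]] := @odd_two_roots _ (al i) (tw w (al i)).
- exact: root_al.
- by rewrite root_tw root_al.
have := h' x rx; rewrite tw_sr si_eq twD twN twZ BDr BNr BZr oddzD oddzN oddzM o1.
by rewrite (negPf (h x rx)) o2.
Qed.

Lemma even_uniclass : (forall w r, Dsp w -> root r -> ~~ oddz (B r (tw w r))) ->
  uniclass dl th ph.
Proof.
move=> good; have [[C0]|noC] := classic (inhabited (cham Bd)); last first.
  by exists 1%g => C; case: noC.
exists (dsp C0) => C; have [t] := reach_connect C0 C.
suff gen C1 v : dsp C1 = (v^-1 * dsp C0 * ph v)%g -> reach t C1 C ->
    exists u, dsp C = (u^-1 * dsp C0 * ph u)%g.
  by apply: (gen C0 1%g); rewrite ph1 invg1 mul1g mulg1.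
elim: t C1 v => [|i t IH] C1 v e /=; first by move=> <-; exists v.
case=> C2 [e12 r]; have g1 r0 : root r0 -> _ := good _ r0 (ex_intro _ C1 erefl).
have g2 r0 : root r0 -> _ := good _ r0 (ex_intro _ C2 erefl).
have [h|h|h|h] := dsp_adj e12.
- by apply: (IH C2 v) r; rewrite h.
- by apply: (IH C2 (v * s i)%g) r; rewrite h /cj e invMg sV phM ph_s !mulgA.
- by rewrite h in g2; case: (tw_sl_odd g1 g2).
- by rewrite h in g2; case: (tw_sr_odd g1 g2).
Qed.

Lemma uniclass_even : uniclass dl th ph ->
  forall w r, Dsp w -> root r -> ~~ oddz (B r (tw w r)).
Proof.
move=> [w0 uc] w r; apply: par_even => {w r} w v [C <-] [E <-].
have odd_ph u : odd (ell (ph u)) = odd (ell u).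
  elim/(@act_ind D W): u => [|i u IH]; first by rewrite ph1.
  by rewrite phM ph_s !oddM IH !odd_s.
have od F : odd (ell (dsp F)) = odd (ell w0).
  by have [u e] := uc F; rewrite /dsp e !oddM ellV odd_ph addbC addbA addbb.
by rewrite !od.
Qed.
End Displacement.

(** * Bad types of maximal length *)

Section Closed.
Local Open Scope ring_scope.
Variables (D : rootdatum) (W : coxgrp D) (S : diagaut W).
Local Notation n := (rk D).
Local Notation V := 'rV[int]_n.
Local Notation s := (cs W).
Local Notation ell := (@ell D W).
Local Notation sg := (sg S).
Local Notation tw := (@tw D W S).
Local Notation twV := (@twV D W S).
Local Notation cj := (@cj D W S).
Local Notation skew := (@skew D W S).
Implicit Types (x z r g : V) (i j k t : 'I_n) (w v u : cg W).

(* What the local structure of a thick building forces on a displacement spectrum. *)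
Record disp_closed (Y : cg W -> Prop) : Prop := DispClosed {
  dc_weak : forall w i, Y w -> skew w i -> Y (cj i w) \/ (Y (s i * w)%g /\ Y (w * s (sg i))%g);
  dc_up : forall w i, Y w -> skew w i -> pos (tw w (al i)) -> pos (twV w (al i)) -> Y (cj i w);
  dc_mixl : forall w i, Y w -> skew w i -> pos (tw w (al i)) -> ~~ pos (twV w (al i)) ->
    Y (cj i w) /\ Y (w * s (sg i))%g;
  dc_mixr : forall w i, Y w -> skew w i -> ~~ pos (tw w (al i)) -> pos (twV w (al i)) ->
    Y (cj i w) /\ Y (s i * w)%g }.

Definition good w := forall r, root r -> ~~ oddz (B r (tw w r)).
Definition maxtype w := forall i, tw w (al i) = al i \/
  (~~ pos (tw w (al i)) /\ ~~ pos (twV w (al i))).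

Lemma good_cj w i : good w -> good (cj i w).
Proof. by move=> h r rr; rewrite tw_cj -si_Bl; apply: h; rewrite root_si. Qed.
Lemma good_cjE w i : good (cj i w) <-> good w.
Proof. by split=> h; [rewrite -(cjK S w i)|]; apply: good_cj. Qed.

Lemma skew_cases w i : [\/ tw w (al i) = al i, tw w (al i) = - al i | skew w i].
Proof.
rewrite /skew; case: eqP => h; first by constructor 1.
by case: eqP => h' /=; [constructor 2 | constructor 3].
Qed.

Lemma tw_slE w i x : twV (s i * w)%g x = twV w (si i x).
Proof. by apply: twV_eq; rewrite tw_sl twVK siK. Qed.
Lemma tw_srE w i x : twV (w * s (sg i))%g x = si i (twV w x).
Proof. by apply: twV_eq; rewrite tw_sr siK twVK. Qed.

Lemma skew_twV w i : skew w i -> twV w (al i) <> al i /\ twV w (al i) <> - al i.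
Proof.
case/andP=> /eqP h1 /eqP h2; split=> h; [apply: h1 | apply: h2].
  by rewrite -{1}h twVK.
by rewrite -[in LHS](opprK (al i)) -h twN twVK.
Qed.

(** Let p = v^-1 al i. Comparing the two conditions modulo 2, a root with odd product with [al i]
    and even product with [al t] has even product with p. A root x odd with both [al i] and p
    contradicts this: if x is odd with [al t], its reflection s_i x is even with [al t] and keeps
    the other two parities. *)
Lemma two_good v i t : nb i t -> good v -> good (s i * v * s (sg t))%g -> False.
Proof.
move=> it gv gz; have ti : nb t i by rewrite nb_sym.
pose p := twV v (al i).
have rp : root p by rewrite root_twV root_al.
have gz' x : root x -> ~~ oddz (B (si i x) (tw v (si t x))).
  by move=> rx; have := gz x rx; rewrite tw_sr tw_sl -si_Bl.
have h2 : ~~ oddz (B (al i) (tw v (al t))).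
  have := gz' _ (root_al t); rewrite si_nb // si_al twN BNr oddzN BDl oddzD.
  by rewrite (negPf (gv _ (root_al t))).
have h1 : ~~ oddz (B (al i) (tw v (al i))) by apply: gv; exact: root_al.
have key x : root x -> oddz (B x (al i)) -> ~~ oddz (B x (al t)) -> ~~ oddz (B x p).
  move=> rx o1 o2; have := gz' x rx; rewrite !si_eq twD twN twZ !BE !oddzD !oddzN !oddzM.
  rewrite (negPf (gv x rx)) o1 (negPf o2) /= [B (al i) (tw v x)]BC tw_Bl.
  by rewrite addbF.
have [x [rx o1 o2]] := odd_two_roots (root_al i) rp.
have [o3|o3] := boolP (oddz (B x (al t))); last by have := key x rx o1 o3; rewrite o2.
have := key (si i x); rewrite root_si !si_Bl si_al BNr oddzN si_nb //.
rewrite BDr oddzD o1 o3 => /(_ rx isT isT); rewrite si_eq BDr BNr BZr oddzD oddzN oddzM o2.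
by rewrite BC -tw_Bl BC (negPf h1).
Qed.

Section Maximal.
Variable Y : cg W -> Prop.
Hypothesis clY : disp_closed Y.

Lemma ell_cj_up w i : skew w i -> pos (tw w (al i)) -> pos (twV w (al i)) ->
  (ell w < ell (cj i w))%N.
Proof.
move=> sk p q; have : (ell w < ell (s i * w)%g)%N by rewrite -(pos_twV S).
have : (ell (s i * w)%g < ell (cj i w))%N.
  rewrite /cj -pos_tw tw_sl; apply: pos_si; rewrite ?root_tw ?root_al //.
  by case/andP: sk => /eqP.
lia.
Qed.

(** Everything in [Y] longer than w is good. At a skew t where v lengthens on one side only, that
    product would be good, which is impossible next to the good v. If v lengthens on both sides,
    consider the bad element s_i v of maximal length: it cannot lengthen on both sides at t, so t is
    joined to i and the longer product s_i v s_t is good, against [two_good]. *)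
Lemma max_violating w v i :
  (forall u, Y u -> ~ good u -> ell u <= ell w)%N -> ell v = (ell w).+1 ->
  Y v -> skew v i -> Y (s i * v)%g -> Y (v * s (sg i))%g ->
  ~~ pos (tw v (al i)) -> ~~ pos (twV v (al i)) -> maxtype v.
Proof.
move=> max ev Yv sk Yl Yr pl pr.
have gv : good v by apply: NNPP => /(max _ Yv); rewrite ev ltnn.
have ngl : ~ good (s i * v)%g by exact: tw_sl_odd.
have ngr : ~ good (v * s (sg i))%g by exact: tw_sr_odd.
have el : ell (s i * v)%g = ell w.
  have := max _ Yl ngl; have := ell_sw v i; lia.
have long u : Y u -> (ell w < ell u)%N -> good u.
  by move=> Yu lt; apply: NNPP => /(max _ Yu); rewrite leqNgt lt.
move=> t; have [h|h|skt] := skew_cases v t; first by left.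
  right; have -> : twV v (al t) = - al t by rewrite -[al t in LHS]opprK twVN (twV_eq h).
  by rewrite h root_posN ?root_al // pos_al.
right; case p: (pos (tw v (al t))); case q: (pos (twV v (al t))) => //; exfalso.
- have it : i != t by apply: contraNneq pl => ->; rewrite p.
  have ptl : pos (tw (s i * v)%g (al t)).
    rewrite tw_sl; apply: pos_si => //; first by rewrite root_tw root_al.
    by move=> h; move: pr; rewrite (twV_eq h) pos_al.
  have up u : Y u -> ~ good u -> ell u = ell w -> skew u t -> pos (tw u (al t)) ->
      ~~ pos (twV u (al t)) by
    move=> Yu ng eu sku pu; apply/negP => qu; have := dc_up clY Yu sku pu qu;
    move/long; rewrite -eu ell_cj_up // good_cjE; auto.
  have skl : skew (s i * v)%g t.
    rewrite /skew tw_sl; apply/andP; split; apply/eqP => h; have := congr1 (si i) h; rewrite siK ?siN => h'.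
      case: (boolP (nb i t)) => nit.
        by have := gv _ (root_al t); rewrite h' si_nb // BDr B_alal B_alnb // nb_sym.
      by move: skt; rewrite /skew h' si_eq B_al [t == i]eq_sym (negPf it) nb_sym (negPf nit) scale0r subr0 eqxx.
    case: (boolP (nb i t)) => nit.
      by have := gv _ (root_al t); rewrite h' si_nb // BNr oddzN BDr B_alal B_alnb // nb_sym.
    by move: skt; rewrite /skew h' si_eq B_al [t == i]eq_sym (negPf it) nb_sym (negPf nit) scale0r subr0 eqxx andbF.
  have nq := up _ Yl ngl el skl ptl.
  have nit : nb i t.
    apply: contraNT nq => nit; rewrite tw_slE si_eq B_al [t == i]eq_sym (negPf it) nb_sym (negPf nit).
    by rewrite scale0r subr0 q.
  have [_ Yz] := dc_mixl clY Yl skl ptl nq.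
  apply: (two_good nit gv); apply: long Yz _.
  by move: ptl; rewrite pos_tw el.
- have [_ Yz] := dc_mixl clY Yv skt p (negbT q).
  apply: (@tw_sr_odd _ _ S v t gv); apply: long Yz _.
  by move: p; rewrite pos_tw ev; lia.
- have [_ Yz] := dc_mixr clY Yv skt (negbT p) q.
  apply: (@tw_sl_odd _ _ S v t gv); apply: long Yz _.
  by move: q; rewrite pos_twV ev; lia.
Qed.

(** A longest bad w cannot lengthen on both sides at a skew i, its conjugate being bad too. If it
    lengthens on one side only at some i, that product is in [Y], good by maximality, and treated by
    [max_violating]; otherwise w itself has the required form. *)
Lemma max_bad w0 : Y w0 -> ~ good w0 -> exists v, maxtype v /\
  ((Y v /\ ~ good v) \/
   (good v /\ exists i, skew v i /\ Y (s i * v)%g /\ Y (v * s (sg i))%g)).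
Proof.
move=> Y0 ng0; pose M := (\max_(u : cg W) ell u)%N.
have leM u : (ell u <= M)%N by exact: leq_bigmax.
have [w [Yw ngw max]] : exists w, [/\ Y w, ~ good w & forall u, Y u -> ~ good u -> (ell u <= ell w)%N].
  have [m] := ubnP (M - ell w0)%N; elim: m w0 Y0 ng0 => // m IH w Yw ngw lt.
  have [[u [Yu ngu lu]]|no] := classic (exists u, [/\ Y u, ~ good u & (ell w < ell u)%N]).
    by apply: (IH u) => //; have := leM u; lia.
  exists w; split=> // u Yu ngu; rewrite leqNgt; apply/negP => lu; apply: no.
  by exists u.
have [[i [ski mix]]|nomix] := classic (exists i, skew w i /\ pos (tw w (al i)) != pos (twV w (al i))).
  move: mix; case p: (pos (tw w (al i))); case q: (pos (twV w (al i))) => // _.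
  - have [Yc Yv] := dc_mixl clY Yw ski p (negbT q).
    pose v := (w * s (sg i))%g; exists v.
    have Yl : Y (s i * v)%g by rewrite /v mulgA.
    have Yr : Y (v * s (sg i))%g by rewrite /v Ks.
    have ev : ell v = (ell w).+1 by move: p; rewrite pos_tw /v; have := ell_ws w (sg i); lia.
    have rt : root (tw w (al i)) by rewrite root_tw root_al.
    have skv : skew v i.
      by rewrite /skew /v tw_sr si_al twN eqr_opp eqr_oppLR andbC.
    have pl : ~~ pos (tw v (al i)) by rewrite tw_sr si_al twN root_posN // p.
    have pr : ~~ pos (twV v (al i)).
      rewrite tw_srE; have [n1 n2] := skew_twV ski; rewrite pos_siN ?root_twV ?root_al // q.
      by case: eqP => // _; case: eqP.
    have gv : good v by apply: NNPP => /(max _ Yv); rewrite ev ltnn.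
    split; first exact: max_violating ev Yv skv Yl Yr pl pr.
    by right; split=> //; exists i.
  - have [Yc Yv] := dc_mixr clY Yw ski (negbT p) q.
    pose v := (s i * w)%g; exists v.
    have Yl : Y (s i * v)%g by rewrite /v sK.
    have Yr : Y (v * s (sg i))%g by [].
    have ev : ell v = (ell w).+1 by move: q; rewrite pos_twV /v; have := ell_sw w i; lia.
    have rt : root (tw w (al i)) by rewrite root_tw root_al.
    have skv : skew v i.
      case/andP: ski => /eqP n1 /eqP n2; rewrite /skew /v tw_sl; apply/andP; split; apply/eqP.
        by move=> /(congr1 (si i)); rewrite siK si_al.
      by move=> /(congr1 (si i)); rewrite siK siN si_al opprK.
    have pr : ~~ pos (twV v (al i)).
      by rewrite tw_slE si_al twVN root_posN ?root_twV ?root_al // q.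
    have pl : ~~ pos (tw v (al i)).
      rewrite tw_sl; case/andP: ski => /negPf n1 /negPf n2.
      by rewrite pos_siN // n1 n2 p.
    have gv : good v by apply: NNPP => /(max _ Yv); rewrite ev ltnn.
    split; first exact: max_violating ev Yv skv Yl Yr pl pr.
    by right; split=> //; exists i.
exists w; split; last by left.
move=> i; have [h|h|ski] := skew_cases w i; first by left.
  right; have -> : twV w (al i) = - al i by rewrite -[al i in LHS]opprK twVN (twV_eq h).
  by rewrite h root_posN ?root_al // pos_al.
right; have e : pos (tw w (al i)) = pos (twV w (al i)).
  by apply: NNPP => h; case: nomix; exists i; split=> //; apply/eqP.
case p: (pos (tw w (al i))); last by rewrite -e p.
have q : pos (twV w (al i)) by rewrite -e.
have := max _ (dc_up clY Yw ski p q); rewrite good_cjE => /(_ ngw).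
by rewrite leqNgt ell_cj_up.
Qed.
End Maximal.
End Closed.

(** * Permutation models *)

Section PermSpectrum.
Variables (N : nat) (Y : 'S_N -> Prop) (u v : 'I_N).
Implicit Types (a b c d : 'I_N) (p q g : 'S_N).
Local Open Scope group_scope.

(** The parity of the inner product of e_a + e_b with its image under p. *)
Definition badp p a b := (p a \in [set a; b]) (+) (p b \in [set a; b]).

Hypothesis Yrule : forall p a b, Y p -> (b : nat) = a.+1 ->
  let t := tperm a b in Y (t * p * t) \/ (Y (t * p) /\ Y (p * t)).
Hypothesis uv : u != v.
Hypothesis Yuv : forall p, Y p -> ~~ badp p u v.

Lemma adj_transport (T : 'S_N -> Prop) :
  (forall g h, T g -> T h -> T (g * h)) -> (forall a b, (b : nat) = a.+1 -> T (tperm a b)) ->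
  forall a b, a != b -> exists2 g, T g & g a = u /\ g b = v.
Proof.
move=> TM Tadj.
have Ts k a b : (b : nat) = (a + k.+1)%N -> T (tperm a b).
  elim: k b => [|k IH] b e; first by apply: Tadj; rewrite e addn1.
  have lt : (a + k.+1 < N)%N by have := ltn_ord b; lia.
  pose c := Ordinal lt.
  have ac : a != c by apply/eqP => /(congr1 val) /=; lia.
  have ab : a != b by apply/eqP => /(congr1 val) /=; lia.
  have bc : b != c by apply/eqP => /(congr1 val) /=; lia.
  have -> : tperm a b = tperm a c ^ tperm c b.
    by rewrite tpermJ tpermL tpermD // eq_sym.
  have Tcb : T (tperm c b) by apply: Tadj; rewrite e /= addnS.
  by rewrite /conjg tpermV; apply: (TM) => //; apply: (TM) => //; apply: IH.
(* [T] is only closed under products; as u and v differ, it contains a transposition and hence its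
   square. *)
have T1 : T 1.
  have lu := ltn_ord u; have lv := ltn_ord v.
  have Nu : (1 < N)%N by move/eqP: uv => ne; have : (u : nat) <> v by [move/val_inj]; lia.
  have N0 : (0 < N)%N by exact: ltnW.
  have h : T (tperm (Ordinal N0) (Ordinal Nu)) by exact: Tadj.
  by have := TM _ _ h h; rewrite tperm2.
have Tall a b : T (tperm a b).
  case: (ltngtP a b) => h; last by rewrite (val_inj h) tperm1.
  - by apply: (Ts (b - a.+1)%N); lia.
  - by rewrite tpermC; apply: (Ts (a - b.+1)%N); lia.
move=> a b ab; pose b' := tperm a u b; exists (tperm a u * tperm b' v); first exact: TM.
have ub' : b' != u by rewrite /b' -[X in _ != X](tpermL a u) (inj_eq perm_inj) eq_sym.
by rewrite !permM tpermL tpermD // 1?eq_sym // -/b' tpermL.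
Qed.

Let esc a b := exists2 p, Y p & (p a = b /\ p b <> a) \/ (p b = a /\ p a <> b).

Let esc_sym a b : esc a b -> esc b a.
Proof. by case=> p Yp h; exists p => //; case: h; auto. Qed.

(** If the conjugate of p is in [Y], it witnesses the transported pair. Otherwise both t p and p t
    are available. If t moves only one point of the pair, p or one of these products serves; if t
    moves both points, it exchanges them; if it moves none, p is kept. *)
Let esc_adj a b c d : (d : nat) = c.+1 -> a != b -> esc a b -> esc (tperm c d a) (tperm c d b).
Proof.
move=> cd; set t := tperm c d.
wlog: a b / exists2 p, Y p & p a = b /\ p b <> a.
  move=> H ab; case=> p Yp [h|h]; first by apply: H => //; exists p; auto.
  by apply: esc_sym; apply: H; rewrite 1?eq_sym //; exists p; auto.
case=> p Yp [pab pba] ab _.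
have tK x : t (t x) = x by rewrite /t tpermK.
have rule := Yrule Yp cd; rewrite /= -/t in rule; case: rule => [Yc|[Yl Yr]].
  exists (t * p * t) => //; left; rewrite !permM !tK pab; split=> //.
  by move/perm_inj.
have ne : (c : nat) <> d by lia.
have tmv x : t x = x \/ (t x = c /\ x = d) \/ (t x = d /\ x = c).
  by rewrite /t; case: tpermP => [->|->|]; auto.
have same x y : t x <> x -> t y <> y -> x != y -> t x = y.
  move=> hx hy xy; have [//|hx'] := tmv x; have [//|hy'] := tmv y.
  by case: hx' => -[e1 e2]; case: hy' => -[e3 e4]; rewrite e1 ?e4 //; move: xy; rewrite e2 e4 eqxx.
have [ta|ta] := eqVneq (t a) a; have [tb|tb] := eqVneq (t b) b.
- by rewrite ta tb; exists p => //; left.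
- rewrite ta; have [e|ne'] := eqVneq (p (t b)) a.
    exists p => //; right; split=> //; rewrite pab => h.
    by move/eqP: tb; apply.
  exists (p * t) => //; left; rewrite !permM pab; split=> //.
  by rewrite -[in X in _ <> X]ta => /perm_inj/eqP; rewrite (negPf ne').
- rewrite tb; have [e|ne'] := eqVneq (p b) (t a).
    exists p => //; right; split=> // h.
    by move/eqP: ta; apply; apply: (@perm_inj _ p); rewrite h pab.
  by exists (t * p) => //; left; rewrite !permM tK pab tb; split=> //; apply/eqP.
- have e := same a b (elimN eqP ta) (elimN eqP tb) ab.
  have e' : t b = a by rewrite -e tK.
  by rewrite e e'; apply: esc_sym; exists p => //; left.
Qed.

(* A member of [Y] that is not an involution has a pair [a], [p a] one of whose points escapes
   it; the rule moves such pairs along adjacent transpositions, up to the pair [u], [v]. *)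
Let inv_all p : Y p -> forall a, p (p a) = a.
Proof.
move=> Yp a; apply: NNPP => h.
have ab : a != p a by apply/eqP => e; apply: h; rewrite -!e.
have e0 : esc a (p a) by exists p => //; left.
pose T g := forall x y, x != y -> esc x y -> esc (g x) (g y).
have [||g Tg [gu gv]] := @adj_transport T _ _ _ _ ab.
- move=> g g' Tg Tg' x y xy exy; rewrite !permM; apply: Tg'; last exact: Tg.
  by rewrite (inj_eq perm_inj).
- by move=> c d cd x y; exact: esc_adj.
have [q Yq] := Tg _ _ ab e0; rewrite gu gv.
have := Yuv Yq; rewrite /badp !inE => nb [[e1 e2]|[e1 e2]]; move: nb; rewrite e1 eqxx ?orbT /=.
- have -> : (q v == u) = false by apply/eqP.
  have -> : (q v == v) = false by apply/eqP => /esym h'; move: uv; rewrite -(inj_eq (@perm_inj _ q)) e1 -h' eqxx.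
  by [].
- have -> : (q u == v) = false by apply/eqP.
  have -> : (q u == u) = false by apply/eqP => h'; move: uv; rewrite -(inj_eq (@perm_inj _ q)) e1 h' eqxx.
  by [].
Qed.

Lemma spectrum_good p a b : Y p -> a != b -> ~~ badp p a b.
Proof.
move=> Yp ab; apply/negP => bad.
pose bd x y := exists2 q, Y q & badp q x y.
pose T g := forall x y, bd x y -> bd (g x) (g y).
have conjY q c d : Y q -> (d : nat) = c.+1 -> Y (tperm c d * q * tperm c d).
  move=> Yq cd; have [//|[_ Yr]] := Yrule Yq cd.
  (* Both q and q t are involutions, so q commutes with t. *)
  suff -> : tperm c d * q * tperm c d = q by [].
  apply/permP => x; rewrite !permM.
  by have := inv_all Yr (q x); rewrite !permM (inv_all Yq).
have ebd : bd a b by exists p.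
have [||g Tg [gu gv]] := @adj_transport T _ _ _ _ ab.
- by move=> g g' Tg Tg' x y h; rewrite !permM; apply: Tg'; exact: Tg.
- move=> c d cd x y [q Yq bq]; exists (tperm c d * q * tperm c d); first exact: conjY.
  move: bq; rewrite /badp !permM !tpermK !inE.
  by rewrite !(inj_eq (@perm_inj _ (tperm c d))).
have [q Yq] := Tg _ _ ebd; rewrite gu gv => bq.
by have := Yuv Yq; rewrite bq.
Qed.
End PermSpectrum.

(** * The isometries in coordinates modulo 2 *)

Section Coordinates.
Local Open Scope ring_scope.
Variables (D : rootdatum) (W : coxgrp D) (S : diagaut W).
Local Notation n := (rk D).
Local Notation V := 'rV[int]_n.
Local Notation s := (cs W).
Local Notation hi := (hi D).
Local Notation sg := (sg S).
Local Notation tw := (@tw D W S).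
Local Notation cj := (@cj D W S).
Local Notation skew := (@skew D W S).
Variables (N : nat) (pp qq : 'I_n -> 'I_N) (eps : 'I_n -> int).
Implicit Types (x z r : V) (i j k : 'I_n) (w v u : cg W) (a b c : 'I_N) (p q : 'S_N).

(* The simple root [al i] is [e_(pp i) + eps i e_(qq i)] in an orthonormal basis [e]. *)
Definition Mc i a : int := (a == pp i)%:R + eps i * (a == qq i)%:R.
Definition E x a : int := \sum_i x 0 i * Mc i a.

Hypothesis pq : forall i, pp i != qq i.
Hypothesis eps1 : forall i, eps i * eps i = 1.
Hypothesis BMc : forall i j, B (al i) (al j) = Mc i (pp j) + eps j * Mc i (qq j).
Hypothesis adj_ex : forall a b, (b : nat) = a.+1 -> exists2 i, pp i = a & qq i = b.
Hypothesis psi_ex : exists p0 : 'S_N, forall i a, oddz (Mc (sg i) a) = oddz (Mc i (p0 a)).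
Variables (u0 v0 : 'I_N).
Hypothesis uv0 : u0 != v0.
Hypothesis Ehi : forall a, oddz (E hi a) = (a == u0) || (a == v0).

Let t i : 'S_N := tperm (pp i) (qq i).

Let oeps i : oddz (eps i).
Proof. by have := oddzM (eps i) (eps i); rewrite eps1 andbb => <-. Qed.
Let ED x z a : E (x + z) a = E x a + E z a.
Proof. by rewrite -big_split; apply: eq_bigr => i _; rewrite coE mulrDl. Qed.
Let EZ (m : int) x a : E (m *: x) a = m * E x a.
Proof. by rewrite mulr_sumr; apply: eq_bigr => i _; rewrite coE mulrA. Qed.
Let Eal i a : E (al i) a = Mc i a.
Proof.
rewrite /E (bigD1 i) //= al_coord eqxx mul1r big1 ?addr0 // => j ji.
by rewrite al_coord eq_sym (negPf ji) mul0r.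
Qed.
Let oddz_sum I (l : seq I) (F G : I -> int) : (forall e : I, oddz (F e) = oddz (G e)) ->
  oddz (\sum_(e <- l) F e) = oddz (\sum_(e <- l) G e).
Proof. by move=> h; elim/big_rec2: _ => // e m m' _ IH; rewrite !oddzD h IH. Qed.

Let B_E x j : B x (al j) = E x (pp j) + eps j * E x (qq j).
Proof.
rewrite B_expandl /E mulr_sumr -big_split; apply: eq_bigr => i _ /=.
by rewrite BMc; ring.
Qed.
Let oB x z a b : a != b -> (forall c, oddz (E x c) = (c == a) || (c == b)) ->
  oddz (B z x) = oddz (E z a) (+) oddz (E z b).
Proof.
move=> ab hx; have e : B z x = \sum_c E x c * E z c.
  rewrite BC B_expandl /E; under [RHS]eq_bigr => c _ do rewrite mulr_suml.
  rewrite exchange_big /=; apply: eq_bigr => j _; rewrite BC B_E.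
  rewrite (bigD1 (pp j)) //= (bigD1 (qq j)) /=; last by rewrite eq_sym.
  rewrite [X in _ + (_ + X)]big1 => [|c /andP[c1 c2]]; last first.
    by rewrite /Mc (negPf c1) (negPf c2) mulr0 addr0 mulr0 mul0r.
  have -> : Mc j (pp j) = 1 by rewrite /Mc eqxx (negPf (pq j)) mulr0 addr0.
  have -> : Mc j (qq j) = eps j by rewrite /Mc eqxx eq_sym (negPf (pq j)) add0r mulr1.
  by rewrite addr0 mulr1 mulrDr mulrA.
have -> : oddz (B z x) = oddz (\sum_c if (c == a) || (c == b) then E z c else 0).
  rewrite e; apply: oddz_sum => c; rewrite oddzM hx.
  by case: ifP.
rewrite -big_mkcond (bigD1 a) ?eqxx //= (bigD1 b) /=; last by rewrite eqxx orbT eq_sym.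
rewrite big1 ?addr0 ?oddzD // => c /andP[/andP[/orP[] /eqP -> ]]; by rewrite ?eqxx ?andbF.
Qed.

Let E_si i x a : oddz (E (si i x) a) = oddz (E x (t i a)).
Proof.
rewrite si_eq ED -scaleNr EZ Eal B_E /Mc !oddzD !oddzM oddzN !oddzD !oddzM oeps /t.
case: tpermP => [->|->|/eqP n1 /eqP n2].
- by rewrite eqxx (negPf (pq i)); case: (oddz (E x _)); case: (oddz (E x _)).
- by rewrite eqxx eq_sym (negPf (pq i)); case: (oddz (E x _)); case: (oddz (E x _)).
- by rewrite (negPf n1) (negPf n2) /= andbF addbF.
Qed.

(** The permutation acts on the index of the coordinate. With products of permutations read from
    left to right, left and right multiplications of w correspond to left and right multiplications
    of p. *)
Let Rel w p := forall x a, oddz (E (tw w x) a) = oddz (E x (p a)).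

Let Rel_sl w p i : Rel w p -> Rel (s i * w)%g (t i * p)%g.
Proof. by move=> h x a; rewrite tw_sl E_si h permM. Qed.
Let Rel_sr w p i : Rel w p -> Rel (w * s (sg i))%g (p * t i)%g.
Proof. by move=> h x a; rewrite tw_sr h E_si permM. Qed.
Let Rel_cj w p i : Rel w p -> Rel (cj i w) (t i * p * t i)%g.
Proof. by move=> h; apply: Rel_sr; apply: Rel_sl. Qed.
Let Rel_ex w : exists p, Rel w p.
Proof.
elim/(@act_ind D W): w => [|i w [p h]]; last by exists (t i * p)%g; apply: Rel_sl.
have [p0 h] := psi_ex; exists p0 => x a; rewrite /tw act1 /E.
rewrite (reindex_inj (@perm_inj _ sg)); apply: oddz_sum => i.
by rewrite psi_coord !oddzM h.
Qed.

Let root_pair r : root r -> exists a b, a != b /\ forall c, oddz (E r c) = (c == a) || (c == b).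
Proof.
move=> rr; have [w [i ->]] := root_conj_simple W rr.
elim/(@act_ind D W): w => [|j w [a [b [ab h]]]].
  exists (pp i), (qq i); split=> // c; rewrite act1 Eal /Mc oddzD oddzM oeps.
  case: (eqVneq c (pp i)) => [->|_]; first by rewrite (negPf (pq i)).
  by case: eqP.
exists (t j a), (t j b); rewrite (inj_eq perm_inj); split=> // c.
by rewrite actM act_s E_si h -(inj_eq (@perm_inj _ (t j))) -[t j c == b](inj_eq (@perm_inj _ (t j))) !tpermK.
Qed.

Variable Y : cg W -> Prop.
Hypothesis clY : disp_closed S Y.
Hypothesis Yhi : forall w, Y w -> ~~ oddz (B hi (tw w hi)).

(* Modulo 2, the isometry [tw w] permutes the coordinates. *)
Lemma coordinates_good w : Y w -> good S w.
Proof.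
move=> Yw r rr; have [p hp] := Rel_ex w; have [a [b [ab h]]] := root_pair rr.
pose Yp q := exists2 v, Y v & Rel v q.
have badE q v x c d : Rel v q -> c != d -> (forall e, oddz (E x e) = (e == c) || (e == d)) ->
    oddz (B x (tw v x)) = badp q c d.
  by move=> hq cd hx; rewrite BC (oB _ cd hx) !hq !hx /badp !inE.
rewrite (badE p w r a b) //; apply: (@spectrum_good _ Yp u0 v0) => //.
- move=> q c d [v Yv hq] cd; have [i <- <-] := adj_ex cd; rewrite -/(t i) /=.
  case sk: (skew v i); last by left; exists v => //; rewrite -(cj_skewN sk); apply: Rel_cj.
  have [Yc|[Yl Yr]] := dc_weak clY Yv sk; first by left; exists (cj i v) => //; apply: Rel_cj.
  right; split; first by exists (s i * v)%g => //; apply: Rel_sl.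
  by exists (v * s (sg i))%g => //; apply: Rel_sr.
- by move=> q [v Yv hq]; rewrite -(badE q v hi) //; apply: Yhi.
- by exists w.
Qed.
End Coordinates.

(** * The simply laced diagrams *)

Section Types.
Local Open Scope ring_scope.

Lemma adj_sym X i j : adj X i j = adj X j i. Proof. by rewrite /adj orbC. Qed.
Lemma adj_irr X i : valid_type X -> adj X i i = false.
Proof. case: X => [m|m|||] /=; rewrite /adj /=; lia. Qed.

Lemma adj_hub X : valid_type X -> exists b, forall Q : nat -> Prop,
  (forall k l, (k < rank X)%N -> (l < rank X)%N -> adj X k l -> Q k -> Q l) ->
  forall k, (k < rank X)%N -> (Q k <-> Q b).
Proof.
move=> HX; exists (if X is (TE6 | TE7 | TE8) then 2%N else 0%N) => Q st.
have eqv k l : (k < rank X)%N -> (l < rank X)%N -> adj X k l -> Q k <-> Q l.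
  by move=> hk hl kl; split; apply: st; rewrite // adj_sym.
case: X HX Q st eqv => [m|m|||] HX Q st eqv k; rewrite /rank /= in eqv *.
- elim: k => // k IH hk; rewrite -IH; last by lia.
  by apply: eqv; rewrite /adj /=; lia.
- have low k' : (k' < m.-1)%N -> Q k' <-> Q 0%N.
    elim: k' => // k' IH hk; rewrite -IH; last by lia.
    by apply: eqv; rewrite /adj /=; lia.
  move=> hk; case: (ltnP k m.-1) => h; first exact: low.
  rewrite -(low (m - 3)%N); last by move: HX => /=; lia.
  by apply: eqv; rewrite /adj /=; move: HX => /=; lia.
all: have e02 : Q 0%N <-> Q 2%N by apply: eqv.
all: have e13 : Q 1%N <-> Q 3%N by apply: eqv.
all: have e23 : Q 2%N <-> Q 3%N by apply: eqv.
all: have e34 : Q 3%N <-> Q 4%N by apply: eqv.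
all: have e45 : Q 4%N <-> Q 5%N by apply: eqv.
- by move: k => [|[|[|[|[|[|k]]]]]] //; tauto.
- have e56 : Q 5%N <-> Q 6%N by apply: eqv.
  by move: k => [|[|[|[|[|[|[|k]]]]]]] //; tauto.
- have e56 : Q 5%N <-> Q 6%N by apply: eqv.
  have e67 : Q 6%N <-> Q 7%N by apply: eqv.
  by move: k => [|[|[|[|[|[|[|[|k]]]]]]]] //; tauto.
Qed.

Lemma adj_conn X (P : 'I_(rank X) -> Prop) : valid_type X -> (exists i, P i) ->
  (forall i j : 'I_(rank X), adj X i j -> P i -> P j) -> forall i, P i.
Proof.
move=> HX [i0 Pi0] step i; have [b hub] := adj_hub HX.
pose Q k := forall h : (k < rank X)%N, P (Ordinal h).
have QP (j : 'I_(rank X)) : Q j <-> P j.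
  split=> [q|p h]; last by rewrite (_ : Ordinal h = j) //; apply: val_inj.
  by have := q (ltn_ord j); rewrite (_ : Ordinal _ = j) //; apply: val_inj.
have st k l : (k < rank X)%N -> (l < rank X)%N -> adj X k l -> Q k -> Q l.
  move=> hk hl kl /(_ hk) Pk; apply/(QP (Ordinal hl)).
  exact: (step (Ordinal hk) (Ordinal hl)) kl Pk.
by apply/QP/(hub Q st) => //; apply/(hub Q st _ (ltn_ord i0))/QP.
Qed.

(* The coefficients of the highest root. *)
Definition hic (X : sl_type) (i : nat) : int :=
  match X with
  | TA _ => 1
  | TD m => if (i == 0)%N then 1 else if (i <= m - 3)%N then 2 else 1
  | TE6 => nth 0 [:: 1; 2; 2; 3; 2; 1] i
  | TE7 => nth 0 [:: 2; 2; 3; 4; 3; 2; 1] i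
  | TE8 => nth 0 [:: 2; 3; 4; 6; 5; 4; 3; 2] i
  end.
Definition cartc (X : sl_type) (i j : nat) : int :=
  if i == j then 2 else if adj X i j then -1 else 0.

(** Evaluates a sum against a Cartan column neighbour by neighbour: a term disappears when the guard
    [c] fails or when k lies beyond the last node. *)
Lemma sum_at m (f : nat -> int) k (c : bool) :
  \sum_(j < m) (if (nat_of_ord j == k) && c then f j else 0) = if c && (k < m)%N then f k else 0.
Proof.
case: c; last by rewrite big1 // => i _; rewrite andbF.
case: ltnP => [km|mk] /=.
  rewrite (bigD1 (Ordinal km)) //= eqxx big1 ?addr0 // => i ne.
  by rewrite andbT; case: eqP => // e; case/eqP: ne; apply: val_inj.
by rewrite big1 // => i _; case: eqP => // e; have := ltn_ord i; rewrite e ltnNge mk.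
Qed.

Lemma hic_cart X (i : 'I_(rank X)) : valid_type X ->
  \sum_(j < rank X) hic X j * cartc X j i = (polar X i)%:Z.
Proof.
move=> HX; case: X HX i => [m|m|||] HX [i hi]; rewrite /rank in hi *.
- pose g (j : nat) : int := (if (j == i) && true then 2 else 0) +
    ((if (j == i.+1) && true then -1 else 0) + (if (j == i.-1) && (0 < i)%N then -1 else 0)).
  rewrite (eq_bigr (fun j : 'I_m => g j)) => [|j _]; last first.
    rewrite /g /cartc /adj /= mul1r; move: HX hi => /=; move: (nat_of_ord j) => a.
    do 6?[case: ifP => /= ?]; lia.
  rewrite /g !big_split /= (sum_at _ (fun=> 2)) !(sum_at _ (fun=> -1)); move: HX hi => /=; do 3?[case: ifP => /= ?]; lia.
- pose g (j : nat) : int := (if (j == i) && true then 2 * hic (TD m) j else 0) +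
    ((if (j == i.+1) && (i < m - 2)%N then - hic (TD m) j else 0) +
    ((if (j == i.-1) && ((0 < i) && (i <= m - 2))%N then - hic (TD m) j else 0) +
    ((if (j == m - 1)%N && (i == m - 3)%N then - hic (TD m) j else 0) +
    (if (j == m - 3)%N && (i == m - 1)%N then - hic (TD m) j else 0)))).
  rewrite (eq_bigr (fun j : 'I_m => g j)) => [|j _]; last first.
    rewrite /g /cartc /adj /=; move: (ltn_ord j) HX hi => /=; move: (nat_of_ord j) => a ? ? ?.
    by do 20?[case: ifP => /= ?; try (exfalso; lia)]; lia.
  rewrite /g !big_split /= (sum_at _ (fun j => 2 * hic (TD m) j)).
  rewrite !(sum_at _ (fun j => - hic (TD m) j)) /hic; move: HX hi => /= HX hi; do 20?[case: ifP => /= ?; try (exfalso; lia)]; lia.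
all: rewrite -(big_mkord xpredT (fun j => hic _ j * cartc _ j i)) unlock.
all: clear HX.
all: by move: i hi => [|[|[|[|[|[|[|[|i]]]]]]]] // _; vm_compute.
Qed.

Lemma hic_gt0 X (i : 'I_(rank X)) : 0 < hic X i.
Proof.
case: X i => [m|m|||] [i hi] //=; rewrite /rank in hi; first by do 2?case: ifP.
all: by move: i hi => [|[|[|[|[|[|[|[|i]]]]]]]].
Qed.

Definition nbX X : rel 'I_(rank X) := fun i j => adj X i j.
Definition cartX X : 'M[int]_(rank X) :=
  \matrix_(i, j) if i == j then 2 else if nbX i j then -1 else 0.
Definition hiX X : 'rV[int]_(rank X) := \row_i hic X i.

Lemma cartXE X i j : cartX X i j = cartc X i j. Proof. by rewrite mxE. Qed.
Lemma hiX_al X i : valid_type X -> form (cartX X) (hiX X) (basis _ i) = (polar X i)%:Z.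
Proof.
move=> HX; rewrite -hic_cart // /form /basis trmx_delta -colE !mxE.
by apply: eq_bigr => j _; rewrite cartXE mxE.
Qed.
Lemma hiX_norm X : valid_type X -> form (cartX X) (hiX X) (hiX X) = 2.
Proof.
move=> HX; have -> : form (cartX X) (hiX X) (hiX X) = \sum_(i < rank X) hic X i * (polar X i)%:Z.
  rewrite {1}/form mxE; apply: eq_bigr => i _; rewrite mulrC !mxE; congr (_ * _).
  by rewrite -hic_cart //; apply: eq_bigr => j _; rewrite cartXE mxE.
case: X HX => [m|m|||] HX.
- rewrite (eq_bigr (fun j : 'I_m => (if (nat_of_ord j == 0%N) && true then 1 else 0) +
     (if (nat_of_ord j == (m - 1)%N) && true then 1 else 0))) => [|[j hj] _].
    by rewrite big_split /= !(sum_at _ (fun=> 1)); move: HX => /=; do 2?[case: ifP => /= ?]; lia.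
  by rewrite /= mul1r; move: HX hj => /=; do 2?[case: ifP => /= ?]; lia.
- rewrite (eq_bigr (fun j : 'I_m => if (nat_of_ord j == 1%N) && true then hic (TD m) j else 0)).
    by rewrite (sum_at _ (fun j => hic (TD m) j)) /hic; move: HX => /=; do 3?[case: ifP => /= ?]; lia.
  by move=> [j hj] _; rewrite andbT [polar _ _]/=; case: eqP; rewrite ?mulr1 ?mulr0.
all: rewrite -(big_mkord xpredT (fun j => hic _ j * (polar _ j)%:Z)) unlock.
all: by vm_compute.
Qed.

Definition datumX X (HX : valid_type X) : rootdatum.
Proof.
apply: (@RootDatum (rank X) (@nbX X) _ _ _ (hiX X)).
- by move=> i j; exact: adj_sym.
- by move=> i; exact: adj_irr.
- by move=> P; exact: adj_conn.
- by move=> i; rewrite mxE hic_gt0.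
- by move=> i; rewrite -/(cartX X) hiX_al.
- by rewrite -/(cartX X) hiX_norm.
- by case: X HX => [m|m|||] //=; lia.
Defined.

Lemma J_polar X (HX : valid_type X) (i : 'I_(rank X)) : @J (datumX HX) i = ~~ polar X i.
Proof.
have e : B (hi (datumX HX)) (@al (datumX HX) i) = (polar X i)%:Z by rewrite -hiX_al.
by rewrite /J e; case: polar.
Qed.
End Types.

(** * Diagram automorphisms *)

Section Diagram.
Local Open Scope ring_scope.
Variables (X : sl_type) (HX : valid_type X).
Local Notation D := (datumX HX).
Variables (W : coxgrp D) (S : diagaut W).
Let f : 'I_(rank X) -> 'I_(rank X) := sg S.

Lemma sg_adj (i j : 'I_(rank X)) : adj X (f i) (f j) = adj X i j.
Proof. exact: (nb_sg S i j). Qed.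
Lemma sg_polar (i : 'I_(rank X)) : polar X (f i) = polar X i.
Proof.
apply: negb_inj; rewrite -!(J_polar HX) /J.
by rewrite -(psi_al S i) -{1}(psi_hi S) psi_B.
Qed.
Lemma sg_inj : injective f. Proof. exact: perm_inj. Qed.

(* Along a branch of the diagram on which the image of an end is known, so are all images. *)
Lemma sg_chain (h : nat -> nat) m : (0 < rank X)%N -> (m <= rank X)%N ->
  (forall i : 'I_(rank X), i = 0%N :> nat -> f i = h 0%N :> nat) ->
  (forall k, (k.+1 < m)%N -> adj X k k.+1) ->
  (forall k x, (k.+1 < m)%N -> (x < rank X)%N -> adj X (h k) x -> x = h k.+1 \/ ((0 < k)%N /\ x = h k.-1)) ->
  forall i : 'I_(rank X), (i < m)%N -> f i = h i :> nat.
Proof.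
move=> r0 mr h0 adjs next i; move: {2}(i : nat) (leqnn i) => k.
elim: k i => [|k IH] i ik im; first by rewrite h0; [move: ik; rewrite leqn0 => /eqP -> | apply/eqP; rewrite -leqn0].
case: (ltngtP i k.+1) ik => // [lt _|e _]; first exact: IH.
have kr : (k < rank X)%N by lia.
pose j := Ordinal kr; have fj : f j = h k :> nat by apply: IH => //=; lia.
have km : (k.+1 < m)%N by lia.
have := sg_adj j i; rewrite fj e /= (adjs k km) => a.
have [->|[k0 fi]] := next k (f i) km (ltn_ord _) a; first by [].
have k1r : (k.-1 < rank X)%N by lia.
have : f (Ordinal k1r) = f i by apply: val_inj; rewrite /= fi; apply: IH => /=; lia.
by move/sg_inj/(congr1 val) => /=; lia.
Qed.
Lemma B_alX (i j : 'I_(rank X)) : B (@al D i) (@al D j) = cartc X i j.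
Proof. by rewrite B_al /cartc -val_eqE. Qed.
End Diagram.

(** * Type A *)

Section TypeA.
Local Open Scope ring_scope.
Variables (m : nat) (HX : valid_type (TA m)).
Local Notation D := (datumX HX).
Variables (W : coxgrp D) (S : diagaut W).

Let m1 : (1 < m)%N. Proof. exact: HX. Qed.
(** In the standard coordinates e_0, ..., e_m the simple roots are e_i - e_(i+1) and the highest
    root is e_0 - e_m. *)
Let pp (i : 'I_m) : 'I_m.+1 := inord i.
Let qq (i : 'I_m) : 'I_m.+1 := inord i.+1.
Let ppE (i : 'I_m) : pp i = i :> nat. Proof. by rewrite inordK // ltnS ltnW. Qed.
Let qqE (i : 'I_m) : qq i = i.+1 :> nat. Proof. by rewrite inordK // ltnS. Qed.
Let MA (i : 'I_m) (a : 'I_m.+1) : @Mc D _ pp qq (fun=> -1) i a =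
  (a == i :> nat)%:R - (a == i.+1 :> nat)%:R.
Proof. by rewrite /Mc mulN1r -!val_eqE /= ppE qqE. Qed.

Let sgA : (forall i : 'I_m, sg S i = i :> nat) \/ (forall i : 'I_m, sg S i = (m - i.+1)%N :> nat).
Proof.
have [i0 ei0] : exists i0 : 'I_m, i0 = 0%N :> nat by exists (Ordinal (ltnW m1)).
have uniq0 (i : 'I_m) : i = 0%N :> nat -> i = i0 by move=> h; apply: val_inj; rewrite /= h ei0.
have := sg_polar S i0; rewrite /polar ei0 eqxx /= => /orP[] /eqP e; [left | right] => i.
  apply: (@sg_chain _ HX W S id m) => //; rewrite /rank /adj /=.
  - exact: ltnW.
  - by move=> j /uniq0 ->.
  - by move=> k _; rewrite eqxx.
  - by move=> k x; lia.
apply: (@sg_chain _ HX W S (fun k => m - k.+1)%N m) => //; rewrite /rank /adj /=.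
- exact: ltnW.
- by move=> j /uniq0 ->; rewrite e.
- by move=> k _; rewrite eqxx.
- by move=> k x; lia.
Qed.

Lemma typeA_good (Y : cg W -> Prop) : disp_closed S Y ->
  (forall w, Y w -> ~~ oddz (B (hi D) (tw S w (hi D)))) -> forall w, Y w -> good S w.
Proof.
move=> clY Yhi w; apply: (@coordinates_good D W S m.+1 pp qq (fun=> -1) _ _ _ _ _ ord0 ord_max) => //.
- by move=> i; rewrite -val_eqE /= ppE qqE; lia.
- move=> i j; rewrite !MA ppE qqE B_alX /cartc /adj /=.
  by do 6?[case: eqP => /= ?]; lia.
- move=> a b e; have am : (a < m)%N by have := ltn_ord b; lia.
  by exists (Ordinal am); apply: val_inj; rewrite /= ?ppE ?qqE.
- case: sgA => h.
    exists 1%g => i a; rewrite perm1 !MA h //.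
  (* Reversing the coordinates realises the reversal of the diagram up to a sign, which is invisible
     modulo 2. *)
  exists (perm rev_ord_inj) => i a; rewrite permE !MA h /= oddzD oddzN addbC oddzD oddzN.
  have := ltn_ord i; have := ltn_ord a; rewrite /= => la li.
  congr (oddz _%:R (+) oddz _%:R); lia.
- by apply/eqP => /(congr1 val) /=; lia.
- move=> a; rewrite /E (eq_bigr (fun i : 'I_m =>
      (if (nat_of_ord i == a) && true then 1 else 0) - (if (nat_of_ord i == a.-1) && (0 < a)%N then 1 else 0))).
    rewrite sumrB !(sum_at _ (fun=> 1)); have := ltn_ord a; rewrite -!val_eqE /=.
    by rewrite /oddz; do 4?[case: ifP => /= ?]; lia.
  move=> i _; rewrite mxE mul1r MA; do 2?[case: ifP => /= ?]; lia.
Qed.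
End TypeA.

(** * Type D of rank at least 5 *)

Section TypeD.
Local Open Scope ring_scope.
Variables (m : nat) (HX : valid_type (TD m.+1)).
Local Notation D := (datumX HX).
Variables (W : coxgrp D) (S : diagaut W).
Hypothesis m4 : (4 <= m)%N.

(** The truncations make the last node share its two coordinates with the one before it: al i = e_i
    - e_(i+1) for i < m, and al m = e_(m-1) + e_m. The highest root is e_0 + e_1. *)
Let pp (i : 'I_m.+1) : 'I_m.+1 := inord (minn i m.-1).
Let qq (i : 'I_m.+1) : 'I_m.+1 := inord (minn i.+1 m).
Let eps (i : 'I_m.+1) : int := if nat_of_ord i == m then 1 else -1.
Let ppE (i : 'I_m.+1) : pp i = minn i m.-1 :> nat. Proof. by rewrite inordK; lia. Qed.
Let qqE (i : 'I_m.+1) : qq i = minn i.+1 m :> nat. Proof. by rewrite inordK; lia. Qed.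
Let MD (i a : 'I_m.+1) : @Mc D _ pp qq eps i a =
  (a == minn i m.-1 :> nat)%:R + eps i * (a == minn i.+1 m :> nat)%:R.
Proof. by rewrite /Mc -!val_eqE /= ppE qqE. Qed.

(** A diagram automorphism can at most exchange the last two nodes, whose simple roots agree modulo
    2; so it acts trivially on the coordinates modulo 2. *)
Let sgD (i : 'I_m.+1) : minn (sg S i) m.-1 = minn i m.-1.
Proof.
have adjE (k x : nat) : adj (TD m.+1) k x = [|| [&& x == k.+1 & x <= m.-1], [&& k == x.+1 & k <= m.-1],
    (k == m - 2) && (x == m) | (x == m - 2) && (k == m)]%N.
  by rewrite /adj /=; lia.
have [i0 ei0] : exists i0 : 'I_m.+1, i0 = 0%N :> nat by exists ord0.
have [i1 ei1] : exists i1 : 'I_m.+1, i1 = 1%N :> nat.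
  by exists (inord 1); rewrite inordK //; lia.
have s1 : sg S i1 = 1%N :> nat by have := sg_polar S i1; rewrite /polar ei1 eqxx => /eqP.
have s0 : sg S i0 = 0%N :> nat.
  have a : adj (TD m.+1) (sg S i0) 1%N.
    by rewrite -s1; apply: etrans (sg_adj S i0 i1) _; rewrite ei0 ei1 adjE; lia.
  rewrite adjE in a.
  have [//|e2] : sg S i0 = 0%N :> nat \/ sg S i0 = 2%N :> nat by lia.
  (* If node 0 went to node 2, the node going to 3 would be a neighbour of 0, hence the polar node
     1, which is fixed. Nodes 2 and 3 are joined because the rank is at least 5. *)
  have [i3 ei3] : exists i3 : 'I_m.+1, sg S i3 = 3%N :> nat.
    by exists ((sg S)^-1%g (inord 3)); rewrite permKV inordK //; lia.
  have b : adj (TD m.+1) i3 0%N.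
    by rewrite -ei0; apply: etrans (esym (sg_adj S i3 i0)) _; rewrite ei3 e2 adjE; lia.
  rewrite adjE in b.
  have i31 : i3 = i1 by apply: val_inj; rewrite /= ei1; lia.
  by move: ei3; rewrite i31 s1.
have low (k : 'I_m.+1) : (k < m.-1)%N -> sg S k = k :> nat.
  apply: (@sg_chain _ HX W S id m.-1) => //; rewrite /rank.
  - by lia.
  - by move=> j ej; rewrite (_ : j = i0) //; apply: val_inj; rewrite /= ei0.
  - by move=> l lm; rewrite adjE; lia.
  - by move=> l x lm xm; rewrite adjE; lia.
case: (ltnP i m.-1) => im.
  by apply: (etrans (congr1 (minn^~ m.-1) (low i im))); lia.
case: (ltnP (sg S i) m.-1) => sm //.
have := low _ sm => /val_inj/perm_inj e.
by have := leq_ltn_trans im (eq_ind _ (fun j : 'I_m.+1 => j < m.-1)%N sm _ e); rewrite ltnn.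
Qed.

Lemma typeD_good (Y : cg W -> Prop) : disp_closed S Y ->
  (forall w, Y w -> ~~ oddz (B (hi D) (tw S w (hi D)))) -> forall w, Y w -> good S w.
Proof.
have oe i : oddz (eps i) by rewrite /eps; case: ifP.
move=> clY Yhi w; apply: (@coordinates_good D W S m.+1 pp qq eps _ _ _ _ _ ord0 (inord 1)) => //.
- by move=> i; rewrite -val_eqE /= ppE qqE; have := ltn_ord i; lia.
- by move=> i; rewrite /eps; case: ifP.
- move=> [i hi] [j hj]; have li : (i < m.+1)%N := hi; have lj : (j < m.+1)%N := hj.
  rewrite !MD ppE qqE B_alX /eps /=.
  have lowE (k : nat) : (k < m)%N -> minn k m.-1 = k /\ minn k.+1 m = k.+1 by split; lia.
  have topE : minn m m.-1 = m.-1 /\ minn m.+1 m = m by split; lia.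
  have adjlow (k l : nat) : (k < m)%N -> (l < m)%N -> adj (TD m.+1) k l = (l == k.+1) || (k == l.+1).
    by rewrite /adj /=; lia.
  have adjtop (l : nat) : (l < m)%N -> adj (TD m.+1) m l = (l.+2 == m).
    by rewrite /adj /=; lia.
  case: (eqVneq i m) => [->|im]; case: (eqVneq j m) => [->|jm].
  + have [-> ->] := topE; rewrite /cartc !eqxx.
    by do 4?[case: eqP => /= ?]; lia.
  + have jm' : (j < m)%N by lia.
    have [-> ->] := topE; have [-> ->] := lowE _ jm'; rewrite /cartc adjtop //.
    by do 6?[case: eqP => /= ?]; lia.
  + have im' : (i < m)%N by lia.
    have [-> ->] := topE; have [-> ->] := lowE _ im'; rewrite /cartc adj_sym adjtop //.
    by do 6?[case: eqP => /= ?]; lia.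
  + have im' : (i < m)%N by lia.
    have jm' : (j < m)%N by lia.
    have [-> ->] := lowE _ im'; have [-> ->] := lowE _ jm'; rewrite /cartc adjlow //.
    by do 6?[case: eqP => /= ?]; lia.
- move=> [a ha] [b hb] /= e; have am : (a < m.+1)%N by lia.
  exists (Ordinal am); apply: val_inj; first by apply: (etrans (ppE _)) => /=; lia.
  by apply: (etrans (qqE _)) => /=; lia.
- exists 1%g => i a; rewrite perm1 !MD !oddzD !oddzM !oe /=.
  have h (k l : nat) : (k < m.+1)%N -> (l < m.+1)%N -> minn k m.-1 = minn l m.-1 ->
    minn k.+1 m = minn l.+1 m by lia.
  apply: (congr2 addb); apply: (congr1 (fun k : nat => oddz (a == k :> nat)%:R)).
    exact: sgD.
  exact: h (ltn_ord _) (ltn_ord _) (sgD i).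
- by apply/eqP => /(congr1 val); rewrite /= inordK //; lia.
- move=> a; rewrite /E (eq_bigr (fun i : 'I_m.+1 =>
      (if (nat_of_ord i == a) && (a < m)%N then hic (TD m.+1) i else 0) +
      ((if (nat_of_ord i == a.-1) && (0 < a)%N then - hic (TD m.+1) i else 0) +
      ((if (nat_of_ord i == m) && (a == m.-1 :> nat) then hic (TD m.+1) i else 0) +
       (if (nat_of_ord i == m) && (a == m :> nat) then hic (TD m.+1) i else 0))))).
    rewrite !big_split /= !(sum_at _ (fun i => hic (TD m.+1) i)) (sum_at _ (fun i => - hic (TD m.+1) i)).
    rewrite -!val_eqE /= inordK; last by lia.
    have la := ltn_ord a; rewrite /hic /oddz.
    by do 14?[case: ifP => /= ?; try (exfalso; lia)]; lia.
  move=> [i hi] _; have hi1 : (i < m.+1)%N := hi; rewrite mxE MD /eps /=; have la := ltn_ord a.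
  by do 8?[case: ifP => /= ?; try (exfalso; lia)]; do 2?[case: eqP => /= ?; try (exfalso; lia)]; lia.
Qed.
End TypeD.

(** * The exceptional types and D_4 *)

Section Compute.
Local Open Scope ring_scope.
Variable X : sl_type.
Local Notation N := (rank X).

Definition ent (m : seq (seq int)) i j : int := nth 0 (nth [::] m i) j.
Definition mkmat f : seq (seq int) := mkseq (fun i => mkseq (f i) N) N.
Definition rowsum (f : nat -> int) := foldr (fun i a => f i + a) 0 (iota 0 N).
(** The rows being images, [reflL] applies s_k after the map of [m] and [reflR] applies it
    before. *)
Definition reflL k m := mkmat (fun i j =>
  if j == k then ent m i j - rowsum (fun l => ent m i l * cartc X l k) else ent m i j).
Definition reflR k m := mkmat (fun i j => ent m i j - cartc X i k * ent m k j).
Definition allN (P : pred nat) := all P (iota 0 N).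
Definition rowpos m i := allN (fun j => 0 <= ent m i j).
Definition rowfix m i := allN (fun j => ent m i j == (i == j)%:R).
Definition rowneg m i := allN (fun j => ent m i j == - (i == j)%:R).
Definition gram (m : seq (seq int)) i j := rowsum (fun l => ent m j l * cartc X l i).

(* A state is a pair of matrices, of [tw w] and of its inverse, in the basis of simple
   roots; the images of the basis are the rows. *)
Definition state := (seq (seq int) * seq (seq int))%type.
Definition stL k (st : state) : state := (reflL k st.1, reflR k st.2).
Definition stR k (st : state) : state := (reflR k st.1, reflL k st.2).
Definition stC k st := stL k (stR k st).
Definition st_skew (st : state) i := ~~ rowfix st.1 i && ~~ rowneg st.1 i.
Definition st_odd (st : state) :=
  oddz (rowsum (fun j => (polar X j)%:Z * rowsum (fun i => hic X i * ent st.1 i j))).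
(** The integral quadratic form x -> (x, w x) is even on the whole lattice as soon as it is even on
    the basis and its polarisation is even on pairs of basis vectors. *)
Definition st_good (st : state) := allN (fun i => ~~ oddz (gram st.1 i i) &&
  allN (fun j => ~~ oddz (gram st.1 i j + gram st.1 j i))).

(* A certificate that if a given [w] occurs in a spectrum closed under the local rules, so
   does some [v] with [(hi, v hi)] odd; each node applies one rule. *)
Inductive cert := Odd | Cj of nat & cert | Lm of nat & cert | Rm of nat & cert
  | Br of nat & cert & cert.
Fixpoint check c (st : state) : bool :=
  match c with
  | Odd => st_odd st
  | Cj i c => [&& (i < N)%N, st_skew st i, rowpos st.1 i || rowpos st.2 i & check c (stC i st)]
  | Lm i c => [&& (i < N)%N, st_skew st i, ~~ rowpos st.1 i, rowpos st.2 i & check c (stL i st)]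
  | Rm i c => [&& (i < N)%N, st_skew st i, rowpos st.1 i, ~~ rowpos st.2 i & check c (stR i st)]
  | Br i c c' => [&& (i < N)%N, st_skew st i, check c (stC i st) &
       (if check c' (stL i st) then true else check c' (stR i st))]
  end.

Definition idmat := mkmat (fun i j => (i == j)%:R).
(* The word [acc] is stored backwards. *)
Fixpoint grow (b : pred nat) fuel (m : seq (seq int)) acc :=
  if fuel is f.+1 then
    if [seq k <- iota 0 N | b k & rowpos m k] is k :: _ then grow b f (reflR k m) (k :: acc)
    else (m, acc)
  else (m, acc).
(** Lengthening greedily reaches the longest element of a parabolic subgroup after as many steps as
    it has positive roots, at most 120, in type E_8. The fuel 2 N^2 is 128 there, and the final test
    makes the result independent of this count. *)
Definition longest b := let r := grow b (N * N * 2) idmat [::] in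
  if allN (fun k => b k ==> ~~ rowpos r.1 k) then Some r.2 else None.

(* [Bad t c]: conjugation by [t] turns the type into one at which the highest root is odd, so
   the type is not good, and [c] excludes it.  [Good l]: the type is good, and [l] excludes a
   neighbour of it across each panel at which it is not conjugation invariant. *)
Inductive entry := Bad of seq nat & cert | Good of seq cert.
Definition check_entry st e :=
  match e with
  | Bad t c => all (gtn N) t && st_odd (foldl (fun st k => stC k st) st t) && check c st
  | Good l => st_good st && allN (fun i => if st_skew st i then
       has (fun c => if check c (stL i st) then true else check c (stR i st)) l else true)
  end.

Definition start (p : seq nat) : state :=
  (mkmat (fun i j => (nth 0%N p i == j)%:R), mkmat (fun i j => (nth 0%N p j == i)%:R)).
Fixpoint sigmas k : seq (seq nat) :=
  if k is k'.+1 then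
    [seq rcons p x | p <- sigmas k', x <- [seq x <- iota 0 N |
       (x \notin p) && all (fun i => adj X (nth 0%N p i) x == adj X i k') (iota 0 k')]]
  else [:: [::]].
Fixpoint bits k : seq bitseq :=
  if k is k'.+1 then [seq b :: l | b <- [:: false; true], l <- bits k'] else [:: [::]].

(** The candidate attached to p and K is the longest element, twisted by p, times the longest
    element of the parabolic of K. It is dismissed when the set of simple roots that it fixes is not
    K; otherwise the table must contain an entry excluding it. *)
Definition check_case (st0 : state) (T : seq (seq nat * bitseq * entry)) p (K : bitseq) :=
  if longest (nth false K) is Some wK then
    let st := foldl (fun st k => stR k st) st0 wK in
    if allN (fun i => nth false K i == rowfix st.1 i) then
      has (fun e => if e.1 == (p, K) then check_entry st e.2 else false) T
    else true
  else false.
Definition check_all (T : seq (seq nat * bitseq * entry)) :=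
  if longest predT is Some w0 then
    all (fun p => let st0 := foldr stL (start p) w0 in all (check_case st0 T p) (bits N)) (sigmas N)
  else false.

Lemma ent_mkmat f (i j : 'I_N) : ent (mkmat f) i j = f i j.
Proof. by rewrite /ent !nth_mkseq. Qed.
Lemma rowsumE f : rowsum f = \sum_(i < N) f i.
Proof. by rewrite /rowsum -(big_mkord xpredT) /index_iota subn0 unlock. Qed.
Lemma allNP (P : pred nat) : reflect (forall i : 'I_N, P i) (allN P).
Proof.
apply: (iffP allP) => h; first by move=> i; apply: h; rewrite mem_iota /=.
by move=> i; rewrite mem_iota /= => hi; exact: (h (Ordinal hi)).
Qed.
Lemma bitsP b : b \in bits (size b).
Proof. by elim: b => // b l IH; apply/allpairsP; exists (b, l); case: b. Qed.
End Compute.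

(** * Soundness of the certificates *)

Section Game.
Local Open Scope ring_scope.
Variables (X : sl_type) (HX : valid_type X).
Local Notation D := (datumX HX).
Variables (W : coxgrp D) (S : diagaut W).
Local Notation N := (rk D).
Local Notation V := 'rV[int]_N.
Local Notation al := (@al D).
Local Notation s := (cs W).
Local Notation sg := (sg S).
Local Notation tw := (@tw D W S).
Local Notation twV := (@twV D W S).
Local Notation cj := (@cj D W S).
Local Notation skew := (@skew D W S).
Implicit Types (i j k : 'I_N) (w v : cg W) (st : state).

Definition repr (f : V -> V) m := forall i j, f (al i) 0 j = ent m i j.
Definition rep w st := repr (tw w) st.1 /\ repr (twV w) st.2.
Definition lin (f : V -> V) := forall x a z, f (x - a *: z) = f x - a *: f z.

Lemma hi_alX i : B (hi D) (al i) = (polar X i)%:Z.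
Proof. by rewrite -hiX_al. Qed.
Lemma si_coord k (x : V) j : @si D k x 0 j =
  if j == k then x 0 j - \sum_i x 0 i * cartc X i k else x 0 j.
Proof.
rewrite si_eq !coE al_coord eq_sym B_expandl; case: eqP => [->|_]; last by rewrite mulr0 subr0.
by rewrite mulr1; congr (_ - _); apply: eq_bigr => i _; rewrite B_alX.
Qed.
Lemma repr_L f m k : repr f m -> repr (fun x => @si D k (f x)) (reflL X k m).
Proof.
move=> h i j; rewrite si_coord ent_mkmat rowsumE -val_eqE /= -h; case: eqP => // _.
by congr (_ - _); apply: eq_bigr => l _; rewrite h.
Qed.
Lemma repr_R f m k : lin f -> repr f m -> repr (fun x => f (@si D k x)) (reflR X k m).
Proof. by move=> lf h i j; rewrite si_eq B_alX lf !coE !h ent_mkmat. Qed.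
Lemma lin_tw w : lin (tw w). Proof. by move=> x a z; rewrite twD twN twZ. Qed.
Lemma lin_twV w : lin (twV w).
Proof. by move=> x a z; apply: twV_eq; rewrite lin_tw !twVK. Qed.
Lemma repr_ext f g m : f =1 g -> repr f m -> repr g m.
Proof. by move=> e h i j; rewrite -e h. Qed.

Lemma rep_L w st k : rep w st -> rep (s k * w)%g (stL X k st).
Proof.
case=> h h'; split; first by apply: repr_ext (repr_L k h) => x; rewrite tw_sl.
by apply: repr_ext (repr_R k (@lin_twV w) h') => x; rewrite tw_slE.
Qed.
Lemma rep_R w st k : rep w st -> rep (w * s (sg k))%g (stR X k st).
Proof.
case=> h h'; split; first by apply: repr_ext (repr_R k (@lin_tw w) h) => x; rewrite tw_sr.
by apply: repr_ext (repr_L k h') => x; rewrite tw_srE.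
Qed.
Lemma rep_C w st k : rep w st -> rep (cj k w) (stC X k st).
Proof. by move=> h; rewrite /cj -mulgA; apply/rep_L/rep_R. Qed.

Lemma rowposE f m i : repr f m -> rowpos X m i = @pos D (f (al i)).
Proof. by move=> h; apply/allNP/posP => h' j; have := h' j; rewrite h. Qed.
Lemma rowfixE f m i : repr f m -> rowfix X m i = (f (al i) == al i).
Proof.
move=> h; apply/allNP/eqP => [h'|e j]; last by rewrite -h e al_coord.
by apply: vecP => j; rewrite h al_coord; apply/eqP/h'.
Qed.
Lemma rownegE f m i : repr f m -> rowneg X m i = (f (al i) == - al i).
Proof.
move=> h; apply/allNP/eqP => [h'|e j]; last by rewrite -h e coN al_coord.
by apply: vecP => j; rewrite h coN al_coord; apply/eqP/h'.
Qed.
Lemma skewE w st i : rep w st -> st_skew X st i = skew w i.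
Proof. by case=> h _; rewrite /st_skew (rowfixE _ h) (rownegE _ h). Qed.
Lemma tw_sum w x : tw w x = \sum_i x 0 i *: tw w (al i).
Proof.
rewrite {1}(vec_sum x); elim/big_rec2: _ => [|i a b _ <-]; last by rewrite twD twZ.
by have := twZ S w 0 0; rewrite !scale0r.
Qed.
Lemma oddE w st : rep w st -> st_odd X st = oddz (B (hi D) (tw w (hi D))).
Proof.
case=> h _; rewrite /st_odd rowsumE; congr oddz; rewrite BC B_expandl; apply: eq_bigr => j _.
rewrite BC hi_alX mulrC; congr (_ * _); rewrite rowsumE.
by rewrite tw_sum summxE; apply: eq_bigr => i _; rewrite coZ h mxE.
Qed.

Variable Y : cg W -> Prop.
Hypothesis clY : disp_closed S Y.
Hypothesis Yhi : forall w, Y w -> ~~ oddz (B (hi D) (tw w (hi D))).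

Lemma check_sound c w st : rep w st -> check X c st -> ~ Y w.
Proof.
elim: c w st => [|i c IH|i c IH|i c IH|i c IH c' IH'] w st h /=.
- by rewrite (oddE h) => o /Yhi; rewrite o.
- case/and4P=> lt; pose k : 'I_N := Ordinal lt; rewrite -[i]/(nat_of_ord k) (skewE _ h) => sk.
  rewrite (rowposE _ h.1) (rowposE _ h.2) => ps ck Yw; apply: IH (rep_C k h) ck _.
  case p1 : (pos (tw w (al k))) ps; case p2 : (pos (twV w (al k))) => // _.
  + exact: dc_up clY _ _ Yw sk p1 p2.
  + by have [] := dc_mixl clY Yw sk p1 (negbT p2).
  + by have [] := dc_mixr clY Yw sk (negbT p1) p2.
- case/and5P=> lt; pose k : 'I_N := Ordinal lt; rewrite -[i]/(nat_of_ord k) (skewE _ h) => sk.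
  rewrite (rowposE _ h.1) (rowposE _ h.2) => p1 p2 ck Yw; apply: IH (rep_L k h) ck _.
  by have [] := dc_mixr clY Yw sk p1 p2.
- case/and5P=> lt; pose k : 'I_N := Ordinal lt; rewrite -[i]/(nat_of_ord k) (skewE _ h) => sk.
  rewrite (rowposE _ h.1) (rowposE _ h.2) => p1 p2 ck Yw; apply: IH (rep_R k h) ck _.
  by have [] := dc_mixl clY Yw sk p1 p2.
- case/and4P=> lt; pose k : 'I_N := Ordinal lt; rewrite -[i]/(nat_of_ord k) (skewE _ h) => sk ck ck' Yw.
  case: (dc_weak clY Yw sk) => [Yc|[Yl Yr]]; first exact: IH (rep_C k h) ck Yc.
  case: ifP ck' => ck' ck''; first exact: IH' (rep_L k h) ck' Yl.
  exact: IH' (rep_R k h) ck'' Yr.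
Qed.

Lemma vec_ind (Q : V -> Prop) : (forall x z, Q x -> Q z -> Q (x + z)) ->
  (forall a i, Q (a *: al i)) -> forall x, Q x.
Proof.
move=> QD Qa x; have Q0 : Q 0 by have := Qa 0 (Ordinal (ltnW (rk_gt1 D))); rewrite scale0r.
by rewrite (vec_sum x); elim/big_ind: _.
Qed.
Lemma gramE w st i j : rep w st -> gram X st.1 i j = B (al i) (tw w (al j)).
Proof.
case=> h _; rewrite /gram rowsumE BC B_expandl; apply: eq_bigr => l _.
by rewrite h B_alX.
Qed.
Lemma good_sound w st : rep w st -> st_good X st -> good S w.
Proof.
move=> h /allNP g r _.
have gd i : ~~ oddz (B (al i) (tw w (al i))) by have /andP[] := g i; rewrite (gramE _ _ h).
have go i j : ~~ oddz (B (al i) (tw w (al j)) + B (al j) (tw w (al i))).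
  by have /andP[_ /allNP/(_ j)] := g i; rewrite !(gramE _ _ h).
have mixed x z : ~~ oddz (B x (tw w z) + B z (tw w x)).
  elim/vec_ind: x => [x x' e e'|a i].
    rewrite twD BDl BDr addrACA oddzD negb_add; move: e e'; by case: oddz; case: oddz.
  elim/vec_ind: z => [z z' e e'|b j].
    by rewrite twD BDl BDr addrACA oddzD; move: e e'; case: oddz; case: oddz.
  rewrite !twZ !BE (_ : _ + _ = a * b * (B (al i) (tw w (al j)) + B (al j) (tw w (al i)))); last by ring.
  by rewrite oddzM (negPf (go i j)) andbF.
elim/vec_ind: r => [x z e e'|a i].
  rewrite twD !BE (_ : _ + _ = B x (tw w x) + B z (tw w z) + (B x (tw w z) + B z (tw w x))); last by ring.
  by rewrite oddzD (negPf (mixed x z)) oddzD (negPf e) (negPf e').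
by rewrite twZ !BE !oddzM (negPf (gd i)) !andbF.
Qed.

Lemma bad_sound t w st : rep w st -> all (gtn N) t ->
  st_odd X (foldl (fun st (k : nat) => stC X k st) st t) -> ~ good S w.
Proof.
elim: t w st => [|k t IH] w st h /=.
  by move=> _; rewrite (oddE h) => o g; have := g _ (root_hi D); rewrite o.
case/andP=> lt al_t o g; apply: IH (rep_C (Ordinal lt : 'I_N) h) al_t o _.
exact: good_cj.
Qed.

Lemma entry_sound e w st : rep w st -> check_entry X st e ->
  ~ ((Y w /\ ~ good S w) \/
     (good S w /\ exists i, skew w i /\ Y (s i * w)%g /\ Y (w * s (sg i))%g)).
Proof.
move=> h; case: e => [t c|l] /=.
  case/andP=> /andP[lt o] ck [[Yw _]|[g _]]; first exact: check_sound h ck Yw.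
  exact: bad_sound h lt o g.
case/andP=> /(good_sound h) g /allNP al [[_ /(_ g)]//|[_ [i [sk [Yl Yr]]]]].
have := al i; rewrite (skewE _ h) sk /= => /(has_nthP Odd)[c _].
case: ifP => ck ck'; first exact: check_sound (rep_L i h) ck Yl.
exact: check_sound (rep_R i h) ck' Yr.
Qed.

Lemma grow_sound b fuel m acc (t : seq 'I_N) :
  map val t = acc -> all b acc -> repr (act (wd W (rev t))) m ->
  exists t' : seq 'I_N, [/\ map val t' = (grow X b fuel m acc).2, all b (map val t') &
     repr (act (wd W (rev t'))) (grow X b fuel m acc).1].
Proof.
elim: fuel m acc t => [|f IH] m acc t e ab h /=; first by exists t; rewrite e.
case E : [seq k <- _ | _] => [|k l]; first by exists t; rewrite e.
have : k \in k :: l by rewrite mem_head.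
rewrite -E mem_filter mem_iota /= => /andP[/andP[bk _] lt].
apply: (IH _ _ ((Ordinal lt : 'I_N) :: t)); rewrite /= ?e ?bk //.
have la : lin (act (wd W (rev t))) by move=> x a z; rewrite actD actN actZ.
apply: repr_ext (repr_R (Ordinal lt : 'I_N) la h) => x.
by rewrite rev_cons -cats1 wd_cat wd1 actM act_s.
Qed.

Lemma longest_sound b acc : longest X b = Some acc ->
  exists t : seq 'I_N, [/\ map val t = acc, all b acc &
     forall i, b i -> ~~ pos (act (wd W (rev t)) (al i))].
Proof.
rewrite /longest; case: ifP => // /allNP neg [<-].
have [|||t [e ab h]] := @grow_sound b (N * N * 2) (idmat X) [::] [::] => //.
  by move=> i j; rewrite ent_mkmat wd_nil act1 al_coord.
exists t; rewrite -e; split=> // i bi; have := neg i; rewrite bi /=.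
by rewrite (rowposE _ h).
Qed.

Lemma rep_wordR w st (t : seq 'I_N) : rep w st ->
  rep (w * wd W (map sg t))%g (foldl (fun st (k : nat) => stR X k st) st (map val t)).
Proof.
elim: t w st => [|k t IH] w st h /=; first by rewrite wd_nil mulg1.
by rewrite wd_cons mulgA; apply/IH/rep_R.
Qed.
Lemma rep_wordL w st (t : seq 'I_N) : rep w st ->
  rep (wd W t * w)%g (foldr (stL X) st (map val t)).
Proof.
move=> h; elim: t => [|k t IH] /=; first by rewrite wd_nil mul1g.
by rewrite wd_cons -mulgA; apply: rep_L.
Qed.

Lemma actw_outside (b : pred 'I_N) (t : seq 'I_N) x i : all b t -> ~~ b i ->
  actw t x 0 i = x 0 i.
Proof.
elim: t => //= k t IH /andP[bk bt] bi; rewrite si_coord; case: eqP => [e|_]; last exact: IH.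
by rewrite e bk in bi.
Qed.

(* Let [K] be the set of simple roots fixed by [tw v].  Composed with the longest element of
   the parabolic subgroup of [K], [tw v] sends every simple root to a negative one. *)
Lemma maxtype_word v (t tK : seq 'I_N) : maxtype S v ->
  (forall i, ~~ pos (act (wd W (rev t)) (al i))) ->
  all (fun i => tw v (al i) == al i) tK ->
  (forall i, tw v (al i) == al i -> ~~ pos (act (wd W (rev tK)) (al i))) ->
  v = (wd W t * wd W (map sg tK))%g.
Proof.
move=> mt neg allK negK; set u := wd W (rev tK) in negK.
pose K i := tw v (al i) == al i.
have fixK (x : V) : (forall i, ~~ K i -> x 0 i = 0) -> tw v x = x.
  move=> h; rewrite tw_sum [RHS](vec_sum x); apply: eq_bigr => i _.
  by case: (boolP (K i)) => [/eqP ->|/h ->] //; rewrite !scale0r.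
have uout x i : ~~ K i -> act u x 0 i = x 0 i.
  by move=> nK; rewrite act_wd (@actw_outside K) // all_rev.
have down j : ~~ pos (tw v (act u (al j))).
  apply/negP => ps; case: (boolP (K j)) => [Kj|nKj].
    have e : tw v (act u (al j)) = act u (al j).
      apply: fixK => i nKi; rewrite uout // al_coord; case: eqP => // e.
      by rewrite -e Kj in nKi.
    by rewrite e (negPf (negK _ Kj)) in ps.
  case: (mt j) => [/eqP|[]]; first exact/negP.
  rewrite -root_posN ?root_tw ?root_al // => /posP p1 _.
  (* For j outside K, the difference u(al j) - al j is supported on K and therefore fixed. If the
     sum were positive, the negative root tw v (al j) would have no coordinate outside K; being
     fixed by tw v, it would equal [al j]. *)
  have e1 : tw v (act u (al j)) = tw v (al j) + (act u (al j) - al j).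
    rewrite -[in LHS](subrK (al j) (act u (al j))) addrC twD (fixK (_ - _)) //.
    by move=> i nKi; rewrite coD coN uout // subrr.
  have out i : ~~ K i -> tw v (al j) 0 i = 0.
    move=> nKi; have := posP _ ps i; have := p1 i.
    by rewrite e1 !coE uout // subrr addr0; lia.
  by case/negP: nKj; apply/eqP/(can_inj (twK S v)); rewrite (fixK _ out).
have flip (x : V) : pos x -> root x -> ~~ pos (act (wd W (rev t)) x).
  move=> /posP px rx; rewrite -root_posN ?root_act //.
  apply/posP => i; rewrite act_sum coN summxE oppr_ge0.
  apply: sumr_le0 => j _; rewrite coZ; apply: mulr_ge0_le0 => //.
  have := neg j; rewrite -root_posN ?root_act ?root_al // => /posP/(_ i).
  by rewrite coN oppr_ge0.
(* The composite tw v u makes every simple root negative and w_0 makes it positive again; an element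
   keeping all simple roots positive is trivial. *)
have e : (wd W (rev t) * v * ph S u)%g = 1%g.
  apply: all_pos_eq1 => i; rewrite -(permKV sg i) -psi_al !actM -psi_act.
  rewrite -/(tw v _) -[X in act _ X]opprK actN root_posN ?root_act ?root_N ?root_tw ?root_act ?root_al //.
  by apply: flip; rewrite ?root_N ?root_tw ?root_act ?root_al // root_posN ?root_tw ?root_act ?root_al.
have eu : (ph S u * wd W (map sg tK) = 1)%g.
  have -> : wd W (map sg tK) = ph S (wd W tK).
    elim: (tK) => [|k l IH] /=; first by rewrite !wd_nil ph1.
    by rewrite !wd_cons phM ph_s IH.
  by rewrite -phM /u wd_rev mulVg ph1.
have := congr1 (fun g => wd W t * g * wd W (map sg tK))%g e.
by rewrite wd_rev mulg1 => <-; rewrite !mulgA mulgV mul1g -mulgA eu mulg1.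
Qed.

Lemma rep_start p : p = [seq val (sg i) | i <- enum 'I_N] -> rep 1%g (start X p).
Proof.
have nthp i : nth 0%N [seq val (sg i) | i <- enum 'I_N] i = sg i.
  by rewrite (nth_map i) ?size_enum_ord // nth_ord_enum.
move=> ->; split=> i j; rewrite ent_mkmat nthp.
  by rewrite /tw act1 psi_al al_coord.
by rewrite /twV invg1 act1 psiV_coord al_coord eq_sym.
Qed.

Lemma sigmas_sound : [seq val (sg i) | i <- enum 'I_N] \in sigmas X (rank X).
Proof.
pose p := [seq val (sg i) | i <- enum 'I_N].
have sp : size p = rank X by rewrite size_map size_enum_ord.
have nthp i : nth 0%N p i = sg i by rewrite (nth_map i) ?size_enum_ord // nth_ord_enum.
rewrite -/p -{1}(take_oversize (eq_leq sp)); move: (leqnn (rank X)); move: {1 3 4}(rank X) => m.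
elim: m => [|m IH] mN; first by rewrite take0 mem_head.
rewrite (take_nth 0%N) ?sp //=; apply/allpairsPdep; exists (take m p), (nth 0%N p m).
split=> //; first exact/IH/ltnW.
rewrite mem_filter mem_iota /=; have em : m = Ordinal (mN : (m < N)%N) by [].
rewrite {2 4}em nthp (ltn_ord (sg _)) andbT -{1}em -nthp -em; apply/andP; split.
  have up : uniq p by rewrite map_inj_uniq ?enum_uniq // => i j /val_inj/perm_inj.
  by rewrite -(cat_take_drop m.+1 p) (take_nth 0%N) ?sp // cat_uniq rcons_uniq in up; case/andP: up => /andP[].
apply/allP => i; rewrite mem_iota /= add0n => im.
have iN : (i < N)%N := ltn_trans im mN.
rewrite nth_take // -[i]/(val (Ordinal iN)) !em !nthp.
by rewrite -(sg_adj S (Ordinal iN) (Ordinal mN)).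
Qed.

(** A bad element would produce, by [max_bad], an element v of the rigid form. By [maxtype_word] it
    is the candidate computed from the diagram automorphism and the set of simple roots it fixes,
    and the corresponding entry refutes both outcomes of [max_bad]. *)
Theorem game_good T : check_all X T -> forall w, Y w -> good S w.
Proof.
rewrite /check_all; case E0 : longest => [w0|] // ck w Yw; apply: NNPP => ng.
have [v [mt bad]] := max_bad clY Yw ng.
have [t [et _ neg]] := longest_sound E0.
pose p := [seq val (sg i) | i <- enum 'I_N].
pose K := [seq tw v (al i) == al i | i <- enum 'I_N].
have nthK i : nth false K i = (tw v (al i) == al i).
  by rewrite (nth_map i) ?size_enum_ord // nth_ord_enum.
have KN : K \in bits (rank X).
  by have := bitsP K; rewrite size_map size_enum_ord.
have := allP (allP ck _ sigmas_sound) _ KN; rewrite /check_case -/p.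
case EK : longest => [wK|] //; have [tK [eK aK negK]] := longest_sound EK.
have ev : v = (wd W t * wd W (map sg tK))%g.
  apply: maxtype_word => // [i||i]; first exact: neg.
    by move: aK; rewrite -eK all_map; apply: sub_all => i /=; rewrite nthK.
  by rewrite -nthK => /negK.
have h : rep v (foldl (fun st (k : nat) => stR X k st) (foldr (stL X) (start X p) w0) wK).
  rewrite ev -et -eK; apply: rep_wordR; rewrite -[wd W t]mulg1.
  exact/rep_wordL/rep_start.
set st := foldl _ _ _ in h *.
have -> /= : allN X (fun i : nat => nth false K i == rowfix X st.1 i).
  by apply/allNP => i; rewrite (rowfixE _ h.1) nthK.
case/(has_nthP (p, K, Good [::]))=> n _; case: ifP => // _ /(entry_sound h); exact.
Qed.
End Game.

(* The certificates were found by computer search.  The entries are indexed by a diagram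
   automorphism and the set of the simple roots fixed by the type. *)
Definition entries X (p : seq nat) (l : seq (seq nat * entry)) : seq (seq nat * bitseq * entry) :=
  [seq (p, [seq k \in e.1 | k <- iota 0 (rank X)], e.2) | e <- l].

Definition game_D4 :=
  entries (TD 4) [:: 0; 1; 2; 3] [::
    ([::], Good [::]);
    ([:: 0], Bad [:: 1] (Br 1 Odd Odd));
    ([:: 1], Bad [::] Odd);
    ([:: 2], Bad [:: 1] (Br 1 Odd Odd));
    ([:: 3], Bad [:: 1] (Br 1 Odd Odd));
    ([:: 0; 2], Good [:: Odd]);
    ([:: 0; 3], Good [:: Odd]);
    ([:: 2; 3], Good [:: Odd]);
    ([:: 0; 2; 3], Bad [:: 1] (Br 1 Odd Odd));
    ([:: 0; 1; 2; 3], Good [::])] ++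
  entries (TD 4) [:: 0; 1; 3; 2] [::
    ([::], Good [:: Br 1 Odd Odd]);
    ([:: 0], Bad [:: 1] (Br 1 Odd Odd));
    ([:: 1], Bad [::] Odd);
    ([:: 1; 2; 3], Good [:: Cj 1 Odd])] ++
  entries (TD 4) [:: 2; 1; 0; 3] [::
    ([::], Good [:: Br 1 Odd Odd]);
    ([:: 1], Bad [::] Odd);
    ([:: 3], Bad [:: 1] (Br 1 Odd Odd));
    ([:: 0; 1; 2], Good [:: Cj 1 Odd])] ++
  entries (TD 4) [:: 2; 1; 3; 0] [::
    ([::], Good [:: Br 1 Odd Odd]);
    ([:: 1], Bad [::] Odd)] ++
  entries (TD 4) [:: 3; 1; 0; 2] [::
    ([::], Good [:: Br 1 Odd Odd]);
    ([:: 1], Bad [::] Odd)] ++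
  entries (TD 4) [:: 3; 1; 2; 0] [::
    ([::], Good [:: Br 1 Odd Odd]);
    ([:: 1], Bad [::] Odd);
    ([:: 2], Bad [:: 1] (Br 1 Odd Odd));
    ([:: 0; 1; 3], Good [:: Cj 1 Odd])].

Definition game_E6 :=
  entries TE6 [:: 0; 1; 2; 3; 4; 5] [::
    ([::], Good [:: Br 2 (Cj 4 (Br 3 (Br 1 Odd Odd) (Br 1 Odd Odd))) (Br 3 (Br 1 Odd Odd) (Br 1 Odd Odd)); Br 3 (Br 1 Odd Odd) (Br 1 Odd Odd)]);
    ([:: 1], Bad [::] Odd);
    ([:: 3], Bad [:: 1] (Br 1 Odd Odd));
    ([:: 2; 3; 4], Bad [:: 0; 2; 3; 1] (Br 5 (Br 4 (Br 3 (Br 1 Odd Odd) (Cj 4 (Lm 3 (Br 1 Odd Odd)))) (Rm 3 (Br 1 Odd Odd))) (Cj 4 (Rm 3 (Br 1 Odd Odd)))));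
    ([:: 0; 2; 3; 4; 5], Bad [:: 1] (Br 1 Odd Odd));
    ([:: 0; 1; 2; 3; 4; 5], Good [::])] ++
  entries TE6 [:: 5; 1; 4; 3; 2; 0] [::
    ([::], Good [::]);
    ([:: 0], Bad [:: 2; 3; 1] (Br 2 (Br 3 (Br 1 Odd Odd) (Br 1 Odd Odd)) (Br 3 (Br 1 Odd Odd) (Br 1 Odd Odd))));
    ([:: 1], Bad [::] Odd);
    ([:: 2], Bad [:: 3; 1] (Br 3 (Br 1 Odd Odd) (Br 1 Odd Odd)));
    ([:: 3], Bad [:: 1] (Br 1 Odd Odd));
    ([:: 4], Bad [:: 3; 1] (Br 3 (Br 1 Odd Odd) (Br 1 Odd Odd)));
    ([:: 5], Bad [:: 4; 3; 1] (Br 4 (Br 3 (Br 1 Odd Odd) (Br 1 Odd Odd)) (Br 3 (Br 1 Odd Odd) (Br 1 Odd Odd))));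
    ([:: 0; 1], Bad [::] Odd);
    ([:: 0; 3], Bad [:: 1] (Br 1 Odd Odd));
    ([:: 0; 4], Bad [:: 3; 1] (Br 3 (Br 1 Odd Odd) (Br 1 Odd Odd)));
    ([:: 0; 5], Bad [:: 2; 3; 1] (Br 2 (Br 3 (Br 1 Odd Odd) (Br 1 Odd Odd)) (Br 3 (Br 1 Odd Odd) (Br 1 Odd Odd))));
    ([:: 1; 2], Bad [::] Odd);
    ([:: 1; 4], Bad [::] Odd);
    ([:: 1; 5], Bad [::] Odd);
    ([:: 2; 4], Bad [:: 0; 2; 3; 1] (Br 0 (Cj 2 (Br 3 (Br 1 Odd Odd) (Br 1 Odd Odd))) (Rm 2 (Br 3 (Br 1 Odd Odd) (Br 1 Odd Odd)))));
    ([:: 2; 5], Bad [:: 3; 1] (Br 3 (Br 1 Odd Odd) (Br 1 Odd Odd)));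
    ([:: 3; 5], Bad [:: 1] (Br 1 Odd Odd));
    ([:: 0; 1; 4], Bad [::] Odd);
    ([:: 0; 1; 5], Bad [::] Odd);
    ([:: 0; 3; 5], Bad [:: 1] (Br 1 Odd Odd));
    ([:: 1; 2; 4], Bad [::] Odd);
    ([:: 1; 2; 5], Bad [::] Odd);
    ([:: 1; 2; 3; 4], Good [:: Br 5 (Br 4 (Cj 2 (Br 3 (Br 1 Odd Odd) (Cj 1 Odd))) (Rm 2 (Cj 3 (Cj 1 Odd)))) (Rm 2 (Cj 3 (Cj 1 Odd))); Br 0 (Br 2 (Cj 4 (Br 3 (Br 1 Odd Odd) (Cj 1 Odd))) (Rm 4 (Cj 3 (Cj 1 Odd)))) (Lm 2 (Cj 3 (Cj 1 Odd)))])].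

Definition game_E7 :=
  entries TE7 [:: 0; 1; 2; 3; 4; 5; 6] [::
    ([::], Good [::]);
    ([:: 0], Bad [::] Odd);
    ([:: 1], Bad [:: 3; 2; 0] (Br 3 (Br 2 (Br 0 Odd Odd) (Br 0 Odd Odd)) (Br 2 (Br 0 Odd Odd) (Br 0 Odd Odd))));
    ([:: 2], Bad [:: 0] (Br 0 Odd Odd));
    ([:: 3], Bad [:: 2; 0] (Br 2 (Br 0 Odd Odd) (Br 0 Odd Odd)));
    ([:: 4], Bad [:: 3; 2; 0] (Br 3 (Br 2 (Br 0 Odd Odd) (Br 0 Odd Odd)) (Br 2 (Br 0 Odd Odd) (Br 0 Odd Odd))));
    ([:: 5], Bad [:: 4; 3; 2; 0] (Br 4 (Br 3 (Br 2 (Br 0 Odd Odd) (Br 0 Odd Odd)) (Br 2 (Br 0 Odd Odd) (Br 0 Odd Odd))) (Br 3 (Br 2 (Br 0 Odd Odd) (Br 0 Odd Odd)) (Br 2 (Br 0 Odd Odd) (Br 0 Odd Odd)))));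
    ([:: 6], Bad [:: 5; 4; 3; 2; 0] (Br 5 (Br 4 (Br 3 (Br 2 (Br 0 Odd Odd) (Br 0 Odd Odd)) (Br 2 (Br 0 Odd Odd) (Br 0 Odd Odd))) (Br 3 (Br 2 (Br 0 Odd Odd) (Br 0 Odd Odd)) (Br 2 (Br 0 Odd Odd) (Br 0 Odd Odd)))) (Br 4 (Br 3 (Br 2 (Br 0 Odd Odd) (Br 0 Odd Odd)) (Br 2 (Br 0 Odd Odd) (Br 0 Odd Odd))) (Br 3 (Br 2 (Br 0 Odd Odd) (Br 0 Odd Odd)) (Br 2 (Br 0 Odd Odd) (Br 0 Odd Odd))))));
    ([:: 0; 1], Bad [::] Odd);
    ([:: 0; 3], Bad [::] Odd);
    ([:: 0; 4], Bad [::] Odd);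
    ([:: 0; 5], Bad [::] Odd);
    ([:: 0; 6], Bad [::] Odd);
    ([:: 1; 2], Bad [:: 0] (Br 0 Odd Odd));
    ([:: 1; 4], Bad [:: 5; 4; 3; 2; 0] (Br 5 (Cj 4 (Br 3 (Br 2 (Br 0 Odd Odd) (Br 0 Odd Odd)) (Br 2 (Br 0 Odd Odd) (Br 0 Odd Odd)))) (Rm 4 (Br 3 (Br 2 (Br 0 Odd Odd) (Br 0 Odd Odd)) (Br 2 (Br 0 Odd Odd) (Br 0 Odd Odd))))));
    ([:: 1; 5], Bad [:: 3; 2; 0] (Br 3 (Br 2 (Br 0 Odd Odd) (Br 0 Odd Odd)) (Br 2 (Br 0 Odd Odd) (Br 0 Odd Odd))));
    ([:: 1; 6], Bad [:: 3; 2; 0] (Br 3 (Br 2 (Br 0 Odd Odd) (Br 0 Odd Odd)) (Br 2 (Br 0 Odd Odd) (Br 0 Odd Odd))));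
    ([:: 2; 4], Bad [:: 0] (Br 0 Odd Odd));
    ([:: 2; 5], Bad [:: 0] (Br 0 Odd Odd));
    ([:: 2; 6], Bad [:: 0] (Br 0 Odd Odd));
    ([:: 3; 5], Bad [:: 2; 0] (Br 2 (Br 0 Odd Odd) (Br 0 Odd Odd)));
    ([:: 3; 6], Bad [:: 2; 0] (Br 2 (Br 0 Odd Odd) (Br 0 Odd Odd)));
    ([:: 4; 6], Bad [:: 3; 2; 0] (Br 3 (Br 2 (Br 0 Odd Odd) (Br 0 Odd Odd)) (Br 2 (Br 0 Odd Odd) (Br 0 Odd Odd))));
    ([:: 0; 1; 4], Bad [::] Odd);
    ([:: 0; 1; 5], Bad [::] Odd);
    ([:: 0; 1; 6], Bad [::] Odd);
    ([:: 0; 3; 5], Bad [::] Odd);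
    ([:: 0; 3; 6], Bad [::] Odd);
    ([:: 0; 4; 6], Bad [::] Odd);
    ([:: 1; 2; 4], Bad [:: 0] (Br 0 Odd Odd));
    ([:: 1; 2; 5], Bad [:: 0] (Br 0 Odd Odd));
    ([:: 1; 2; 6], Bad [:: 0] (Br 0 Odd Odd));
    ([:: 1; 4; 6], Good [:: Br 2 (Br 0 Odd Odd) (Br 0 Odd Odd); Br 3 (Br 1 (Cj 4 (Cj 3 (Br 2 (Br 0 Odd Odd) (Br 0 Odd Odd)))) (Cj 3 (Br 2 (Br 0 Odd Odd) (Br 0 Odd Odd)))) (Rm 1 (Br 2 (Br 0 Odd Odd) (Br 0 Odd Odd)))]);
    ([:: 2; 4; 6], Bad [:: 0] (Br 0 Odd Odd));
    ([:: 0; 1; 4; 6], Bad [::] Odd);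
    ([:: 1; 2; 3; 4], Good [:: Odd; Br 0 (Br 2 (Br 3 (Br 1 (Cj 4 (Cj 3 (Cj 2 (Cj 0 Odd)))) (Cj 3 (Cj 2 (Cj 0 Odd)))) (Rm 1 (Cj 2 (Cj 0 Odd)))) (Rm 3 (Rm 4 (Cj 0 Odd)))) Odd]);
    ([:: 1; 2; 4; 6], Bad [:: 0] (Br 0 Odd Odd));
    ([:: 1; 2; 3; 4; 6], Bad [:: 5; 4; 3; 2; 0] (Br 5 (Br 4 (Br 3 (Br 2 (Br 0 Odd Odd) (Cj 3 (Lm 2 (Br 0 Odd Odd)))) (Rm 2 (Br 0 Odd Odd))) (Cj 3 (Rm 2 (Br 0 Odd Odd)))) (Cj 4 (Cj 3 (Rm 2 (Br 0 Odd Odd))))));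
    ([:: 1; 2; 3; 4; 5; 6], Bad [:: 0] (Br 0 Odd Odd));
    ([:: 0; 1; 2; 3; 4; 5; 6], Good [::])].

Definition game_E8 :=
  entries TE8 [:: 0; 1; 2; 3; 4; 5; 6; 7] [::
    ([::], Good [::]);
    ([:: 0], Bad [:: 2; 3; 4; 5; 6; 7] (Br 2 (Br 3 (Br 4 (Br 5 (Br 6 (Br 7 Odd Odd) (Br 7 Odd Odd)) (Br 6 (Br 7 Odd Odd) (Br 7 Odd Odd))) (Br 5 (Br 6 (Br 7 Odd Odd) (Br 7 Odd Odd)) (Br 6 (Br 7 Odd Odd) (Br 7 Odd Odd)))) (Br 4 (Br 5 (Br 6 (Br 7 Odd Odd) (Br 7 Odd Odd)) (Br 6 (Br 7 Odd Odd) (Br 7 Odd Odd))) (Br 5 (Br 6 (Br 7 Odd Odd) (Br 7 Odd Odd)) (Br 6 (Br 7 Odd Odd) (Br 7 Odd Odd))))) (Br 3 (Br 4 (Br 5 (Br 6 (Br 7 Odd Odd) (Br 7 Odd Odd)) (Br 6 (Br 7 Odd Odd) (Br 7 Odd Odd))) (Br 5 (Br 6 (Br 7 Odd Odd) (Br 7 Odd Odd)) (Br 6 (Br 7 Odd Odd) (Br 7 Odd Odd)))) (Br 4 (Br 5 (Br 6 (Br 7 Odd Odd) (Br 7 Odd Odd)) (Br 6 (Br 7 Odd Odd) (Br 7 Odd Odd))) (Br 5 (Br 6 (Br 7 Odd Odd) (Br 7 Odd Odd)) (Br 6 (Br 7 Odd Odd) (Br 7 Odd Odd)))))));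
    ([:: 1], Bad [:: 3; 4; 5; 6; 7] (Br 3 (Br 4 (Br 5 (Br 6 (Br 7 Odd Odd) (Br 7 Odd Odd)) (Br 6 (Br 7 Odd Odd) (Br 7 Odd Odd))) (Br 5 (Br 6 (Br 7 Odd Odd) (Br 7 Odd Odd)) (Br 6 (Br 7 Odd Odd) (Br 7 Odd Odd)))) (Br 4 (Br 5 (Br 6 (Br 7 Odd Odd) (Br 7 Odd Odd)) (Br 6 (Br 7 Odd Odd) (Br 7 Odd Odd))) (Br 5 (Br 6 (Br 7 Odd Odd) (Br 7 Odd Odd)) (Br 6 (Br 7 Odd Odd) (Br 7 Odd Odd))))));
    ([:: 2], Bad [:: 3; 4; 5; 6; 7] (Br 3 (Br 4 (Br 5 (Br 6 (Br 7 Odd Odd) (Br 7 Odd Odd)) (Br 6 (Br 7 Odd Odd) (Br 7 Odd Odd))) (Br 5 (Br 6 (Br 7 Odd Odd) (Br 7 Odd Odd)) (Br 6 (Br 7 Odd Odd) (Br 7 Odd Odd)))) (Br 4 (Br 5 (Br 6 (Br 7 Odd Odd) (Br 7 Odd Odd)) (Br 6 (Br 7 Odd Odd) (Br 7 Odd Odd))) (Br 5 (Br 6 (Br 7 Odd Odd) (Br 7 Odd Odd)) (Br 6 (Br 7 Odd Odd) (Br 7 Odd Odd))))));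
    ([:: 3], Bad [:: 4; 5; 6; 7] (Br 4 (Br 5 (Br 6 (Br 7 Odd Odd) (Br 7 Odd Odd)) (Br 6 (Br 7 Odd Odd) (Br 7 Odd Odd))) (Br 5 (Br 6 (Br 7 Odd Odd) (Br 7 Odd Odd)) (Br 6 (Br 7 Odd Odd) (Br 7 Odd Odd)))));
    ([:: 4], Bad [:: 5; 6; 7] (Br 5 (Br 6 (Br 7 Odd Odd) (Br 7 Odd Odd)) (Br 6 (Br 7 Odd Odd) (Br 7 Odd Odd))));
    ([:: 5], Bad [:: 6; 7] (Br 6 (Br 7 Odd Odd) (Br 7 Odd Odd)));
    ([:: 6], Bad [:: 7] (Br 7 Odd Odd));
    ([:: 7], Bad [::] Odd);
    ([:: 0; 1], Bad [:: 3; 4; 5; 6; 7] (Br 3 (Br 4 (Br 5 (Br 6 (Br 7 Odd Odd) (Br 7 Odd Odd)) (Br 6 (Br 7 Odd Odd) (Br 7 Odd Odd))) (Br 5 (Br 6 (Br 7 Odd Odd) (Br 7 Odd Odd)) (Br 6 (Br 7 Odd Odd) (Br 7 Odd Odd)))) (Br 4 (Br 5 (Br 6 (Br 7 Odd Odd) (Br 7 Odd Odd)) (Br 6 (Br 7 Odd Odd) (Br 7 Odd Odd))) (Br 5 (Br 6 (Br 7 Odd Odd) (Br 7 Odd Odd)) (Br 6 (Br 7 Odd Odd) (Br 7 Odd Odd))))));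
    ([:: 0; 3], Bad [:: 4; 5; 6; 7] (Br 4 (Br 5 (Br 6 (Br 7 Odd Odd) (Br 7 Odd Odd)) (Br 6 (Br 7 Odd Odd) (Br 7 Odd Odd))) (Br 5 (Br 6 (Br 7 Odd Odd) (Br 7 Odd Odd)) (Br 6 (Br 7 Odd Odd) (Br 7 Odd Odd)))));
    ([:: 0; 4], Bad [:: 5; 6; 7] (Br 5 (Br 6 (Br 7 Odd Odd) (Br 7 Odd Odd)) (Br 6 (Br 7 Odd Odd) (Br 7 Odd Odd))));
    ([:: 0; 5], Bad [:: 6; 7] (Br 6 (Br 7 Odd Odd) (Br 7 Odd Odd)));
    ([:: 0; 6], Bad [:: 7] (Br 7 Odd Odd));
    ([:: 0; 7], Bad [::] Odd);
    ([:: 1; 2], Bad [:: 0; 2; 3; 4; 5; 6; 7] (Br 0 (Cj 2 (Br 3 (Br 4 (Br 5 (Br 6 (Br 7 Odd Odd) (Br 7 Odd Odd)) (Br 6 (Br 7 Odd Odd) (Br 7 Odd Odd))) (Br 5 (Br 6 (Br 7 Odd Odd) (Br 7 Odd Odd)) (Br 6 (Br 7 Odd Odd) (Br 7 Odd Odd)))) (Br 4 (Br 5 (Br 6 (Br 7 Odd Odd) (Br 7 Odd Odd)) (Br 6 (Br 7 Odd Odd) (Br 7 Odd Odd))) (Br 5 (Br 6 (Br 7 Odd Odd) (Br 7 Odd Odd)) (Br 6 (Br 7 Odd Odd) (Br 7 Odd Odd)))))) (Rm 2 (Br 3 (Br 4 (Br 5 (Br 6 (Br 7 Odd Odd) (Br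 7 Odd Odd)) (Br 6 (Br 7 Odd Odd) (Br 7 Odd Odd))) (Br 5 (Br 6 (Br 7 Odd Odd) (Br 7 Odd Odd)) (Br 6 (Br 7 Odd Odd) (Br 7 Odd Odd)))) (Br 4 (Br 5 (Br 6 (Br 7 Odd Odd) (Br 7 Odd Odd)) (Br 6 (Br 7 Odd Odd) (Br 7 Odd Odd))) (Br 5 (Br 6 (Br 7 Odd Odd) (Br 7 Odd Odd)) (Br 6 (Br 7 Odd Odd) (Br 7 Odd Odd))))))));
    ([:: 1; 4], Bad [:: 5; 6; 7] (Br 5 (Br 6 (Br 7 Odd Odd) (Br 7 Odd Odd)) (Br 6 (Br 7 Odd Odd) (Br 7 Odd Odd))));
    ([:: 1; 5], Bad [:: 6; 7] (Br 6 (Br 7 Odd Odd) (Br 7 Odd Odd)));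
    ([:: 1; 6], Bad [:: 7] (Br 7 Odd Odd));
    ([:: 1; 7], Bad [::] Odd);
    ([:: 2; 4], Bad [:: 5; 6; 7] (Br 5 (Br 6 (Br 7 Odd Odd) (Br 7 Odd Odd)) (Br 6 (Br 7 Odd Odd) (Br 7 Odd Odd))));
    ([:: 2; 5], Bad [:: 6; 7] (Br 6 (Br 7 Odd Odd) (Br 7 Odd Odd)));
    ([:: 2; 6], Bad [:: 7] (Br 7 Odd Odd));
    ([:: 2; 7], Bad [::] Odd);
    ([:: 3; 5], Bad [:: 6; 7] (Br 6 (Br 7 Odd Odd) (Br 7 Odd Odd)));
    ([:: 3; 6], Bad [:: 7] (Br 7 Odd Odd));
    ([:: 3; 7], Bad [::] Odd);
    ([:: 4; 6], Bad [:: 7] (Br 7 Odd Odd));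
    ([:: 4; 7], Bad [::] Odd);
    ([:: 5; 7], Bad [::] Odd);
    ([:: 0; 1; 4], Bad [:: 5; 6; 7] (Br 5 (Br 6 (Br 7 Odd Odd) (Br 7 Odd Odd)) (Br 6 (Br 7 Odd Odd) (Br 7 Odd Odd))));
    ([:: 0; 1; 5], Bad [:: 6; 7] (Br 6 (Br 7 Odd Odd) (Br 7 Odd Odd)));
    ([:: 0; 1; 6], Bad [:: 7] (Br 7 Odd Odd));
    ([:: 0; 1; 7], Bad [::] Odd);
    ([:: 0; 3; 5], Bad [:: 6; 7] (Br 6 (Br 7 Odd Odd) (Br 7 Odd Odd)));
    ([:: 0; 3; 6], Bad [:: 7] (Br 7 Odd Odd));
    ([:: 0; 3; 7], Bad [::] Odd);
    ([:: 0; 4; 6], Bad [:: 7] (Br 7 Odd Odd));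
    ([:: 0; 4; 7], Bad [::] Odd);
    ([:: 0; 5; 7], Bad [::] Odd);
    ([:: 1; 2; 4], Bad [:: 5; 6; 7] (Br 5 (Br 6 (Br 7 Odd Odd) (Br 7 Odd Odd)) (Br 6 (Br 7 Odd Odd) (Br 7 Odd Odd))));
    ([:: 1; 2; 5], Bad [:: 6; 7] (Br 6 (Br 7 Odd Odd) (Br 7 Odd Odd)));
    ([:: 1; 2; 6], Bad [:: 7] (Br 7 Odd Odd));
    ([:: 1; 2; 7], Bad [::] Odd);
    ([:: 1; 4; 6], Bad [:: 7] (Br 7 Odd Odd));
    ([:: 1; 4; 7], Bad [::] Odd);
    ([:: 1; 5; 7], Bad [::] Odd);
    ([:: 2; 4; 6], Bad [:: 7] (Br 7 Odd Odd));
    ([:: 2; 4; 7], Bad [::] Odd);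
    ([:: 2; 5; 7], Bad [::] Odd);
    ([:: 3; 5; 7], Bad [::] Odd);
    ([:: 0; 1; 4; 6], Bad [:: 7] (Br 7 Odd Odd));
    ([:: 0; 1; 4; 7], Bad [::] Odd);
    ([:: 0; 1; 5; 7], Bad [::] Odd);
    ([:: 0; 3; 5; 7], Bad [::] Odd);
    ([:: 1; 2; 3; 4], Good [:: Br 5 (Br 4 (Br 3 (Br 1 (Cj 2 (Cj 3 (Cj 4 (Cj 5 (Br 6 (Br 7 Odd Odd) (Br 7 Odd Odd)))))) (Cj 3 (Cj 4 (Cj 5 (Br 6 (Br 7 Odd Odd) (Br 7 Odd Odd)))))) (Rm 1 (Cj 4 (Cj 5 (Br 6 (Br 7 Odd Odd) (Br 7 Odd Odd)))))) (Rm 3 (Rm 2 (Cj 5 (Br 6 (Br 7 Odd Odd) (Br 7 Odd Odd)))))) (Cj 4 (Rm 3 (Rm 2 (Cj 4 (Br 6 (Br 7 Odd Odd) (Br 7 Odd Odd)))))); Br 6 (Br 7 Odd Odd) (Br 7 Odd Odd)]);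
    ([:: 1; 2; 4; 6], Bad [:: 7] (Br 7 Odd Odd));
    ([:: 1; 2; 4; 7], Bad [::] Odd);
    ([:: 1; 2; 5; 7], Bad [::] Odd);
    ([:: 1; 2; 3; 4; 6], Bad [:: 7] (Br 7 Odd Odd));
    ([:: 1; 2; 3; 4; 7], Bad [::] Odd);
    ([:: 1; 2; 3; 4; 5; 6], Bad [:: 0; 2; 3; 4; 5; 6; 7] (Br 0 (Br 2 (Br 3 (Br 4 (Br 5 (Br 6 (Br 7 Odd Odd) (Cj 5 (Lm 6 (Br 7 Odd Odd)))) (Rm 6 (Br 7 Odd Odd))) (Cj 5 (Rm 6 (Br 7 Odd Odd)))) (Cj 4 (Cj 5 (Rm 6 (Br 7 Odd Odd))))) (Cj 3 (Cj 4 (Cj 5 (Rm 6 (Br 7 Odd Odd)))))) (Cj 2 (Cj 3 (Cj 4 (Cj 5 (Rm 6 (Br 7 Odd Odd))))))));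
    ([:: 0; 1; 2; 3; 4; 5; 6], Bad [:: 7] (Br 7 Odd Odd));
    ([:: 0; 1; 2; 3; 4; 5; 6; 7], Good [::])].

Lemma check_D4 : check_all (TD 4) game_D4. Proof. by vm_compute. Qed.
Lemma check_E6 : check_all TE6 game_E6. Proof. by vm_compute. Qed.
Lemma check_E7 : check_all TE7 game_E7. Proof. by vm_compute. Qed.
Lemma check_E8 : check_all TE8 game_E8. Proof. by vm_compute. Qed.

(** * The spectrum of an automorphism *)

Section Main.
Local Open Scope ring_scope.

Lemma Dsp_closed (D : rootdatum) (W : coxgrp D) (S : diagaut W) (Bd : bldg W) th :
  bijective th -> (forall C E, @dl _ _ Bd (th C) (th E) = ph S (dl C E)) ->
  disp_closed S (@Dsp D W Bd th).
Proof.
move=> bij iso; split=> [w i Yw sk|_ i [C <-] sk p q|_ i [C <-] sk p q|_ i [C <-] sk p q].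
- exact: dsp_rule bij iso _ _ Yw sk.
- have [E [_ [_ [e _]]]] := dl_thick C i.
  by exists E; exact: dsp_up iso _ _ _ e sk p q.
- exact: dsp_mixedl iso _ _ sk p q.
- exact: dsp_mixedr bij iso _ _ sk p q.
Qed.

Lemma simply_laced_good X (HX : valid_type X) (W : coxgrp (datumX HX)) (S : diagaut W) Y :
  disp_closed S Y -> (forall w, Y w -> ~~ oddz (B (hi (datumX HX)) (tw S w (hi (datumX HX))))) ->
  forall w, Y w -> good S w.
Proof.
case: X HX W S Y => [m|m|||] HX W S Y.
- exact: typeA_good.
- case: m HX W S Y => // m HX W S Y; case: (ltnP 3 m) => m4; first exact: typeD_good.
  have m3 : m = 3%N by apply/eqP; rewrite eqn_leq m4 -ltnS; exact: HX.
  by subst m => cl hy; apply: game_good cl hy _ check_D4.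
- by move=> cl hy; apply: game_good cl hy _ check_E6.
- by move=> cl hy; apply: game_good cl hy _ check_E7.
- by move=> cl hy; apply: game_good cl hy _ check_E8.
Qed.

Lemma WJ_inJ X (HX : valid_type X) (W : coxgrp (datumX HX)) (w : cg W) :
  w \in @WJ X (cg W) (cs W) <-> inJ w.
Proof.
split=> [/gen_prodgP[m [c hc ->]]|[t]]; last first.
  elim: t w => [|i t IH] w /=; first by move=> _ ->; rewrite wd_nil group1.
  case/andP=> Ji Jt ->; rewrite wd_cons; apply: groupM; last exact: IH.
  by apply/mem_gen/imsetP; exists i; rewrite // inE -J_polar.
elim: m c hc => [|m IH] c hc; first by rewrite big_ord0; exact: inJ1.
rewrite big_ord_recl; have /imsetP[j] := hc ord0; rewrite inE => Jj ->.
by apply: inJ_s; [rewrite J_polar | apply: IH].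
Qed.

Section Translate.
Variables (X : sl_type) (HX : valid_type X) (W : coxgrp (datumX HX)) (Bd : bldg W).
Local Notation D := (datumX HX).
Implicit Types (C E : cham Bd).

Lemma same_pointE C E : same_point (cs W) (@dl _ _ Bd) C E <-> samept C E.
Proof. exact: WJ_inJ. Qed.
Lemma collinearE C E : collinear (cs W) (@dl _ _ Bd) C E <-> ppos C E = 1.
Proof.
rewrite -collP /coll /collinear -same_pointE; split=> -[ns [C' [E' [j]]]].
  case=> pj [/same_pointE h1 [/same_pointE h2 h3]]; split=> //; exists C', E', j.
  split=> //; first by rewrite J_polar negbK.
  (* The degenerate option, in which both points share a chamber, would make the points equal. *)
  case: h3 => // /dl1 e; case: ns; apply/same_pointE/(samept_trans h1).
  by rewrite e; exact: samept_sym.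
case=> Jj /same_pointE h1 /same_pointE h2 h3; split=> //; exists C', E', j.
by rewrite J_polar negbK in Jj; do !split=> //; right.
Qed.
Lemma pos2E C E : pos2' (cs W) (@dl _ _ Bd) C E <-> ppos C E = -1.
Proof.
rewrite -pos2P /pos2' -same_pointE.
have cE C1 E1 : collinear (cs W) (@dl _ _ Bd) C1 E1 <-> coll C1 E1 by rewrite collP collinearE.
split=> -[ns [nc [F [h1 [h2 h3]]]]]; split=> //; split; try by rewrite -?cE ?cE // => /cE.
  exists F; split; [exact/cE | split; [exact/cE|]].
  by move=> F' /cE h1' /cE h2'; apply/same_pointE/h3.
exists F; split; [exact/cE | split; [exact/cE|]].
by move=> F' /cE h1' /cE h2'; apply/same_pointE/h3.
Qed.
End Translate.
End Main.

Theorem theoremA (X : sl_type) (HX : valid_type X)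
  (W : finGroupType) (s : 'I_(rank X) -> W) (Hcox : coxeter_system s)
  (T : Type) (delta : T -> T -> W)
  (Hb : is_building s delta) (Hthick : thick s delta)
  (theta : T -> T) (sigma : {perm 'I_(rank X)}) (phi : W -> W)
  (Haut : building_aut s delta theta sigma phi) :
  uniclass delta theta phi <-> kangaroo_1_2' s delta theta.
Proof.
case: Hcox => gen rel univ; case: Haut => bij phiM phis iso.
pose D := datumX HX.
have rel' (i j : 'I_(rk D)) : ((s i * s j) ^+ coxm i j = 1)%g := rel i j.
pose W0 : coxgrp D := @CoxGrp D W s gen rel' univ.
pose Bd : bldg W0 := @Bldg D W0 T delta Hb Hthick.
pose S : diagaut W0 := @DiagAut D W0 sigma phi phiM phis.
have iso' (C E : cham Bd) : @dl _ _ Bd (theta C) (theta E) = ph S (@dl _ _ Bd C E) := iso C E.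
have odd_ppos (C : cham Bd) : oddz (B (hi D) (tw S (@dsp D W0 Bd theta C) (hi D)))
    = (ppos C (theta C : cham Bd) == 1%R) || (ppos C (theta C : cham Bd) == (-1)%R).
  by rewrite tw_hi oddz1 ?root_act ?root_hi.
split=> [uc C|kang].
  have := @uniclass_even D W0 S Bd theta bij iso' uc _ (hi D) (ex_intro _ C erefl) (root_hi D).
  rewrite odd_ppos => /norP[n1 n2]; split.
    by move/(@collinearE X HX W0 Bd)/eqP; exact/negP.
  by move/(@pos2E X HX W0 Bd)/eqP; exact/negP.
apply: (@even_uniclass D W0 S Bd theta iso') => w r Yw.
have cl := @Dsp_closed D W0 S Bd theta bij iso'.
apply: (@simply_laced_good X HX W0 S _ cl _ w Yw r) => _ [C <-].
have [n1 n2] := kang C; rewrite odd_ppos negb_or; apply/andP; split; apply/negP => /eqP.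
  by move/(@collinearE X HX W0 Bd).
by move/(@pos2E X HX W0 Bd).
Qed.
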